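(* Let $d\ge1$ and let $c(t)=(c_{ij}(t))$, $t\in\mathbb R$, be a symmetric $d\times d$ matrix with Borel measurable, locally bounded entries, such that $c(t)$ is non-negative definite for all $t$ and, for some integer $1\le p_0\le d$, $$\sum_{i,j=1}^d c_{ij}(t)\xi_i\xi_j\ \ge\ \sum_{j=1}^{p_0}\xi_j^2\qquad\text{for all }t\in\mathbb R,\ \xi\in\mathbb R^d.$$ Then for every $p\in(1,\infty)$ there is a constant $M_0=M_0(d,p,p_0)$ depending only on $d,p,p_0$ such that for all $u\in C_0^\infty(\mathbb R^{d+1})$ and all $i,j\in\{1,\dots,p_0\}$, $$\|u_{x_ix_j}\|_{L^p(\mathbb R^{d+1})}\le M_0\,\|u_t+Lu\|_{L^p(\mathbb R^{d+1})},$$ where $Lu(t,x)=\sum_{i,j=1}^d c_{ij}(t)u_{x_ix_j}(t,x)$.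
   Context: $L^p$ norms are with respect to Lebesgue measure on $\mathbb R^{d+1}$. The constant $M_0$ does not depend on the coefficients $c_{ij}$ (in particular no upper bound on $c$ is assumed). *)

(* Defs.v *)
From HB Require Import structures.
From mathcomp Require Import all_boot all_order all_algebra.
From mathcomp Require Import all_classical all_reals all_analysis.
Set Implicit Arguments. Unset Strict Implicit. Unset Printing Implicit Defensive.
Import Order.TTheory GRing.Theory Num.Theory.
Import numFieldNormedType.Exports.
Local Open Scope classical_set_scope.
Local Open Scope ring_scope.

Section Defs.
Variable R : realType.

(* Points of R^n are row vectors 'rV[R]_n.  For R^{d+1} = R_t x R^d_x we use
   'rV[R]_(d.+1): coordinate 0 is t, coordinate k.+1 is x_{k+1}. *)

Definition coord_vec (n : nat) (k : 'I_n) : 'rV[R]_n := delta_mx 0 k.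

Definition vcons (n : nat) (x : R) (v : 'rV[R]_n) : 'rV[R]_n.+1 :=
  \row_(i < n.+1) (if unlift ord0 i is Some j then v 0 j else x).

(* Iterated Lebesgue integral over R^n of an extended-real function
   (one coordinate at a time).  For non-negative measurable functions this is,
   by Tonelli, the Lebesgue integral on R^n. *)
Fixpoint iint (n : nat) : ('rV[R]_n -> \bar R) -> \bar R :=
  match n with
  | 0 => fun f => f 0
  | n'.+1 => fun f =>
      (\int[@lebesgue_measure R]_x iint (fun v : 'rV[R]_n' => f (vcons x v)))%E
  end.

Definition LpnormRn (n : nat) (p : R) (f : 'rV[R]_n -> R) : \bar R :=
  poweR (iint (fun v => ((`|f v| `^ p)%:E))) p^-1.

Fixpoint iter_partial (n : nat) (s : seq 'I_n) (f : 'rV[R]_n -> R)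
  : 'rV[R]_n -> R :=
  match s with
  | [::] => f
  | k :: s' => fun x => derive (iter_partial s' f) x (coord_vec k)
  end.

Definition smooth (n : nat) (f : 'rV[R]_n -> R) : Prop :=
  (forall s : seq 'I_n, continuous (iter_partial s f)) /\
  (forall (s : seq 'I_n) (k : 'I_n) (x : 'rV[R]_n),
      derivable (iter_partial s f) x (coord_vec k)).

Definition Cinf_c (n : nat) (f : 'rV[R]_n -> R) : Prop :=
  smooth f /\ compact (closure [set x | f x != 0]).

Definition dxx (d : nat) (i j : 'I_d) (u : 'rV[R]_d.+1 -> R) : 'rV[R]_d.+1 -> R :=
  iter_partial [:: lift ord0 i; lift ord0 j] u.

Definition dt (d : nat) (u : 'rV[R]_d.+1 -> R) : 'rV[R]_d.+1 -> R :=
  iter_partial [:: ord0] u.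

Definition Lop (d : nat) (c : 'I_d -> 'I_d -> R -> R) (u : 'rV[R]_d.+1 -> R)
  : 'rV[R]_d.+1 -> R :=
  fun z => \sum_(i < d) \sum_(j < d) c i j (z 0 ord0) * dxx i j u z.

End Defs.

(* Main.v *)
(** Polarisation reduces [u_{x_i x_j}] to second derivatives along [e = e_i +- e_j].
    Since [c >= e e^T / 4], a finite difference scheme for [u_t + L u] can be
    written as [U_{k+1} = Q (R_k U_k) + g_k] on a finite abelian group, where [Q] is
    the lazy walk average in the direction [e] and [R_k] is the convolution with a
    probability measure, read off a decomposition of [c - e e^T / 4] as a sum of
    rank one matrices.  The solution is affine in each [R_k], so by Jensen it
    suffices to bound [d_e^2 U] in l^p when all [R_k] are Dirac masses; a change of
    variables then removes them, and the equation decouples along the lines in the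
    direction [e].  The resulting one-dimensional discrete heat kernel is treated by
    Calderon-Zygmund theory: an energy estimate for [p = 2], the Hormander condition
    on dyadic parabolic boxes from moments of the binomial law, interpolation and
    duality.  Hence the constant depends on [p] only.  As the mesh tends to 0, sums
    over the lattice converge to integrals in [x]; in time, where [c] is merely
    measurable, one integrates the discrete estimate over the offset of the time
    grid instead. *)

Require Import Defs.
From HB Require Import structures.
From mathcomp Require Import all_boot all_order all_algebra.
From mathcomp Require Import ring lra zify.
From mathcomp Require Import all_classical all_reals all_analysis.
From mathcomp Require Import measurable_realfun.
Import Order.TTheory GRing.Theory Num.Theory.
Import numFieldNormedType.Exports.
Local Open Scope ring_scope.

Set Implicit Arguments.
Unset Strict Implicit.
Unset Printing Implicit Defensive.

(** * The discrete heat kernel *)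

(** The constant may not depend on the size of [c], so no kernel of the full operator is ever
    estimated: everything except the diffusion [e e^T / 4] must enter through translations, under
    which l^p norms are invariant. The walk in the direction [e] is lazy, so that its generating
    polynomial is the square of [(X + 1) / 2]. Its symbol is then non-negative, on which the energy
    estimate rests, and all kernel bounds become bounds on coefficient sums of
    [(X - 1)^k ((X + 1) / 2)^N]. The time step is [1 / n^2] and the walks move by order [1 / n], but
    the spatial mesh is [1 / (2 n^2)]: the rank one vectors have to be rounded to the lattice, and
    on this finer mesh the rounding error is of order [n^-3], negligible against the time step. The
    scheme marches backward from a time after the support of [u], as the sign of [u_t] requires.
    Bounds on [c] over a compact time interval and on the derivatives of [u] enter only the
    consistency errors, which vanish in the limit. *)

Section L1norm.
Variable R : realFieldType.
Implicit Types P Q : {poly R}.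

Definition l1norm P : R := \sum_(i < size P) `|P`_i|.

Lemma l1normE P N : (size P <= N)%N -> l1norm P = \sum_(i < N) `|P`_i|.
Proof.
move=> sPN; rewrite /l1norm -(subnKC sPN) big_split_ord /= [X in _ + X]big1 ?addr0//.
by move=> i _; rewrite nth_default ?normr0 ?leq_addr.
Qed.

Lemma l1norm_ge0 P : 0 <= l1norm P.
Proof. exact: sumr_ge0. Qed.

Lemma l1normD P Q : l1norm (P + Q) <= l1norm P + l1norm Q.
Proof.
rewrite (l1normE (N := maxn (size P) (size Q))) ?size_polyD //.
rewrite (l1normE (N := maxn (size P) (size Q)) (leq_maxl _ _)).
rewrite [l1norm Q](l1normE (N := maxn (size P) (size Q)) (leq_maxr _ _)) -big_split /=.
by apply: ler_sum => i _; rewrite coefD ler_normD.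
Qed.

Lemma l1normZ c P : l1norm (c *: P) = `|c| * l1norm P.
Proof.
rewrite (l1normE (size_scale_leq c P)) mulr_sumr.
by apply: eq_bigr => i _; rewrite coefZ normrM.
Qed.

Lemma l1normN P : l1norm (- P) = l1norm P.
Proof. by rewrite -scaleN1r l1normZ normrN1 mul1r. Qed.

Lemma l1norm0 : l1norm 0 = 0.
Proof. by rewrite /l1norm size_poly0 big_ord0. Qed.

Lemma l1normMXC P c : l1norm (P * 'X + c%:P) = l1norm P + `|c|.
Proof.
rewrite (l1normE (N := (size P).+1)); last first.
  by rewrite size_MXaddC; case: ifP => // _; rewrite leqnn.
rewrite big_ord_recl /= coefD coefMX coefC /= add0r addrC; congr (_ + _).
by apply: eq_bigr => i _; rewrite coefD coefMX coefC /= addr0.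
Qed.

Lemma l1normMX P : l1norm (P * 'X) = l1norm P.
Proof. by rewrite -[P * 'X]addr0 -polyC0 l1normMXC normr0 addr0. Qed.

Lemma l1normMXn P n : l1norm (P * 'X^n) = l1norm P.
Proof.
elim: n => [|n IH]; first by rewrite expr0 mulr1.
by rewrite exprSr mulrA l1normMX.
Qed.

Lemma l1norm1 : l1norm 1 = 1.
Proof. by rewrite -[1 in LHS]add0r -(mul0r 'X) -polyC1 l1normMXC l1norm0 add0r normr1. Qed.

Lemma l1normM P Q : l1norm (P * Q) <= l1norm P * l1norm Q.
Proof.
elim/poly_ind: P => [|P c IH]; first by rewrite mul0r l1norm0 mul0r.
rewrite mulrDl (le_trans (l1normD _ _))// l1normMXC mulrDl lerD//.
  by rewrite -mulrA [_ * Q]mulrC mulrA l1normMX.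
by rewrite mul_polyC l1normZ.
Qed.

(** Coefficients are indexed by all integers, zero at the negative ones, so that translates of a
    kernel need no side conditions. *)
Definition coefz P (m : int) : R := if m is Posz k then P`_k else 0.

Lemma sum_window_le (f : int -> R) N B (s : int) :
  (forall m, 0 <= f m) -> (forall k : nat, f (Negz k) = 0) ->
  (forall k : nat, (N <= k)%N -> f k%:Z = 0) ->
  \sum_(b < B) f (b%:Z + s) <= \sum_(i < N) f i%:Z.
Proof.
move=> f0 fneg fN.
have mono M : \sum_(i < M) f i%:Z <= \sum_(i < N) f i%:Z.
  case: (leqP M N) => [MN|/ltnW NM].
    rewrite -(subnKC MN) big_split_ord /= lerDl; exact: sumr_ge0.
  rewrite -(subnKC NM) big_split_ord /= [X in _ + X]big1 ?addr0// => i _.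
  by rewrite fN // leq_addr.
case: s => k.
  apply: le_trans (mono (k + B)%N); rewrite big_split_ord /= -[leLHS]add0r.
  apply: lerD; first exact: sumr_ge0.
  by apply: ler_sum => i _; rewrite -PoszD addnC.
apply: le_trans (mono (B - k.+1)%N).
elim: B => [|B IH]; first by rewrite !big_ord0.
rewrite big_ord_recr /=; case: (ltnP B k.+1) => Bk.
  have -> : (B%:Z + Negz k = Negz (k - B))%R by lia.
  rewrite fneg addr0 (le_trans IH)//.
  have -> : (B.+1 - k.+1 = 0)%N by lia.
  by have -> : (B - k.+1 = 0)%N by lia.
rewrite subSn // big_ord_recr /= lerD//.
by have -> : (B%:Z + Negz k = (B - k.+1)%:Z)%R by lia.
Qed.

Lemma sum_coefz_le P B (s : int) : \sum_(b < B) `|coefz P (b%:Z + s)| <= l1norm P.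
Proof.
apply: (@sum_window_le (fun m => `|coefz P m|) (size P)) => // [k|k sk] /=.
  by rewrite normr0.
by rewrite nth_default ?normr0.
Qed.

Lemma coefzB P Q m : coefz (P - Q) m = coefz P m - coefz Q m.
Proof. by case: m => k /=; rewrite ?coefB ?subr0. Qed.

Lemma coefzMXn P n m : coefz (P * 'X^n) m = coefz P (m - n%:Z).
Proof.
case: m => k /=; last by have -> : (Negz k - n%:Z = Negz (k + n))%R by lia.
rewrite coefMXn; case: ltnP => kn.
  by have -> : (k%:Z - n%:Z = Negz (n - k.+1))%R by lia.
by have -> : (k%:Z - n%:Z = (k - n)%:Z)%R by lia.
Qed.

(** [X^n - 1] telescopes into [n] shifted copies of [X - 1], and shifts preserve the norm: a
    translation by [n] costs at most [n] first differences. *)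
Lemma l1norm_mulXnB1 P n : l1norm (P * ('X^n - 1)) <= n%:R * l1norm (('X - 1) * P).
Proof.
elim: n => [|n IH]; first by rewrite expr0 subrr mulr0 l1norm0 mul0r.
have -> : P * ('X^(n.+1) - 1) = P * ('X^n - 1) + ('X - 1) * P * 'X^n.
  by rewrite exprS; ring.
rewrite (le_trans (l1normD _ _))// l1normMXn -natr1 [leRHS]mulrDl mul1r.
by rewrite lerD2r.
Qed.
End L1norm.

(** * Binomial weights, their moments and their differences *)

Section BinomialKernel.
Variable R : realFieldType.

Definition binw (L i : nat) : R := 'C(L, i)%:R / 2 ^+ L.

(** The expectation of [phi] at the position of the simple random walk after [L] steps of size one,
    [i] of them upward. *)
Definition binE (L : nat) (phi : R -> R) : R :=
  \sum_(i < L.+1) binw L i * phi (2 * i%:R - L%:R).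

Lemma binw_ge0 L i : 0 <= binw L i.
Proof. by rewrite divr_ge0 ?ler0n ?exprn_ge0. Qed.

Lemma binES L phi :
  binE L.+1 phi = 2^-1 * (binE L (fun x => phi (x - 1)) + binE L (fun x => phi (x + 1))).
Proof.
rewrite /binE big_ord_recl /= [X in _ * (X + _)]big_ord_recl [X in _ * (_ + X)]big_ord_recr /=.
under eq_bigr => i _.
  rewrite /bump /= add1n.
  have -> : binw L.+1 i.+1 = 2^-1 * binw L i.+1 + 2^-1 * binw L i.
    by rewrite /binw binS natrD exprS ?invfM; ring.
  rewrite mulrDl; over.
rewrite big_split /= [X in _ + (X + _) = _]big_ord_recr [X in _ + (_ + X) = _]big_ord_recr /=.
have -> : binw L.+1 0 = 2^-1 * binw L 0.
  by rewrite /binw !bin0 exprS ?invfM; ring.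
have -> : binw L L.+1 = 0 by rewrite /binw bin_small // mul0r.
under [X in _ + ((X + _) + _) = _]eq_bigr => i _ do rewrite -mulrA.
under [X in _ + (_ + (X + _)) = _]eq_bigr => i _ do rewrite -mulrA.
rewrite -!mulr_sumr.
have -> : 2 * 0%:R - L.+1%:R = 2 * 0%:R - L%:R - 1 :> R by rewrite -natr1; lra.
have -> : 2 * L.+1%:R - L.+1%:R = 2 * L%:R - L%:R + 1 :> R by rewrite -natr1; lra.
have -> : \sum_(i < L) binw L i.+1 * phi (2 * i.+1%:R - L.+1%:R) =
  \sum_(i < L) binw L (bump 0 i) * phi (2 * (bump 0 i)%:R - L%:R - 1).
  apply: eq_bigr => i _; rewrite /bump add1n; congr (_ * phi _).
  by rewrite -[L.+1%:R]natr1; lra.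
have -> : \sum_(i < L) binw L i * phi (2 * i.+1%:R - L.+1%:R) =
  \sum_(i < L) binw L i * phi (2 * i%:R - L%:R + 1).
  apply: eq_bigr => i _; congr (_ * phi _).
  by rewrite -!natr1; lra.
lra.
Qed.

Lemma binE_ext L phi psi : phi =1 psi -> binE L phi = binE L psi.
Proof. by move=> e; apply: eq_bigr => i _; rewrite e. Qed.

Lemma binED L phi psi : binE L (fun x => phi x + psi x) = binE L phi + binE L psi.
Proof. by rewrite -big_split; apply: eq_bigr => i _; rewrite mulrDr. Qed.

Lemma binEZ L c phi : binE L (fun x => c * phi x) = c * binE L phi.
Proof. by rewrite mulr_sumr; apply: eq_bigr => i _; rewrite mulrCA. Qed.

Lemma binE0 phi : binE 0 phi = phi 0.
Proof. by rewrite /binE big_ord1 /binw bin0 expr0 divr1 mul1r mulr0 subrr. Qed.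

Lemma binE1 L : binE L (fun=> 1) = 1.
Proof.
elim: L => [|L IH]; first by rewrite binE0.
by rewrite binES -binED (@binE_ext _ _ (fun=> 2 * 1)) ?binEZ ?IH; [lra|move=> x; ring].
Qed.

Lemma binE_sqr L : binE L (fun x => x ^+ 2) = L%:R.
Proof.
elim: L => [|L IH]; first by rewrite binE0 expr0n.
rewrite binES -binED (@binE_ext _ _ (fun x => 2 * x ^+ 2 + 2 * 1)); last by move=> x; ring.
by rewrite binED !binEZ IH binE1 -[L.+1%:R]natr1; lra.
Qed.

Lemma binE_pow4 L : binE L (fun x => x ^+ 4) = 3 * L%:R ^+ 2 - 2 * L%:R.
Proof.
elim: L => [|L IH]; first by rewrite binE0 !expr0n /=; lra.
rewrite binES -binED.
rewrite (@binE_ext _ _ (fun x => 2 * x ^+ 4 + (12 * x ^+ 2 + 2 * 1))); last by move=> x; ring.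
by rewrite !binED !binEZ IH binE_sqr binE1 -[L.+1%:R]natr1; lra.
Qed.

Definition halfX : {poly R} := 2^-1 *: ('X + 1).
Definition diffX : {poly R} := 'X - 1.

Lemma coef_halfX N i : (halfX ^+ N)`_i = binw N i.
Proof.
rewrite exprZn coefZ exprD1n coef_sum /binw mulrC exprVn; congr (_ / _).
under eq_bigr => j _ do rewrite coefMn coefXn.
case: (ltnP i N.+1) => iN; last first.
  rewrite bin_small // big1 // => j _; case: eqP => [ij|]; last by rewrite mul0rn.
  by have := ltn_ord j; rewrite -ij ltnNge iN.
rewrite (bigD1 (Ordinal iN)) //= eqxx big1 ?addr0 // => j ne.
by rewrite eq_sym (negbTE (_ : j != i :> nat)) ?mul0rn.
Qed.

Lemma size_halfX N : (size (halfX ^+ N) <= N.+1)%N.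
Proof.
apply/leq_sizeP => j jN; rewrite coef_halfX /binw bin_small ?mul0r //.
Qed.

Lemma l1norm_halfX N : l1norm (halfX ^+ N) = 1.
Proof.
rewrite (l1normE (size_halfX N)) -[RHS](binE1 N); apply: eq_bigr => i _.
by rewrite coef_halfX mulr1 ger0_norm ?binw_ge0.
Qed.

Lemma coef_diffX P i : (diffX * P)`_i = (if i is k.+1 then P`_k else 0) - P`_i.
Proof. by rewrite mulrBl mul1r coefB coefXM; case: i. Qed.

Lemma binw_shift N i : (N.+1)%:R * binw N i = 2 * (N.+1%:R - i%:R) * binw N.+1 i.
Proof.
rewrite /binw; case: (leqP i N.+1) => iN; last first.
  by rewrite !bin_small ?mul0r ?mulr0 //; lia.
have h : ((N.+1)%:R * 'C(N, i)%:R = (N.+1%:R - i%:R) * 'C(N.+1, i)%:R :> R).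
  by rewrite -natrB // -!natrM; congr (_%:R); exact: (mul_bin_down N.+1 i).
by rewrite mulrA h exprS; field; rewrite ?expf_neq0 ?pnatr_eq0 //.
Qed.

Lemma binw_shiftS N i : (N.+1)%:R * binw N i = 2 * i.+1%:R * binw N.+1 i.+1.
Proof.
have h : ((N.+1)%:R * 'C(N, i)%:R = i.+1%:R * 'C(N.+1, i.+1)%:R :> R).
  by rewrite -!natrM; congr (_%:R); rewrite -mul_bin_diag.
by rewrite /binw mulrA h exprS; field; rewrite ?expf_neq0 ?pnatr_eq0 //.
Qed.

(** Differencing binomial weights yields those of order [N + 1] times a polynomial of degree one, a
    discrete Hermite polynomial. Norms of differences thus become moments of the walk. *)
Lemma coef_diff_halfX N i :
  (N.+1)%:R * (diffX * halfX ^+ N)`_i = 2 * (binw N.+1 i * (2 * i%:R - N.+1%:R)).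
Proof.
rewrite coef_diffX coef_halfX mulrBr binw_shift; case: i => [|i].
  rewrite mulr0; lra.
rewrite coef_halfX binw_shiftS; lra.
Qed.

Lemma coef_diff2_halfX N i :
  (N.+1)%:R * N.+2%:R * (diffX ^+ 2 * halfX ^+ N)`_i
    = 4 * (binw N.+2 i * ((2 * i%:R - N.+2%:R) ^+ 2 - N.+2%:R)).
Proof.
have -> : diffX ^+ 2 * halfX ^+ N = diffX * (diffX * halfX ^+ N) by rewrite mulrA.
rewrite coef_diffX mulrBr.
have e0 := coef_diff_halfX N i.
have s0 := binw_shift N.+1 i.
have -> : N.+1%:R * N.+2%:R * (diffX * halfX ^+ N)`_i =
  2 * (2 * i%:R - N.+1%:R) * (2 * (N.+2%:R - i%:R) * binw N.+2 i) :> R.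
  by rewrite -s0 mulrAC e0; ring.
case: i {e0 s0} => [|i].
  by rewrite mulr0 -[N.+2%:R]natr1; ring.
have e0 := coef_diff_halfX N i.
have s0 := binw_shiftS N.+1 i.
have -> : N.+1%:R * N.+2%:R * (diffX * halfX ^+ N)`_i =
  2 * (2 * i%:R - N.+1%:R) * (2 * i.+1%:R * binw N.+2 i.+1) :> R.
  by rewrite -s0 mulrAC e0; ring.
by rewrite -[N.+2%:R]natr1 -[i.+1%:R]natr1; ring.
Qed.

Lemma l1norm_diff_halfX N i : (4 ^ i <= N.+1)%N ->
  l1norm (diffX * halfX ^+ N) <= 2 / 2 ^+ i.
Proof.
move=> iN; rewrite (@l1normE _ _ N.+2); last first.
  apply/leq_sizeP => j jN; apply/eqP; rewrite -(mulrI_eq0 _ (@lregP _ N.+1%:R _)); last first.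
    by rewrite pnatr_eq0.
  by rewrite coef_diff_halfX /binw bin_small ?mul0r ?mulr0.
set t : R := 2 ^+ i; have t0 : 0 < t by rewrite exprn_gt0.
have tN : t ^+ 2 <= N.+1%:R by rewrite -exprM mulnC exprM -natrX -natrX ler_nat.
have N0 : 0 < N.+1%:R :> R by rewrite ltr0n.
rewrite -(ler_pM2l N0) mulr_sumr.
(* Since [2 |x| <= x^2 / t + t], the second moment suffices, and [t^2 <= N + 1] bounds the result by
   [2 (N + 1) / t]. *)
apply: (@le_trans _ _ (binE N.+1 (fun x => t^-1 * x ^+ 2 + t * 1))).
  apply: ler_sum => j _.
  rewrite -[N.+1%:R in leLHS]gtr0_norm // -normrM coef_diff_halfX.
  rewrite normrM normrM (ger0_norm (binw_ge0 _ _)) ger0_norm //.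
  set x := _ - N.+1%:R; rewrite mulrCA ler_wpM2l ?binw_ge0 //.
  have h : 0 <= (`|x| - t) ^+ 2 by rewrite sqr_ge0.
  rewrite -(ler_pM2l t0) mulrDr mulVKf ?gt_eqF // -[x ^+ 2]real_normK ?num_real //.
  by nra.
rewrite binED !binEZ binE_sqr binE1 mulr1.
rewrite -(ler_pM2l t0) mulrDr !mulrA mulfV ?gt_eqF //.
have -> : t * N.+1%:R * 2 / t = 2 * N.+1%:R by field; rewrite gt_eqF.
lra.
Qed.

(** The second difference of the law of [n] lazy steps, each made of two half-steps [(X + 1) / 2];
    the centre is at the exponent [n + 1]. *)
Definition kerP n : {poly R} := diffX ^+ 2 * halfX ^+ (2 * n).

Lemma size_kerP n : (size (kerP n) <= (2 * n).+3)%N.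
Proof.
apply/leq_sizeP => j jN; apply/eqP.
rewrite -(mulrI_eq0 _ (@lregP _ ((2 * n).+1%:R * (2 * n).+2%:R) _)); last first.
  by rewrite mulf_neq0 ?pnatr_eq0.
by rewrite coef_diff2_halfX /binw bin_small ?mul0r ?mulr0.
Qed.

(** Parabolic scaling keeps the second moment of a second derivative of the heat kernel bounded in
    time. With [L = 2 n + 2] and [|x^2 - L| <= x^2 + L] it reduces to the second and fourth moments
    of the walk, and [4 L^2 - 2 L <= 8 L (L - 1)]. *)
Lemma kerP_moment n :
  \sum_(i < (2 * n).+3) (i%:R - n.+1%:R) ^+ 2 * `|(kerP n)`_i| <= 8.
Proof.
set L := (2 * n).+2; have L2 : 2 <= L%:R :> R by rewrite ler_nat.
set c : R := (2 * n).+1%:R * L%:R.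
have cE : c = (L%:R - 1) * L%:R by rewrite /c /L -[(2 * n).+2%:R]natr1; ring.
have c0 : 0 < c by rewrite mulr_gt0 ?ltr0n.
rewrite -(ler_pM2l c0) mulr_sumr.
apply: (@le_trans _ _ (binE L (fun x => x ^+ 4 + L%:R * x ^+ 2))).
  apply: ler_sum => j _.
  rewrite mulrCA -[c in leLHS]gtr0_norm // -normrM coef_diff2_halfX.
  rewrite normrM normrM (ger0_norm (binw_ge0 _ _)) ger0_norm //.
  rewrite -/L; set x := 2 * j%:R - L%:R.
  have LE : L%:R = 2 * n.+1%:R :> R by rewrite -natrM; congr (_%:R); rewrite /L; lia.
  have -> : (j%:R - n.+1%:R) ^+ 2 = 4^-1 * x ^+ 2 by rewrite /x LE; field.
  have -> : 4^-1 * x ^+ 2 * (4 * (binw L j * `|x ^+ 2 - L%:R|)) = binw L j * (x ^+ 2 * `|x ^+ 2 - L%:R|) by field.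
  rewrite ler_wpM2l ?binw_ge0 //.
  have -> : x ^+ 4 + L%:R * x ^+ 2 = x ^+ 2 * (x ^+ 2 + L%:R) by ring.
  rewrite ler_wpM2l ?sqr_ge0 // (le_trans (ler_normB _ _)) //.
  by rewrite !ger0_norm ?sqr_ge0 ?ler0n.
rewrite binED binEZ binE_pow4 binE_sqr cE; nra.
Qed.

End BinomialKernel.

(** * The Hormander condition for the discrete heat kernel *)

Section Hormander.
Variable R : realFieldType.

Definition heatK (n : nat) (m : int) : R := coefz (kerP R n) (m + n.+1%:Z).

Lemma sum_supp_le (f : nat -> R) p q A : (forall a, 0 <= f a) ->
  (forall a, ~~ (p <= a < p + q)%N -> f a = 0) ->
  \sum_(a < A) f a <= \sum_(i < q) f (p + i)%N.
Proof.
move=> f0 fz.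
pose g (m : int) := if m is Posz k then f (p + k)%N else 0.
have g0 m : 0 <= g m by case: m => k /=.
apply: le_trans (@sum_window_le R g q A (- p%:Z) g0 _ _) => //.
  apply: ler_sum => a _; case: (leqP p a) => pa; last by rewrite fz ?g0 //; lia.
  have -> : (a%:Z - p%:Z = (a - p)%N%:Z)%R by lia.
  by rewrite /g subnKC.
by move=> k qk /=; rewrite fz //; lia.
Qed.

Lemma l1norm_diff_halfX4 a i : (4 ^ i <= 4 * a.+1)%N ->
  l1norm (diffX R * halfX R ^+ a) <= 4 / 2 ^+ i.
Proof.
case: i => [|i] ia.
  by apply: le_trans (@l1norm_diff_halfX R a 0 _) _ => //; rewrite expr0 !divr1 ler_nat.
apply: le_trans (@l1norm_diff_halfX R a i _) _; first by rewrite expnS leq_mul2l in ia.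
by rewrite exprS invfM mulrA; apply: ler_wpM2r; [rewrite invr_ge0 exprn_ge0|lra].
Qed.

Lemma l1normX (P : {poly R}) k : l1norm (P ^+ k) <= l1norm P ^+ k.
Proof.
elim: k => [|k IH]; first by rewrite !expr0 l1norm1.
by rewrite !exprS (le_trans (l1normM _ _)) // ler_wpM2l ?l1norm_ge0.
Qed.

(** The [2 n] half-steps are shared among the [k] differences: each factor [X - 1] receives about
    [n / 2] of them and gains [n^(-1/2)]. *)
Lemma l1norm_kerP_gen k n i : (k <= 4)%N -> (4 ^ i <= n)%N ->
  l1norm (diffX R ^+ k * halfX R ^+ (2 * n)) <= (4 / 2 ^+ i) ^+ k.
Proof.
move=> k4 ni; set a := ((2 * n) %/ 4)%N.
have -> : diffX R ^+ k * halfX R ^+ (2 * n) = (diffX R * halfX R ^+ a) ^+ k * halfX R ^+ (2 * n - a * k).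
  rewrite exprMn -exprM -mulrA -exprD subnKC //.
  by apply: leq_trans (leq_mul (leqnn a) k4) _; rewrite /a; lia.
rewrite (le_trans (l1normM _ _)) // l1norm_halfX mulr1 (le_trans (l1normX _ _)) //.
apply: lerXn2r; rewrite ?nnegrE ?l1norm_ge0 ?divr_ge0 ?exprn_ge0 //.
by apply: l1norm_diff_halfX4; apply: leq_trans ni _; rewrite /a; lia.
Qed.

(** Chebyshev's inequality for the second moment of [kerP_moment]. *)
Lemma heatK_tail n j B (s : int) :
  \sum_(b < B | (2 ^ j <= absz (b%:Z + s)%R)%N) `|heatK n (b%:Z + s)| <= 8 / 4 ^+ j.
Proof.
rewrite ler_pdivlMr // mulrC mulr_sumr.
apply: le_trans (@kerP_moment R n).
pose f (m : int) : R := (m%:~R - n.+1%:R) ^+ 2 * `|coefz (kerP R n) m|.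
have f0 m : 0 <= f m by rewrite mulr_ge0 ?sqr_ge0.
apply: le_trans (@sum_window_le R f (2 * n).+3 B (s + n.+1%:Z) f0 _ _).
- rewrite big_mkcond; apply: ler_sum => b _; case: ifP => // h.
  rewrite /f /heatK -addrA ler_wpM2r //.
  have -> : (b%:Z + (s + n.+1%:Z))%:~R - n.+1%:R = (b%:Z + s)%:~R :> R.
    by rewrite addrA; move: (_ + s)%R => m; rewrite intrD -pmulrn addrK.
  have -> : 4 ^+ j = ((2 ^ j)%N%:R) ^+ 2 :> R by rewrite natrX -exprM mulnC exprM; congr (_ ^+ _); lra.
  rewrite -[leRHS]real_normK ?num_real //; apply: lerXn2r; rewrite ?nnegrE //.
  by rewrite -intr_norm -abszE ler_nat.
- by move=> k; rewrite /f /= normr0 mulr0.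
- move=> k hk; rewrite /f /= nth_default ?normr0 ?mulr0 //.
  exact: leq_trans (size_kerP _ _) hk.
Qed.

Lemma heatK_shift_space n B (s s' : int) :
  \sum_(b < B) `|heatK n (b%:Z + s) - heatK n (b%:Z + s')|
     <= (absz (s - s'))%:R * l1norm (diffX R * kerP R n).
Proof.
wlog ss : s s' / s' <= s => [H|].
  case: (lerP s' s) => [|/ltW] /H //.
  rewrite distnC; under eq_bigr do rewrite distrC; exact.
have [k ->] : exists k : nat, s' = s - k%:Z by exists (absz (s - s')); lia.
rewrite subKr /=.
apply: le_trans (l1norm_mulXnB1 _ _).
rewrite -l1normN; apply: le_trans (sum_coefz_le _ B (s + n.+1%:Z)).
apply: ler_sum => b _; rewrite mulrBr mulr1 opprB coefzB coefzMXn /heatK.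
by rewrite !addrA (addrAC _ (- k%:Z)).
Qed.

(** The discrete heat equation [((X + 1) / 2)^2 - X = (X - 1)^2 / 4]. The factor [X] compensates for
    the centre, which moves by one at each time step. *)
Lemma kerPS m :
  kerP R m.+1 - kerP R m * 'X = 4^-1 *: (diffX R ^+ 4 * halfX R ^+ (2 * m)).
Proof.
rewrite /kerP mulnS exprD [halfX R ^+ 2]exprZn -!mul_polyC.
have -> : 2^-1 ^+ 2 = 4^-1 :> R by rewrite expr2 -invfM; congr (_^-1); lra.
have c4 : (4^-1 : R)%:P * 4%:R = 1 :> {poly R}.
  by rewrite -polyC_natr -polyCM mulVf ?polyC1 ?pnatr_eq0.
move: (halfX R ^+ (2 * m)) => H.
have -> : diffX R ^+ 2 * H * 'X = (4^-1 : R)%:P * 4%:R * (diffX R ^+ 2 * H * 'X) by rewrite c4 mul1r.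
rewrite /diffX.
move: ((4^-1 : R)%:P) => c; ring.
Qed.

Lemma heatK_shift_time n al B (s : int) :
  \sum_(b < B) `|heatK (n + al) (b%:Z + s) - heatK n (b%:Z + s)|
     <= \sum_(i < al) 4^-1 * l1norm (diffX R ^+ 4 * halfX R ^+ (2 * (n + i))).
Proof.
elim: al => [|al IH].
  by rewrite big_ord0 addn0 big1 // => b _; rewrite subrr normr0.
rewrite big_ord_recr /=.
have tri (b : 'I_B) : true -> `|heatK (n + al.+1) (b%:Z + s) - heatK n (b%:Z + s)| <=
  `|heatK (n + al) (b%:Z + s) - heatK n (b%:Z + s)| +
  `|heatK (n + al).+1 (b%:Z + s) - heatK (n + al) (b%:Z + s)|.
  by move=> _; rewrite addnS [leRHS]addrC ler_distD.
apply: le_trans (ler_sum _ tri) _; rewrite big_split /= lerD //.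
set m := (n + al)%N.
rewrite -[4^-1](@ger0_norm R) ?invr_ge0 // -l1normZ.
apply: le_trans (sum_coefz_le _ B (s + m.+2%:Z)).
apply: ler_sum => b _; rewrite /heatK.
have -> : b%:Z + s + m.+1%:Z = (b%:Z + (s + m.+2%:Z)) - 1%N%:Z by lia.
rewrite -coefzMXn expr1 -[b%:Z + s + _]addrA -coefzB.
by rewrite kerPS.
Qed.

(** A shift in space by [2^j] meets three differences, of total size [n^(-3/2)]; a shift in time by
    [4^j] meets four, of size [n^(-2)]. The constant is [4^3], which is also [4^4 / 4]. *)
Lemma heatK_shift n al B (s s' : int) i j :
  (4 ^ i <= n)%N -> (al <= 4 ^ j)%N -> (absz (s - s')%R <= 2 ^ j)%N ->
  \sum_(b < B) `|heatK (n + al) (b%:Z + s) - heatK n (b%:Z + s')|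
     <= 64 * (2 ^+ j / 8 ^+ i + 4 ^+ j / 16 ^+ i).
Proof.
move=> ni alj kj.
have tri (b : 'I_B) : true -> `|heatK (n + al) (b%:Z + s) - heatK n (b%:Z + s')| <=
  `|heatK n (b%:Z + s) - heatK n (b%:Z + s')| +
  `|heatK (n + al) (b%:Z + s) - heatK n (b%:Z + s)|.
  by move=> _; rewrite [leRHS]addrC ler_distD.
apply: le_trans (ler_sum _ tri) _; rewrite big_split /= mulrDr lerD //.
  apply: le_trans (heatK_shift_space _ _ _ _) _.
  have := @l1norm_kerP_gen 3 n i isT ni; rewrite exprS -mulrA -/(kerP R n) => h.
  have -> : 64 * (2 ^+ j / 8 ^+ i) = 2 ^+ j * (64 / 8 ^+ i) :> R by ring.
  apply: ler_pM; rewrite ?l1norm_ge0 ?ler0n //; first by rewrite -natrX ler_nat.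
  apply: le_trans h _; rewrite expr_div_n -[(2 ^+ i) ^+ 3]exprM (mulnC i) exprM.
  by rewrite -!natrX lexx.
apply: le_trans (heatK_shift_time _ _ _ _) _.
have bd (m : 'I_al) : true -> 4^-1 * l1norm (diffX R ^+ 4 * halfX R ^+ (2 * (n + m))) <= 64 / 16 ^+ i.
  move=> _; have := @l1norm_kerP_gen 4 (n + m) i isT (leq_trans ni (leq_addr _ _)).
  rewrite expr_div_n -[(2 ^+ i) ^+ 4]exprM (mulnC i) => h.
  rewrite mulrC ler_pdivrMr //; apply: le_trans h _.
  have -> : 16 = 2 ^+ 4 :> R by rewrite -natrX.
  have e : 64 / (2 ^+ 4) ^+ i * 4 = 256 / (2 ^+ 4) ^+ i :> R by rewrite mulrAC; congr (_ / _); lra.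
  rewrite e -exprM; apply: ler_wpM2r; first by rewrite invr_ge0 exprn_ge0.
  by rewrite -natrX ler_nat.
apply: le_trans (ler_sum _ bd) _; rewrite sumr_const card_ord -[leLHS]mulr_natr -mulrA.
rewrite ler_wpM2l // mulrC ler_wpM2r ?invr_ge0 ?exprn_ge0 //.
by rewrite -natrX ler_nat.
Qed.

(** The block starting at [4^(j + l)] has [3 * 4^(j + l)] terms and contributes at most [6 c 2^-l],
    which leaves a geometric series. *)
Lemma sum_blocks_le (f : nat -> R) c j l : 0 <= c ->
  (forall i n, (4 ^ i <= n)%N -> f n <= c * (2 ^+ j / 8 ^+ i + 4 ^+ j / 16 ^+ i)) ->
  \sum_(4 ^ j <= n < 4 ^ (j + l)) f n <= 12 * c * (1 - 2^-1 ^+ l).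
Proof.
move=> c0 H; elim: l => [|l IH]; first by rewrite addn0 big_geq // expr0 subrr mulr0.
have le1 : (4 ^ j <= 4 ^ (j + l))%N by rewrite leq_exp2l ?leq_addr.
have le2 : (4 ^ (j + l) <= 4 ^ (j + l.+1))%N by rewrite leq_exp2l ?leq_add2l.
rewrite (big_cat_nat le1 le2) /=.
have : \sum_(4 ^ (j + l) <= n < 4 ^ (j + l.+1)) f n <= 6 * c * 2^-1 ^+ l.
  apply: (@le_trans _ _ (\sum_(4 ^ (j + l) <= n < 4 ^ (j + l.+1)) c * (2 ^+ j / 8 ^+ (j + l) + 4 ^+ j / 16 ^+ (j + l)))).
    by rewrite !big_nat; apply: ler_sum => n /andP[nl _]; exact: H.
  rewrite sumr_const_nat -[leLHS]mulr_natr natrB // addnS expnS natrM natrX.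
  set t : R := 2 ^+ j; set u : R := 2 ^+ l.
  have t0 : 0 < t by rewrite exprn_gt0.
  have u1 : 1 <= u by rewrite exprn_ege1 ?ler1n.
  have -> : 4 ^+ j = t ^+ 2 by rewrite /t exprAC; congr (_ ^+ _); lra.
  have -> : 4 ^+ (j + l) = (t * u) ^+ 2 by rewrite /t /u -exprD exprAC; congr (_ ^+ _); lra.
  have -> : 8 ^+ (j + l) = (t * u) ^+ 3 by rewrite /t /u -exprD exprAC; congr (_ ^+ _); lra.
  have -> : 16 ^+ (j + l) = (t * u) ^+ 4 by rewrite /t /u -exprD exprAC; congr (_ ^+ _); lra.
  have u0 : 0 < u by lra.
  rewrite exprVn -/u.
  have -> : c * (t / (t * u) ^+ 3 + t ^+ 2 / (t * u) ^+ 4) * (4 * (t * u) ^+ 2 - (t * u) ^+ 2)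
     = c * u^-1 * (3 + 3 * u^-1) by field; rewrite !gt_eqF.
  have -> : 6 * c / u = c * u^-1 * 6 by ring.
  rewrite ler_wpM2l ?mulr_ge0 ?invr_ge0 ?(ltW u0) //.
  have : u^-1 <= 1 by rewrite invf_le1.
  lra.
rewrite [2^-1 ^+ l.+1]exprS; move: IH; set A := bigop _ _ _; set B := bigop _ _ _.
move: (2^-1 ^+ l) => w; nra.
Qed.

Definition heat_kernel (z y : nat * nat) : R :=
  if (y.1 <= z.1)%N then heatK (z.1 - y.1) (z.2%:Z - y.2%:Z) else 0.

Definition plabel (j : nat) (z : nat * nat) : nat * nat :=
  (z.1 %/ 4 ^ j, z.2 %/ 2 ^ j)%N.

(** The kernel vanishes before the time of its source, so the enlarged box extends only forward in
    time: two boxes in time by three in space, hence the factor [6] in the count. *)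
Definition near_box j (l z : nat * nat) : bool :=
  [&& (l.1 <= (plabel j z).1)%N, ((plabel j z).1 <= l.1.+1)%N,
      (l.2 <= (plabel j z).2.+1)%N & ((plabel j z).2 <= l.2.+1)%N].

Lemma heat_kernelE a b y : (y.1 <= a)%N ->
  heat_kernel (a, b) y = heatK (a - y.1) (b%:Z - y.2%:Z).
Proof. by move=> h; rewrite /heat_kernel h. Qed.

Lemma heat_kernel_lt a b y : (a < y.1)%N -> heat_kernel (a, b) y = 0.
Proof. by move=> h; rewrite /heat_kernel leqNgt h. Qed.

Lemma heat_kernel_row_tail j l y a B : plabel j y = l ->
  ((l.1 <= a %/ 4 ^ j)%N && (a %/ 4 ^ j <= l.1.+1)%N) ->
  \sum_(b < B | ~~ near_box j l (a, b : nat)) `|heat_kernel (a, b : nat) y| <= 8 / 4 ^+ j.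
Proof.
move=> <- /andP[h1 h2]; rewrite /heat_kernel /=; case: leqP => ya; last first.
  by rewrite big1 ?normr0 ?divr_ge0 ?exprn_ge0.
apply: le_trans (heatK_tail (a - y.1) j B (- y.2%:Z)).
rewrite big_mkcond [leRHS]big_mkcond; apply: ler_sum => b _.
case: ifP => [nb|_]; last by case: ifP.
case: ifP => // /negP[]; move: nb; rewrite /near_box /= h1 h2 /=.
have p0 : (0 < 2 ^ j)%N by rewrite expn_gt0.
set p := (2 ^ j)%N in p0 *.
have e1 := divn_eq b p; have e2 := divn_eq y.2 p.
have m1 := ltn_pmod b p0; have m2 := ltn_pmod y.2 p0.
move: e1 e2 m1 m2; set u := (_ %/ _)%N; set v := (y.2 %/ _)%N.
rewrite negb_and -!ltnNge => e1 e2 m1 m2 /orP[] h.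
  have : (u.+1 * p + p <= v * p)%N by rewrite addnC -mulSn leq_mul2r h orbT.
  by rewrite !mulSn; lia.
have : (v.+1 * p + p <= u * p)%N by rewrite addnC -mulSn leq_mul2r h orbT.
by rewrite !mulSn; lia.
Qed.

Lemma plabel_dist j y y' : plabel j y = plabel j y' ->
  (absz (y.1%:Z - y'.1%:Z)%R <= 4 ^ j)%N && (absz (y.2%:Z - y'.2%:Z)%R <= 2 ^ j)%N.
Proof.
case; have H (p a b : nat) : (0 < p)%N -> (a %/ p)%N = (b %/ p)%N -> (absz (a%:Z - b%:Z)%R <= p)%N.
  move=> p0 e; have := divn_eq a p; have := divn_eq b p.
  by have := ltn_pmod a p0; have := ltn_pmod b p0; rewrite e; lia.
by move=> e1 e2; rewrite !H // expn_gt0.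
Qed.

(** Three ranges of the time [a]. Before the box both kernels vanish. In the next [2 * 4^j] rows
    each kernel is estimated by its tail, which gives [32] in all. Later the difference is estimated
    by [heatK_shift], and the dyadic blocks sum to [12 * 64 = 768]. *)
Lemma heat_kernel_hormander_le j y y' A B : plabel j y = plabel j y' ->
  (y.1 <= y'.1)%N ->
  \sum_(a < A) \sum_(b < B | ~~ near_box j (plabel j y) (a : nat, b : nat))
     `|heat_kernel (a : nat, b : nat) y - heat_kernel (a : nat, b : nat) y'| <= 800.
Proof.
move=> eyy yy'; set l := plabel j y; set P := (4 ^ j)%N.
have P0 : (0 < P)%N by rewrite expn_gt0.
have ly : (l.1 * P <= y.1)%N by rewrite leq_divM.
have ly' : (y'.1 < l.1.+1 * P)%N.
  by rewrite /l eyy /= mulSn addnC {1}(divn_eq y'.1 P) ltn_add2l ltn_pmod.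
pose f1 a : R := if (l.1 * P <= a < l.1 * P + P.*2)%N then 16 / 4 ^+ j else 0.
pose T n : R := \sum_(b < B) `|heatK (n + (y'.1 - y.1)) (b%:Z - y.2%:Z) - heatK n (b%:Z - y'.2%:Z)|.
pose f2 a : R := if (y'.1 + P <= a < y'.1 + P + (4 ^ (j + A) - P))%N then T (a - y'.1)%N else 0.
have f10 a : 0 <= f1 a by rewrite /f1; case: ifP => // _; rewrite divr_ge0 ?exprn_ge0.
have f20 a : 0 <= f2 a by rewrite /f2; case: ifP => // _; apply: sumr_ge0.
apply: (@le_trans _ _ (\sum_(a < A) (f1 a + f2 a))).
  apply: ler_sum => a _.
  case: (ltnP a (l.1 * P)) => h1.
    rewrite big1 ?addr_ge0 // => b _.
    rewrite !heat_kernel_lt ?subrr ?normr0 //; last by apply: leq_trans h1 ly.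
    by apply: leq_trans h1 (leq_trans ly yy').
  case: (ltnP a (l.1 * P + P.*2)) => h2.
    rewrite -[leLHS]addr0 lerD // /f1 h1 h2 /=.
    have ha : ((l.1 <= a %/ P)%N && (a %/ P <= l.1.+1)%N).
      rewrite leq_divRL // h1 /= -ltnS ltn_divLR //.
      by move: h2; rewrite -addnn !mulSn; move: (l.1 * P)%N => w; lia.
    have -> : 16 / 4 ^+ j = 8 / 4 ^+ j + 8 / 4 ^+ j :> R by rewrite -mulrDl; congr (_ / _); lra.
    have t1 := @heat_kernel_row_tail j l y a B erefl ha.
    have t2 := @heat_kernel_row_tail j l y' a B (esym eyy) ha.
    apply: le_trans (lerD t1 t2); rewrite -big_split /=; apply: ler_sum => b _.
    exact: ler_normB.
  rewrite -[leLHS]add0r lerD // /f2.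
  have h3 : (y'.1 + P <= a)%N by apply: leq_trans h2; move: ly'; rewrite mulSn -addnn; lia.
  have h4 : (a < y'.1 + P + (4 ^ (j + A) - P))%N.
    have : (A < 4 ^ (j + A))%N by apply: (@leq_trans (4 ^ A)); [exact: ltn_expl | rewrite leq_exp2l ?leq_addl].
    have : (P <= 4 ^ (j + A))%N by rewrite /P leq_exp2l ?leq_addr.
    by have := ltn_ord a; lia.
  rewrite h3 h4 /= big_mkcond; apply: ler_sum => b _; case: ifP => // _.
  rewrite !heat_kernelE; [|by lia|by lia].
  by have -> : (a - y'.1 + (y'.1 - y.1) = a - y.1)%N by lia.
rewrite big_split /=.
have s1 : \sum_(a < A) f1 a <= 32.
  apply: le_trans (@sum_supp_le f1 (l.1 * P) P.*2 A f10 _) _.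
    by move=> a /negbTE h; rewrite /f1 h.
  apply: (@le_trans _ _ (\sum_(i < P.*2) 16 / 4 ^+ j)).
    apply: ler_sum => i _; rewrite /f1; case: ifP => _; first exact: lexx.
    exact: divr_ge0 (ler0n _ 16) (exprn_ge0 _ (ler0n _ 4)).
  rewrite sumr_const card_ord -[leLHS]mulr_natr -mul2n natrM /P natrX.
  have -> : 16 / 4 ^+ j * (2 * 4 ^+ j) = 32 :> R; last by [].
  by field; rewrite expf_neq0 ?pnatr_eq0.
have s2 : \sum_(a < A) f2 a <= 768.
  apply: le_trans (@sum_supp_le f2 (y'.1 + P) (4 ^ (j + A) - P) A f20 _) _.
    by move=> a /negbTE h; rewrite /f2 h.
  apply: (@le_trans _ _ (\sum_(P <= n < 4 ^ (j + A)) T n)).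
    rewrite -[X in index_iota X _]add0n big_addn big_mkord; apply: ler_sum => i _.
    rewrite /f2 ifT; last by have := ltn_ord i; lia.
    by rewrite addnC addnA (addnC i) -addnA addKn addnC.
  have [d1 d2] := andP (plabel_dist eyy).
  apply: le_trans (@sum_blocks_le T 64 j A _ _) _ => //.
    move=> i n ni; apply: heatK_shift => //; first by lia.
    by move: d2; move: (2 ^ j)%N => w; lia.
  have : 0 <= 2^-1 ^+ A :> R by rewrite exprn_ge0 // invr_ge0.
  lra.
lra.
Qed.

Lemma heat_kernel_hormander j y y' A B : plabel j y = plabel j y' ->
  \sum_(a < A) \sum_(b < B | ~~ near_box j (plabel j y) (a : nat, b : nat))
     `|heat_kernel (a : nat, b : nat) y - heat_kernel (a : nat, b : nat) y'| <= 800.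
Proof.
move=> e; case: (leqP y.1 y'.1) => [|/ltnW] h; first exact: heat_kernel_hormander_le.
rewrite e; have := @heat_kernel_hormander_le j y' y A B (esym e) h.
by under eq_bigr do under eq_bigr do rewrite distrC.
Qed.

End Hormander.

(** * Calderon-Zygmund decomposition *)

Section CalderonZygmund.
Variables (R : realFieldType) (X : finType) (L : eqType) (lab : nat -> X -> L) (J : nat).
Hypothesis lab_nested : forall j z y, lab j z = lab j y -> lab j.+1 z = lab j.+1 y.
Hypothesis lab_top : forall z y, lab J z = lab J y.
Hypothesis lab_card : forall j z, (j <= J)%N -> #|[pred y | lab j y == lab j z]| = (8 ^ j)%N.
Variables (k : X -> X -> R) (C1 C2 : R) (near : nat -> L -> X -> bool).
Hypothesis C1_ge0 : 0 <= C1.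
Hypothesis C2_ge0 : 0 <= C2.
Hypothesis kL2 : forall g : X -> R,
  \sum_z (\sum_y k z y * g y) ^+ 2 <= C2 * \sum_y g y ^+ 2.
Hypothesis near_card : forall j z, (j <= J)%N ->
  (#|[pred y | near j (lab j z) y]| <= 6 * 8 ^ j)%N.
Hypothesis kH : forall j y y', lab j y = lab j y' ->
  \sum_(z | ~~ near j (lab j y) z) `|k z y - k z y'| <= C1.

Let lab_mono i j z y : (i <= j)%N -> lab i z = lab i y -> lab j z = lab j y.
Proof. by move=> ij e; rewrite -(subnKC ij); elim: (j - i)%N => [|l IH]; rewrite ?addn0 // addnS; apply: lab_nested. Qed.

Section Level.
Variables (g : X -> R) (lam : R).
Hypothesis lam_gt0 : 0 < lam.
Hypothesis lam_big : \sum_y `|g y| <= lam * 8 ^+ J.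

Let M j z := \sum_(y | lab j y == lab j z) `|g y|.
Let stop j z := lam * 8 ^+ j < M j z.
Let B : pred X := fun z => [exists j : 'I_J, stop j z].
(** Taking the largest level whose cube has average above [lam] makes the stopped cubes disjoint and
    gives their parents average at most [lam]. The hypothesis [lam_big] keeps the top cube from
    stopping. *)
Let lev z : nat := \max_(j < J | stop j z) j.
Let w z : R := (8 ^+ lev z)^-1.
Let cube z : pred X := fun y => lab (lev z) y == lab (lev z) z.

Let M_mono i j z : (i <= j)%N -> M i z <= M j z.
Proof.
move=> ij; rewrite /M big_mkcond [leRHS]big_mkcond; apply: ler_sum => y _.
case: ifP => [/eqP/(lab_mono ij) ->|_]; first by rewrite eqxx.
by case: ifP.
Qed.

Let stop_eq j z y : lab j z = lab j y -> stop j z = stop j y.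
Proof. by rewrite /stop /M => ->. Qed.

Let stopJ z : stop J z = false.
Proof.
apply/negbTE; rewrite -leNgt; apply: le_trans lam_big.
by rewrite /M big_mkcond; apply: ler_sum => y _; case: ifP.
Qed.

Let lev_max j z : (j <= J)%N -> stop j z -> (j <= lev z)%N /\ B z.
Proof.
rewrite leq_eqVlt => /orP[/eqP->|jJ]; first by rewrite stopJ.
move=> s; split; last by apply/existsP; exists (Ordinal jJ).
exact: (@leq_bigmax_cond _ (fun i : 'I_J => stop i z) (fun i : 'I_J => nat_of_ord i) (Ordinal jJ)).
Qed.

Let levP z : B z -> stop (lev z) z /\ (lev z < J)%N.
Proof.
move=> /existsP[j sj].
have : (0 < #|[pred i : 'I_J | stop i z]|)%N by apply/card_gt0P; exists j.
move/(eq_bigmax_cond (fun i : 'I_J => nat_of_ord i)) => [i si].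
by rewrite /lev => e; split; [rewrite e | rewrite e ltn_ord].
Qed.

Let cubeP z y : B z -> cube z y -> B y /\ lev y = lev z.
Proof.
move=> Bz /eqP e; have [sz zJ] := levP Bz.
have [h By] := lev_max (ltnW zJ) (etrans (stop_eq e) sz).
split=> //; apply/eqP; rewrite eqn_leq h andbT.
have [sy yJ] := levP By.
by have [] := lev_max (ltnW yJ) (etrans (stop_eq (esym (lab_mono h e))) sy).
Qed.

Let cube_sym z y : B z && cube z y = B y && cube y z.
Proof.
apply/andP/andP => -[b c]; have [b' e] := cubeP b c; split=> //.
  by rewrite /cube e eq_sym.
by rewrite /cube e eq_sym.
Qed.

(** Cubes are never enumerated: a sum over cubes is a sum over the points of [B] with weight [w],
    the inverse size of the cube. The orders of summation can be exchanged because lying in the same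
    cube is symmetric and fixes the level. *)
Let cube_exchange (F : X -> X -> R) :
  \sum_(y | B y) w y * (\sum_(x | cube y x) F y x) = \sum_(x | B x) w x * (\sum_(y | cube x y) F y x).
Proof.
under eq_bigr do rewrite mulr_sumr.
under [RHS]eq_bigr do rewrite mulr_sumr.
rewrite pair_big_dep [RHS]pair_big_dep /=.
rewrite (reindex_inj (inv_inj (@swap_pairK X X))) /=.
apply: eq_big => [[x y]|[x y]] /=; first by rewrite cube_sym.
by move=> /andP[b c]; have [_ e] := cubeP b c; rewrite /w e.
Qed.

Let cube_card z : B z -> w z * #|cube z|%:R = 1.
Proof.
by move=> /levP[_ /ltnW lJ]; rewrite /w (lab_card z lJ) natrX mulVf ?expf_neq0 ?pnatr_eq0.
Qed.

Let w_ge0 z : 0 <= w z. Proof. by rewrite invr_ge0 exprn_ge0. Qed.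

Let cube_const (F : X -> R) : \sum_(y | B y) w y * (\sum_(x | cube y x) F x) = \sum_(x | B x) F x.
Proof.
rewrite (cube_exchange (fun _ x => F x)); apply: eq_bigr => x Bx.
by rewrite sumr_const -mulr_natl mulrA cube_card // mul1r.
Qed.

Let cardB : lam * (#|B|)%:R <= \sum_y `|g y|.
Proof.
apply: (@le_trans _ _ (\sum_(x | B x) `|g x|)); last first.
  by rewrite big_mkcond; apply: ler_sum => x _; case: ifP.
rewrite -cube_const mulr_natr -sumr_const; apply: ler_sum => y By.
have [] := levP By; rewrite /stop => /ltW h _.
by rewrite /w mulrC ler_pdivlMr ?exprn_gt0.
Qed.

Let good y : R := if B y then w y * (\sum_(x | cube y x) g x) else g y.
Let bad y : R := g y - good y.

Let good_l1 : \sum_y `|good y| <= \sum_y `|g y|.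
Proof.
rewrite (bigID B) [leRHS](bigID B) /= lerD //; last first.
  by apply: ler_sum => y /negbTE h; rewrite /good h.
rewrite -[leRHS]cube_const; apply: ler_sum => y By; rewrite /good By.
by rewrite normrM ger0_norm // ler_wpM2l // ler_norm_sum.
Qed.

(** On [B] the parent cube does not stop and is [8] times as large. Off [B] level [0] does not stop,
    which bounds [|g|] by [lam]. *)
Let good_le y : `|good y| <= 8 * lam.
Proof.
rewrite /good; case: ifP => By.
  have [_ lJ] := levP By.
  rewrite normrM ger0_norm // -ler_pdivlMl ?invr_gt0 ?exprn_gt0 // invrK.
  apply: le_trans (ler_norm_sum _ _ _) _.
  apply: (le_trans (M_mono y (leqnSn (lev y)))).
  have -> : 8 ^+ lev y * (8 * lam) = lam * 8 ^+ (lev y).+1 by rewrite exprS; ring.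
  rewrite leNgt; apply/negP => /(lev_max lJ)[].
  by rewrite ltnn.
have : ~~ stop 0 y by apply/negP => /(@lev_max 0 y (leq0n _))[_]; rewrite By.
rewrite /stop expr0 mulr1 -leNgt => h.
apply: le_trans (_ : M 0 y <= _); first by rewrite /M (bigD1 y) //= lerDl sumr_ge0.
by apply: le_trans h _; rewrite ler_peMl ?ltW ?ltr1n.
Qed.

Let good_l2 : \sum_y good y ^+ 2 <= 8 * lam * \sum_y `|g y|.
Proof.
apply: le_trans (ler_wpM2l _ good_l1); last by rewrite mulr_ge0 ?ltW.
rewrite mulr_sumr; apply: ler_sum => y _.
by rewrite -[leLHS]real_normK ?num_real // expr2 ler_wpM2r // good_le.
Qed.

Let bad_l1 : \sum_y `|bad y| <= 2 * \sum_y `|g y|.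
Proof.
apply: (@le_trans _ _ (\sum_y (`|g y| + `|good y|))).
  by apply: ler_sum => y _; rewrite ler_normB.
by rewrite big_split /= mulr_natl mulr2n lerD2l.
Qed.

Let bad_mean y : B y -> \sum_(x | cube y x) bad x = 0.
Proof.
move=> By; rewrite sumrB.
have e x : cube y x -> good x = good y.
  move=> c; have [Bx lx] := cubeP By c; rewrite /good By Bx /w lx; congr (_ * _).
  apply: eq_bigl => z; rewrite /cube lx.
  by move: c => /eqP ->.
rewrite (eq_bigr _ e) sumr_const /good By -mulr_natr mulrAC cube_card // mul1r.
by rewrite subrr.
Qed.

(** The mean of [bad] over each cube is zero, so the kernel can be replaced by its increments inside
    the cube. Averaging over all reference points [x] of the cube replaces the choice of a
    centre. *)
Let bad_supp z : \sum_y k z y * bad y =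
  \sum_(y | B y) w y * \sum_(x | cube y x) (k z y - k z x) * bad y.
Proof.
rewrite (bigID B) /= [X in _ + X]big1 ?addr0; last first.
  by move=> y /negbTE h; rewrite /bad /good h subrr mulr0.
have -> : \sum_(y | B y) k z y * bad y = \sum_(y | B y) w y * (\sum_(x | cube y x) k z y * bad y).
  by apply: eq_bigr => y By; rewrite sumr_const -mulr_natl mulrA cube_card // mul1r.
apply/eqP; rewrite -subr_eq0 -sumrB; apply/eqP.
under eq_bigr => y By.
  rewrite -mulrBr -sumrB.
  under eq_bigr do rewrite -mulrBl subKr.
  over.
rewrite (cube_exchange (fun y x => k z x * bad y)) big1 // => y By.
by rewrite -mulr_sumr bad_mean // !mulr0.
Qed.

Let exc : pred X := fun z => [exists y, B y && near (lev y) (lab (lev y) y) z].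

Let exc_card : lam * #|exc|%:R <= 6 * \sum_y `|g y|.
Proof.
have : #|exc|%:R <= 6 * #|B|%:R :> R; last first.
  move=> h; apply: le_trans (ler_wpM2l (ltW lam_gt0) h) _.
  by rewrite mulrCA ler_wpM2l // cardB.
apply: (@le_trans _ _ (\sum_z \sum_(y | B y) w y * (near (lev y) (lab (lev y) y) z)%:R)).
  rewrite -sum1_card natr_sum big_mkcond; apply: ler_sum => z _.
  case: ifP => [/existsP[y /andP[By nz]]|_]; last first.
    by apply: sumr_ge0 => y _; rewrite mulr_ge0.
  have e1 : 1 = \sum_(x | cube y x) w y by rewrite sumr_const -[RHS]mulr_natr cube_card.
  rewrite [leLHS]e1.
  rewrite big_mkcond [leRHS]big_mkcond; apply: ler_sum => x _.
  case: ifP => [c|_]; last first.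
    by case: (B x) => //; rewrite mulr_ge0 ?w_ge0 ?ler0n.
  have [-> lx] := cubeP By c.
  by move: c; rewrite /cube /w lx => /eqP ->; rewrite nz mulr1.
rewrite exchange_big /= mulr_natr -sumr_const; apply: ler_sum => y By.
have [_ /ltnW lJ] := levP By.
rewrite -mulr_sumr -natr_sum -big_mkcond sum1_card.
rewrite /w mulrC ler_pdivrMr ?exprn_gt0 // -natrX -natrM ler_nat.
exact: near_card.
Qed.

Let far_bad : \sum_(z | ~~ exc z) `|\sum_y k z y * bad y| <= 2 * C1 * \sum_y `|g y|.
Proof.
apply: (@le_trans _ _ (\sum_(y | B y) w y * \sum_(x | cube y x)
   (\sum_(z | ~~ exc z) `|k z y - k z x|) * `|bad y|)).
  under [leRHS]eq_bigr => y _.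
    rewrite mulr_sumr; under eq_bigr do rewrite mulr_suml mulr_sumr.
    rewrite exchange_big /=; over.
  rewrite [leRHS]exchange_big /=; apply: ler_sum => z _.
  rewrite bad_supp; apply: le_trans (ler_norm_sum _ _ _) _.
  apply: ler_sum => y By; rewrite normrM ger0_norm // -mulr_sumr ler_wpM2l //.
  apply: le_trans (ler_norm_sum _ _ _) _.
  by apply: ler_sum => x c; rewrite normrM.
apply: (@le_trans _ _ (\sum_(y | B y) C1 * `|bad y|)).
  apply: ler_sum => y By.
  apply: (@le_trans _ _ (w y * \sum_(x | cube y x) C1 * `|bad y|)); last first.
    by rewrite sumr_const -[_ *+ #|_|]mulr_natl mulrA cube_card // mul1r.
  rewrite ler_wpM2l //; apply: ler_sum => x c; rewrite ler_wpM2r //.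
  move: c; rewrite /cube => /eqP/esym e; apply: le_trans (kH e).
  rewrite big_mkcond [leRHS]big_mkcond; apply: ler_sum => z _.
  case: ifP => [ez|_]; last by case: ifP.
  case: ifP => // /negbFE nz; move: ez => /negP[].
  by apply/existsP; exists y; rewrite By.
rewrite -mulr_sumr -mulrA mulrCA ler_wpM2l //.
apply: le_trans bad_l1; rewrite big_mkcond; apply: ler_sum => y _.
by case: ifP.
Qed.

Let markov (P : pred X) (F : X -> R) t : (forall z, 0 <= F z) ->
  t * #|[pred z | P z && (t <= F z)]|%:R <= \sum_(z | P z) F z.
Proof.
move=> F0; rewrite mulr_natr -sumr_const big_mkcond [leRHS]big_mkcond.
apply: ler_sum => z _ /=; rewrite inE; case: (P z) => //=.
by case: ifP.
Qed.

(** Half of [lam] is allotted to each part: the good part gives [4 * 8 * C2] by Chebyshev's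
    inequality, the exceptional set [6], and the bad part away from it [2 * 2 * C1] by Markov's
    inequality. *)
Lemma weak_type_big :
  lam * #|[pred z | lam < `|\sum_y k z y * g y|]|%:R
    <= (32 * C2 + 6 + 4 * C1) * \sum_y `|g y|.
Proof.
set h := lam / 2; have h0 : 0 < h by rewrite divr_gt0.
pose P1 := [pred z | true && (h ^+ 2 <= (\sum_y k z y * good y) ^+ 2)].
pose P3 := [pred z | ~~ exc z && (h <= `|\sum_y k z y * bad y|)].
pose P0 := [pred z | lam < `|\sum_y k z y * g y|].
have cards : (#|P0| <= #|P1| + #|exc| + #|P3|)%N.
  apply: leq_trans (_ : #|[predU [predU P1 & exc] & P3]| <= _)%N.
    apply/subset_leq_card/fintype.subsetP => z lz.
    have -> : (z \in [predU [predU P1 & exc] & P3]) = [|| h ^+ 2 <= (\sum_y k z y * good y) ^+ 2,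
        exc z | ~~ exc z && (h <= `|\sum_y k z y * bad y|)] by rewrite orbA.
    have {}lz : lam < `|\sum_y k z y * g y| by [].
    have e : \sum_y k z y * g y = \sum_y k z y * good y + \sum_y k z y * bad y.
      by rewrite -big_split; apply: eq_bigr => y _; rewrite /bad /= -mulrDr addrC subrK.
    case: (exc z) => /=; first by rewrite orbT.
    case: (lerP h `|\sum_y k z y * bad y|) => h2; first by rewrite orbT.
    rewrite orbF -[leRHS]real_normK ?num_real //.
    rewrite lerXn2r ?nnegrE ?(ltW h0) //.
    rewrite e in lz; have := lt_le_trans lz (ler_normD _ _).
    rewrite /h in h2 *; lra.
  apply: leq_trans (leq_addr #|[predI [predU P1 & exc] & P3]| _) _.
  rewrite cardUI leq_add2r.
  by apply: leq_trans (leq_addr #|[predI P1 & exc]| _) _; rewrite cardUI.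
have c1 : lam * #|P1|%:R <= 32 * C2 * \sum_y `|g y|.
  have := @markov predT (fun z => (\sum_y k z y * good y) ^+ 2) (h ^+ 2) (fun z => sqr_ge0 _).
  move=> /le_trans/(_ (kL2 good)) m.
  have := le_trans m (ler_wpM2l C2_ge0 good_l2).
  rewrite -/P1 -(ler_pM2l lam_gt0 (lam * _)).
  have -> : h ^+ 2 = lam * lam / 4 by rewrite /h; field.
  move: (#|P1|%:R : R) (\sum_y `|g y|) => a b; nra.
have c3 : lam * #|P3|%:R <= 4 * C1 * \sum_y `|g y|.
  have := @markov (fun z => ~~ exc z) (fun z => `|\sum_y k z y * bad y|) h (fun z => normr_ge0 _).
  move=> /le_trans/(_ far_bad); rewrite -/P3 /h.
  move: (#|P3|%:R : R) (\sum_y `|g y|) => a b; nra.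
apply: (@le_trans _ _ (lam * (#|P1| + #|exc| + #|P3|)%N%:R)).
  by apply: ler_wpM2l; rewrite ?(ltW lam_gt0) // ler_nat.
rewrite !natrD; move: c1 exc_card c3; move: (#|P1|%:R : R) (#|exc|%:R : R) (#|P3|%:R : R) (\sum_y `|g y|) => a1 a2 a3 b; nra.
Qed.

End Level.

Theorem cz_weak_type (g : X -> R) (lam : R) : 0 < lam ->
  lam * #|[pred z | lam < `|\sum_y k z y * g y|]|%:R
    <= (32 * C2 + 7 + 4 * C1) * \sum_y `|g y|.
Proof.
move=> l0; have g0 : 0 <= \sum_y `|g y| by exact: sumr_ge0.
case: (lerP (\sum_y `|g y|) (lam * 8 ^+ J)) => [/(weak_type_big l0) h|/ltW h].
  by apply: le_trans h _; rewrite ler_wpM2r //; lra.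
(* Here [lam] is at most the average of [|g|] over the top cube, and the trivial count [8^J]
   suffices. *)
pose P0 := [pred z | lam < `|\sum_y k z y * g y|].
have cX : (#|P0| <= 8 ^ J)%N.
  have [z _|h0] := pickP P0; last by rewrite eq_card0.
  rewrite -(lab_card z (leqnn J)); apply/subset_leq_card/fintype.subsetP => y _.
  by rewrite inE; apply/eqP/lab_top.
apply: (@le_trans _ _ (1 * \sum_y `|g y|)).
  rewrite mul1r; apply: le_trans _ h; apply: ler_wpM2l; first exact: ltW.
  by rewrite -natrX ler_nat.
by apply: ler_wpM2r => //; move: C1_ge0 C2_ge0; lra.
Qed.
End CalderonZygmund.

(** * Interpolation and duality *)

Section GeometricSums.
Variable R : realType.

Lemma powR_two_gt1 (s : R) : 0 < s -> 1 < 2 `^ s :> R.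
Proof.
move=> s0; have := @gt0_ltr_powR R s s0 1 2; rewrite powR1; apply; rewrite ?nnegrE //.
by rewrite ltr1n.
Qed.

Lemma geometric_up (s l0 a : R) (I : nat) : 0 < s -> 0 < l0 ->
  \sum_(i < I | l0 * 2 ^+ i < a) (l0 * 2 ^+ i) `^ s <= (1 - 2 `^ (- s))^-1 * a `^ s.
Proof.
move=> s0 l00.
have r1 := powR_two_gt1 s0; set r : R := 2 `^ s in r1.
have -> : (1 - 2 `^ (- s))^-1 = r / (r - 1).
  by rewrite powRN -/r; field; rewrite subr_eq0 !gt_eqF ?(lt_trans ltr01).
have l0i i : 0 < l0 * 2 ^+ i by rewrite mulr_gt0 ?exprn_gt0.
have full n : \sum_(i < n.+1) (l0 * 2 ^+ i) `^ s <= r / (r - 1) * (l0 * 2 ^+ n) `^ s.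
  have rr : 0 < r - 1 by rewrite subr_gt0.
  elim: n => [|n IH].
    rewrite big_ord1; apply: ler_peMl; first exact: powR_ge0.
    by rewrite ler_pdivlMr //; lra.
  rewrite big_ord_recr /=; apply: le_trans (lerD IH (lexx _)) _.
  rewrite exprSr mulrA [(_ * 2) `^ s]powRM ?(ltW (l0i _)) // -/r.
  have := powR_ge0 (l0 * 2 ^+ n) s; move: (_ `^ s) => x x0.
  by rewrite le_eqVlt; apply/orP; left; apply/eqP; field; rewrite gt_eqF.
elim: I => [|I IH].
  by rewrite big_ord0 mulr_ge0 ?powR_ge0 // divr_ge0 ?subr_ge0 ?ltW // (lt_trans ltr01).
rewrite big_mkcond big_ord_recr -big_mkcond /=; case: ifPn => [la|_]; last by rewrite addr0.
apply: le_trans (_ : \sum_(i < I.+1) (l0 * 2 ^+ i) `^ s <= _).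
  rewrite big_ord_recr /= lerD2r big_mkcond; apply: ler_sum => i _.
  by case: ifP => // _; exact: powR_ge0.
apply: le_trans (full I) _; apply: ler_wpM2l.
  by rewrite divr_ge0 ?subr_ge0 ?ltW // (lt_trans ltr01).
by apply: ge0_ler_powR; rewrite ?nnegrE ?ltW // (lt_trans (l0i _) la).
Qed.

Lemma geometric_down (t l0 a : R) (I : nat) : 0 < t -> 0 < l0 -> 0 < a ->
  \sum_(i < I | a <= l0 * 2 ^+ i) (l0 * 2 ^+ i) `^ (- t) <= (1 - 2 `^ (- t))^-1 * a `^ (- t).
Proof.
move=> t0 l00 a0.
have q1 : 2 `^ (- t) < 1 :> R by rewrite powRN invf_lt1 ?powR_gt0 // powR_two_gt1.
set q : R := 2 `^ (- t) in q1 *; have q0 : 0 < q by rewrite powR_gt0.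
have c0 : 0 < (1 - q)^-1 by rewrite invr_gt0 subr_gt0.
have full l n : 0 < l -> \sum_(i < n) (l * 2 ^+ i) `^ (- t) <= (1 - q)^-1 * l `^ (- t).
  elim: n l => [|n IH] l lp; first by rewrite big_ord0 mulr_ge0 ?powR_ge0 ?ltW.
  rewrite big_ord_recl expr0 mulr1.
  under eq_bigr => i _ do rewrite lift0 exprS mulrA.
  apply: le_trans (lerD (lexx _) (IH _ _)) _; first by rewrite mulr_gt0.
  have -> : (l * 2) `^ (- t) = l `^ (- t) * q by rewrite powRM // ltW.
  move: (l `^ (- t)) => x.
  rewrite le_eqVlt; apply/orP; left; apply/eqP; field.
  by rewrite subr_eq0 gt_eqF.
elim: I l0 l00 => [|I IH] l0 l00; first by rewrite big_ord0 mulr_ge0 ?powR_ge0 ?ltW.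
case: (lerP a l0) => al.
  apply: le_trans (_ : \sum_(i < I.+1) (l0 * 2 ^+ i) `^ (- t) <= _).
    by rewrite big_mkcond; apply: ler_sum => i _; case: ifP => // _; exact: powR_ge0.
  apply: le_trans (full _ _ l00) _; apply: ler_wpM2l; first exact: ltW.
  rewrite !powRN lef_pV2 ?posrE ?powR_gt0 //.
  by apply: (ge0_ler_powR (ltW t0)); rewrite ?nnegrE ?(ltW a0) ?(ltW l00).
rewrite big_mkcond big_ord_recl /= expr0 mulr1 (lt_geF al) /= add0r -big_mkcond /=.
apply: le_trans (IH (l0 * 2) _); last by rewrite mulr_gt0.
rewrite le_eqVlt; apply/orP; left; apply/eqP.
by apply: eq_big => [i|i _]; rewrite /bump /= add1n exprS mulrA.
Qed.
End GeometricSums.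

Section Interpolation.
Variables (R : realType) (X : finType).
Implicit Types (k : X -> X -> R) (g : X -> R).

Definition Lp_bounded k (p N : R) := forall g,
  \sum_z `|\sum_y k z y * g y| `^ p <= N * \sum_y `|g y| `^ p.

(** On a finite set finitely many dyadic levels bracket all positive values, so the layer cake
    integral of the interpolation becomes a finite sum. The sum of the inverses bounds the positive
    values from below. *)
Lemma dyadic_levels (F : X -> R) : (forall z, 0 <= F z) ->
  exists l0 : R, exists I : nat, 0 < l0 /\
  forall z, 0 < F z -> exists2 i, (i < I)%N & 2 * (l0 * 2 ^+ i) < F z <= 4 * (l0 * 2 ^+ i).
Proof.
move=> F0.
pose S := \sum_(z | 0 < F z) (F z)^-1.
have S0 : 0 <= S by apply: sumr_ge0 => z /ltW; rewrite invr_ge0.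
pose l0 : R := (S + 1)^-1 / 2.
have l00 : 0 < l0 by rewrite divr_gt0 ?invr_gt0 // ltr_wpDl.
pose T := (\sum_z F z) / l0.
pose I := (Num.Def.truncn T).+1.
exists l0; exists I.+1; split=> // z Fz.
have low : 2 * l0 < F z.
  rewrite /l0 mulrC divfK ?pnatr_eq0 // invf_plt ?posrE //; last by rewrite ltr_wpDl.
  rewrite /S (bigD1 z) //= -addrA ltrDl ltr_wpDl //.
  by apply: sumr_ge0 => y /andP[/ltW]; rewrite invr_ge0.
have eI : F z <= 4 * (l0 * 2 ^+ I).
  have FT : F z <= l0 * T.
    by rewrite /T mulrC divfK ?gt_eqF // (bigD1 z) //= lerDl sumr_ge0.
  apply: le_trans FT _; rewrite [leRHS]mulrCA; apply: ler_wpM2l; first exact: ltW.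
  have : T < I%:R by rewrite /I truncnS_gt.
  have : (I%:R : R) <= 2 ^+ I by rewrite -natrX ler_nat ltnW // ltn_expl.
  have : 0 <= 2 ^+ I :> R by rewrite exprn_ge0.
  lra.
have ex : exists i, F z <= 4 * (l0 * 2 ^+ i) by exists I.
case: (ex_minnP ex) => i h m; exists i; first by rewrite ltnS; apply: m.
rewrite h andbT; case: i h m => [|i] h m; first by rewrite expr0 mulr1.
rewrite ltNge; apply/negP => c.
suff : (i.+1 <= i)%N by rewrite ltnn.
by apply: m; apply: le_trans c _; rewrite exprS; lra.
Qed.

(** Marcinkiewicz interpolation on dyadic levels: the part of [g] above [lam i] is estimated by the
    weak type bound, the rest by the [l^2] bound. Summation over the levels leaves geometric series
    with exponents [p - 1 > 0] and [p - 2 < 0]. *)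
Lemma interpolation k (C2 Cw p : R) : 1 < p < 2 -> 0 <= C2 -> 0 <= Cw ->
  (forall g, \sum_z (\sum_y k z y * g y) ^+ 2 <= C2 * \sum_y g y ^+ 2) ->
  (forall g lam, 0 < lam ->
     lam * #|[pred z | lam < `|\sum_y k z y * g y|]|%:R <= Cw * \sum_y `|g y|) ->
  Lp_bounded k p (4 `^ p * (Cw / (1 - 2 `^ (1 - p)) + C2 / (1 - 2 `^ (p - 2)))).
Proof.
move=> /andP[p1 p2] C20 Cw0 L2 W g.
have p0 : 0 < p by lra.
have [l0 [I [l00 lev]]] := @dyadic_levels (fun z => `|\sum_y k z y * g y|) (fun z => normr_ge0 _).
pose lam i : R := l0 * 2 ^+ i.
have lam0 i : 0 < lam i by rewrite mulr_gt0 ?exprn_gt0.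
pose hi i y := if lam i < `|g y| then g y else 0.
pose lo i y := if lam i < `|g y| then 0 else g y.
have count i : #|[pred z | 2 * lam i < `|\sum_y k z y * g y|]|%:R <=
   Cw / lam i * \sum_(y | lam i < `|g y|) `|g y| +
   C2 / lam i ^+ 2 * \sum_(y | ~~ (lam i < `|g y|)) `|g y| ^+ 2.
  pose P1 := [pred z | lam i < `|\sum_y k z y * hi i y|].
  pose P2 := [pred z | lam i < `|\sum_y k z y * lo i y|].
  pose P0 := [pred z | 2 * lam i < `|\sum_y k z y * g y|].
  have c : (#|P0| <= #|P1| + #|P2|)%N.
    rewrite -cardUI; apply: leq_trans (leq_addr _ _).
    apply/subset_leq_card/fintype.subsetP => z; rewrite /P0 /P1 /P2 !inE => h.
    have e : \sum_y k z y * g y = \sum_y k z y * hi i y + \sum_y k z y * lo i y.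
      rewrite -big_split; apply: eq_bigr => y _; rewrite /= -mulrDr /hi /lo.
      by case: ifP; rewrite ?addr0 ?add0r.
    rewrite e in h; have := lt_le_trans h (ler_normD _ _).
    by apply: contraLR; rewrite negb_or -!leNgt => /andP[]; lra.
  apply: (@le_trans _ _ (#|P1|%:R + #|P2|%:R)); first by rewrite -natrD ler_nat.
  apply: lerD.
    have := W (hi i) _ (lam0 i); rewrite -/P1 mulrC -ler_pdivlMr // => /le_trans; apply.
    rewrite mulrAC ler_wpM2l ?mulr_ge0 ?invr_ge0 ?(ltW (lam0 i)) // [leRHS]big_mkcond.
    by apply: ler_sum => y _; rewrite /hi; case: ifP => // _; rewrite normr0.
  have l2 : 0 < lam i ^+ 2 by rewrite exprn_gt0.
  rewrite mulrAC ler_pdivlMr // mulrC.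
  apply: (@le_trans _ _ (\sum_z (\sum_y k z y * lo i y) ^+ 2)).
    rewrite mulr_natr -sumr_const big_mkcond; apply: ler_sum => z _.
    case: ifP => [h|_]; last exact: sqr_ge0.
    rewrite -[leRHS]real_normK ?num_real // lerXn2r ?nnegrE ?(ltW (lam0 i)) //.
    exact: ltW.
  apply: le_trans (L2 _) _; rewrite ler_wpM2l // [leRHS]big_mkcond.
  apply: ler_sum => y _; rewrite /lo; case: ifP => /= _; first by rewrite expr0n.
  by rewrite real_normK ?num_real.
apply: (@le_trans _ _ (4 `^ p * \sum_(i < I) lam i `^ p *
    #|[pred z | 2 * lam i < `|\sum_y k z y * g y|]|%:R)).
  apply: (@le_trans _ _ (\sum_z \sum_(i < I)
     if 2 * lam i < `|\sum_y k z y * g y| then 4 `^ p * lam i `^ p else 0)).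
    apply: ler_sum => z _; have := normr_ge0 (\sum_y k z y * g y).
    rewrite le_eqVlt => /orP[/eqP <-|Fz].
      rewrite powR0 ?gt_eqF //; apply: sumr_ge0 => i _.
      by case: ifP => // _; rewrite mulr_ge0 ?powR_ge0.
    have [i iI /andP[h1 h2]] := lev z Fz.
    rewrite (bigD1 (Ordinal iI)) //= /lam h1 -[leLHS]addr0 lerD //.
      rewrite -powRM ?(ltW (lam0 i)) //; apply: ge0_ler_powR => //; rewrite ?nnegrE ?(ltW p0) //.
      by rewrite mulr_ge0 // (ltW (lam0 i)).
    by apply: sumr_ge0 => j _; case: ifP => // _; rewrite mulr_ge0 ?powR_ge0.
  rewrite exchange_big /= mulr_sumr; apply: ler_sum => i _.
  by rewrite -big_mkcond sumr_const -[leLHS]mulr_natr mulrA.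
rewrite -mulrA; apply: ler_wpM2l; first exact: powR_ge0.
have lp1 i : lam i `^ p / lam i = lam i `^ (p - 1).
  by rewrite powRB ?gt_eqF ?implybT // powRr1 // ltW.
have lp2 i : lam i `^ p / lam i ^+ 2 = lam i `^ (- (2 - p)).
  rewrite opprB powRB; last by rewrite (gt_eqF (lam0 i)) implybT.
  by congr (_ / _); rewrite (@powR_mulrn _ _ 2) // ltW.
apply: (@le_trans _ _ (\sum_(i < I) (Cw * \sum_(y | lam i < `|g y|) lam i `^ (p - 1) * `|g y| +
   C2 * \sum_(y | ~~ (lam i < `|g y|)) lam i `^ (- (2 - p)) * `|g y| ^+ 2))).
  apply: ler_sum => i _; apply: le_trans (ler_wpM2l (powR_ge0 _ _) (count i)) _.
  rewrite -!mulr_sumr -lp1 -lp2 le_eqVlt; apply/orP; left; apply/eqP; ring.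
rewrite big_split /= -!mulr_sumr mulrDl; apply: lerD.
  rewrite -mulrA ler_wpM2l // mulr_sumr.
  under eq_bigr do rewrite big_mkcond /=.
  rewrite exchange_big /=; apply: ler_sum => y _; rewrite -big_mkcond /= -mulr_suml.
  have s0 : 0 < p - 1 by lra.
  have := geometric_up `|g y| I s0 l00; rewrite opprB -/lam => h.
  apply: le_trans (ler_wpM2r (normr_ge0 _) h) _.
  by rewrite -mulrA [_ `^ _ * _]mulrC mulr_powRB1.
rewrite -mulrA ler_wpM2l // mulr_sumr.
under eq_bigr do rewrite big_mkcond /=.
rewrite exchange_big /=; apply: ler_sum => y _; rewrite -big_mkcond /= -mulr_suml.
have t0 : 0 < 2 - p by lra.
case: (eqVneq (g y) 0) => [->|gy].
  by rewrite normr0 expr0n mulr0 powR0 ?mulr0 // gt_eqF.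
have gp : 0 < `|g y| by rewrite normr_gt0.
under eq_bigl do rewrite -leNgt.
have := geometric_down I t0 l00 gp; rewrite -/lam => h.
apply: le_trans (ler_wpM2r (sqr_ge0 _) h) _.
rewrite -mulrA -powR_mulrn ?normr_ge0 // -powRD; last by rewrite (gt_eqF gp) implybT.
by rewrite opprB subrK.
Qed.

(** The sum [S] is the pairing of [T] with [phi], where [|phi|^q = |T|^p]. It is moved to the
    transpose and split by Young's inequality with a weight [th]; the choice [th^q = N + 1] makes
    the dual term at most [S / q], so that it can be absorbed. *)
Lemma duality k (p q N : R) : 1 < p -> 1 < q -> p^-1 + q^-1 = 1 -> 0 <= N ->
  Lp_bounded (fun z y => k y z) q N -> Lp_bounded k p ((N + 1) `^ (p / q)).
Proof.
move=> p1 q1 pq N0 H g.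
have p0 : 0 < p by lra. have q0 : 0 < q by lra.
set S := \sum_z _.
pose T z := \sum_y k z y * g y.
pose phi z := Num.sg (T z) * `|T z| `^ (p - 1).
have pq' : (p - 1) * q = p.
  have e : p + q = p * q.
    have -> : p + q = p * q * (p^-1 + q^-1) by field; rewrite !gt_eqF.
    by rewrite pq mulr1.
  by rewrite mulrBl mul1r -e addrK.
have phiq z : `|phi z| `^ q = `|T z| `^ p.
  rewrite /phi normrM; case: (eqVneq (T z) 0) => [->|Tz].
    by rewrite sgr0 !normr0 mul0r !powR0 // gt_eqF.
  rewrite normr_sg Tz mul1r [`|_ `^ _|]ger0_norm ?powR_ge0 //.
  by rewrite -powRrM pq'.
have SE : S = \sum_z T z * phi z.
  apply: eq_bigr => z _; rewrite /phi mulrA [T z * _]mulrC -normrEsg.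
  by rewrite mulr_powRB1.
set th : R := (N + 1) `^ q^-1.
have N1 : 0 < N + 1 by lra.
have th0 : 0 < th by rewrite powR_gt0.
have thq : th `^ q = N + 1 by rewrite -powRrM mulVf ?gt_eqF // powRr1 ?ltW.
have thp : th `^ p = (N + 1) `^ (p / q) by rewrite -powRrM mulrC.
pose T' y := \sum_z k z y * phi z.
have S1 : S = \sum_y g y * T' y.
  rewrite SE; under eq_bigr do rewrite mulr_suml.
  rewrite exchange_big /=; apply: eq_bigr => y _; rewrite mulr_sumr.
  by apply: eq_bigr => z _; ring.
have S2 : S <= th `^ p / p * \sum_y `|g y| `^ p + (th `^ q)^-1 / q * \sum_y `|T' y| `^ q.
  rewrite S1 !mulr_sumr -big_split /=; apply: ler_sum => y _.
  apply: le_trans (ler_norm _) _; rewrite normrM.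
  have := @conjugate_powR R (th * `|g y|) (th^-1 * `|T' y|) p q.
  rewrite !mulr_ge0 ?invr_ge0 ?(ltW th0) // => /(_ isT isT p0 q0 pq).
  rewrite mulrACA mulfV ?gt_eqF // mul1r => /le_trans; apply.
  rewrite !powRM ?invr_ge0 ?(ltW th0) //.
  have -> : th^-1 `^ q = (th `^ q)^-1.
    by rewrite -[th^-1]powR_inv1 ?(ltW th0) // -powRrM mulN1r powRN.
  by rewrite [X in X + _]mulrAC [X in _ + X]mulrAC.
have Tq : \sum_y `|T' y| `^ q <= N * S.
  by apply: le_trans (H phi) _; rewrite ler_wpM2l //; under eq_bigr do rewrite phiq.
have S0 : 0 <= S by apply: sumr_ge0 => z _; exact: powR_ge0.
have S3 : (th `^ q)^-1 / q * \sum_y `|T' y| `^ q <= q^-1 * S.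
  rewrite thq; apply: (@le_trans _ _ ((N + 1)^-1 / q * (N * S))).
    by rewrite ler_wpM2l // divr_ge0 ?invr_ge0 ?ltW.
  have -> : (N + 1)^-1 / q * (N * S) = q^-1 * S * (N / (N + 1)) by ring.
  apply: ler_piMr; first by rewrite mulr_ge0 ?invr_ge0 ?(ltW q0).
  by rewrite ler_pdivrMr //; lra.
have : p^-1 * S <= p^-1 * (th `^ p * \sum_y `|g y| `^ p).
  have -> : p^-1 * S = S - q^-1 * S by rewrite -{2}[S]mul1r -pq; ring.
  rewrite lerBlDr; apply: le_trans S2 _; apply: lerD => //.
  by rewrite le_eqVlt; apply/orP; left; apply/eqP; ring.
by rewrite ler_pM2l ?invr_gt0 // thp.
Qed.
End Interpolation.

(** * Schemes on finite abelian groups *)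

Section Evolution.
Variables (R : realFieldType) (G : finZmodType) (e : G).
Implicit Types (U V : G -> R) (P Q : {poly R}) (x z : G) (g : nat -> G -> R).

Lemma sum_shift U z : \sum_x U (x + z) = \sum_x U x.
Proof. by rewrite [RHS](reindex_inj (addIr z)). Qed.

(** Polynomials act on functions, with [X] acting as the shift by [e]. Products become compositions
    by [pactM], so identities between kernels are identities between polynomials. *)
Definition pact P U x : R := \sum_(i < size P) P`_i * U (x + e *+ i).

Lemma pactE N P U x : (size P <= N)%N -> pact P U x = \sum_(i < N) P`_i * U (x + e *+ i).
Proof.
move=> sPN; rewrite /pact -(subnKC sPN) big_split_ord /= [X in _ + X]big1 ?addr0//.
by move=> i _; rewrite nth_default ?mul0r ?leq_addr.
Qed.

Lemma pactMXC P c U x : pact (P * 'X + c%:P) U x = pact P (fun y => U (y + e)) x + c * U x.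
Proof.
rewrite (@pactE (size P).+1); last first.
  by rewrite size_MXaddC; case: ifP => // _; rewrite leqnn.
rewrite big_ord_recl /= coefD coefMX coefC /= add0r mulr0n addr0 addrC; congr (_ + _).
by apply: eq_bigr => i _; rewrite coefD coefMX coefC /= addr0 mulrSr addrA.
Qed.

Lemma pact0 U x : pact 0 U x = 0.
Proof. by rewrite /pact size_poly0 big_ord0. Qed.

Lemma pact_ext P U V x : U =1 V -> pact P U x = pact P V x.
Proof. by move=> h; apply: eq_bigr => i _; rewrite h. Qed.

Lemma pactD P Q U x : pact (P + Q) U x = pact P U x + pact Q U x.
Proof.
rewrite (pactE (N := maxn (size P) (size Q)) _ _ (size_polyD _ _)).
rewrite (pactE (N := maxn (size P) (size Q)) _ _ (leq_maxl _ _)).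
rewrite [pact Q _ _](pactE (N := maxn (size P) (size Q)) _ _ (leq_maxr _ _)) -big_split /=.
by apply: eq_bigr => i _; rewrite coefD mulrDl.
Qed.

Lemma pactZ c P U x : pact (c *: P) U x = c * pact P U x.
Proof.
rewrite (pactE _ _ (size_scale_leq c P)) mulr_sumr.
by apply: eq_bigr => i _; rewrite coefZ mulrA.
Qed.

Lemma pact_shift P U z x : pact P (fun y => U (y + z)) x = pact P U (x + z).
Proof. by apply: eq_bigr => i _; rewrite addrAC. Qed.

Lemma pactM P Q U x : pact (P * Q) U x = pact P (pact Q U) x.
Proof.
elim/poly_ind: P x => [|P c IH] x; first by rewrite mul0r !pact0.
rewrite mulrDl pactD mul_polyC pactZ pactMXC; congr (_ + _).
rewrite pact_shift -IH -mulrA [_ * Q]mulrC mulrA.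
by rewrite -[P * Q * _]addr0 -polyC0 pactMXC mul0r addr0 pact_shift.
Qed.

Definition avgQ U x : R := (U (x + e) + 2 * U x + U (x - e)) / 4.
Definition diff2 U x : R := U (x + e) - 2 * U x + U (x - e).

Lemma avgQE U x : avgQ U x = pact (halfX R ^+ 2) U (x - e).
Proof.
rewrite expr2 pactM /halfX -[in RHS]polyC1 -[_ + _]mul1r.
have H V y : pact (2^-1 *: (1 * ('X + 1%:P))) V y = 2^-1 * (V (y + e) + V y).
  rewrite pactZ; congr (_ * _); rewrite -{1}polyC1 mul_polyC scale1r.
  rewrite -['X]mul1r -{1}polyC1 pactMXC mul1r; congr (_ + _).
  by rewrite (pactE _ _ (size_polyC_leq1 _)) big_ord1 coefC eqxx mul1r addr0.
by rewrite H /= !H subrK /avgQ; field.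
Qed.

Lemma diff2E U x : diff2 U x = pact (diffX R ^+ 2) U (x - e).
Proof.
have H V y : pact (diffX R) V y = V (y + e) - V y.
  rewrite /diffX -polyC1 -polyCN -['X]mul1r -{1}polyC1 pactMXC mulN1r; congr (_ - _).
  by rewrite (pactE _ _ (size_polyC_leq1 _)) big_ord1 coefC eqxx mul1r addr0.
by rewrite expr2 pactM H !H subrK /diff2; ring.
Qed.

Lemma diff2_iter n U x :
  diff2 (iter n avgQ U) x = pact (kerP R n) U (x - e *+ n.+1).
Proof.
elim: n U x => [|n IH] U x; first by rewrite /kerP mulr1 diff2E.
rewrite iterSr IH (pact_ext _ _ (avgQE U)).
rewrite (pact_shift _ (pact (halfX R ^+ 2) U)) -pactM.
have -> : kerP R n * halfX R ^+ 2 = kerP R n.+1.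
  by rewrite /kerP -mulrA -exprD mulnS addnC.
by rewrite -addrA -opprD -mulrSr.
Qed.

Fixpoint heat_sol g n : G -> R :=
  if n is m.+1 then fun x => avgQ (heat_sol g m) x + g m x else fun=> 0.

Lemma avgQ_ext U V x : U =1 V -> avgQ U x = avgQ V x.
Proof. by move=> h; rewrite /avgQ !h. Qed.

Lemma avgQ_sum (I : finType) (F : I -> G -> R) x :
  avgQ (fun y => \sum_i F i y) x = \sum_i avgQ (F i) x.
Proof. by rewrite /avgQ -mulr_suml !big_split /= -mulr_sumr. Qed.

(** Duhamel's formula. *)
Lemma heat_solE g n x : heat_sol g n.+1 x = \sum_(j < n.+1) iter (n - j) avgQ (g j) x.
Proof.
elim: n x => [|n IH] x.
  by rewrite big_ord1 /= /avgQ; ring.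
rewrite big_ord_recr /= subnn; congr (_ + _).
rewrite (@avgQ_ext _ (fun y => \sum_(j < n.+1) iter (n - j) avgQ (g j) y)); last first.
  exact: IH.
rewrite avgQ_sum; apply: eq_bigr => j _.
by rewrite subSn // -ltnS.
Qed.

Lemma diff2_ext U V x : U =1 V -> diff2 U x = diff2 V x.
Proof. by move=> h; rewrite /diff2 !h. Qed.

Lemma diff2_sum (I : finType) (F : I -> G -> R) x :
  diff2 (fun y => \sum_i F i y) x = \sum_i diff2 (F i) x.
Proof. by rewrite /diff2 /= mulr_sumr -sumrN -!big_split. Qed.

Lemma diff2_heat_sol g n x : diff2 (heat_sol g n.+1) x =
  \sum_(j < n.+1) pact (kerP R (n - j)) (g j) (x - e *+ (n - j).+1).
Proof.
rewrite (diff2_ext _ (heat_solE g n)) diff2_sum.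
by apply: eq_bigr => j _; rewrite diff2_iter.
Qed.

Lemma sum_coefz_reverse (P : {poly R}) (F : nat -> R) c B : (size P <= c.+1)%N -> (c < B)%N ->
  \sum_(b < B) coefz P (c%:Z - b%:Z) * F b = \sum_(i < size P) P`_i * F (c - i)%N.
Proof.
move=> sP cB; rewrite -(subnKC cB) big_split_ord /= [X in _ + X]big1 ?addr0; last first.
  move=> i _; have -> : (c%:Z - (c.+1 + i)%N%:Z = Negz i)%R by lia.
  by rewrite mul0r.
rewrite (reindex_inj rev_ord_inj) /=.
rewrite -(subnKC sP) big_split_ord /= [X in _ + X]big1 ?addr0; last first.
  move=> i _; have -> : (c%:Z - (size P + (c.+1 - size P) - (size P + i).+1)%N%:Z = (size P + i)%N%:Z)%R.
    by have := ltn_ord i; move: (nat_of_ord i) => k; move: (size P) sP => N sP; lia.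
  by rewrite /= nth_default ?mul0r // leq_addr.
apply: eq_bigr => i _; have := ltn_ord i => hi.
have ic : (i <= c)%N by rewrite -ltnS (leq_trans hi sP).
rewrite (subnKC sP) subSS; congr (_ * _).
by move: (nat_of_ord i) ic => k hk; have -> // : (c%:Z - (c - k)%N%:Z = k%:Z)%R by lia.
Qed.

(* The window runs in the direction [- e], so that the convolution with the
   kernel needs no reflection. *)
Lemma window_eq g K B n b x : (n < K)%N -> (n < b)%N -> (b + n.+1 < B)%N ->
  diff2 (heat_sol g n.+1) (x - e *+ b) =
  \sum_(j < K) \sum_(b' < B) heat_kernel R (n, b) (j : nat, b' : nat) * g j (x - e *+ b').
Proof.
move=> nK nb bB; rewrite diff2_heat_sol -(subnKC nK) big_split_ord /=.
rewrite [X in _ = _ + X]big1 ?addr0; last first.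
  move=> j _; rewrite big1 // => b' _; rewrite heat_kernel_lt ?mul0r //=; lia.
apply: eq_bigr => j _; have := ltn_ord j; rewrite ltnS => jn.
under eq_bigr => b' _.
  rewrite heat_kernelE //= /heatK.
  have -> : (b%:Z - b'%:Z + (n - j).+1%:Z = (b + (n - j).+1)%N%:Z - b'%:Z)%R by lia.
  over.
have sz := size_kerP R (n - j).
rewrite (@sum_coefz_reverse _ (fun b' => g j (x - e *+ b'))); last 2 first.
- by apply: leq_trans sz _; lia.
- lia.
apply: eq_bigr => i _; congr (_ * g _ _); have hi := leq_trans (ltn_ord i) sz.
rewrite mulrnBr; last by lia.
by rewrite mulrnDr !opprD opprK !addrA.
Qed.

Definition dotG U V := \sum_x U x * V x.

(** Write [Q] for the lazy average. Its symbol is a squared cosine, so [0 <= Q^2 <= Q], and [diff2]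
    is [4 (Q - 1)], whence [16]. Non-negativity of the form of [Q] at [W n.+1 - W n] turns
    [|g n|^2 = |W n.+1 - Q (W n)|^2] into an inequality in which [q - s] telescopes. *)
Lemma heat_sol_L2 g K :
  \sum_(n < K) \sum_x diff2 (heat_sol g n.+1) x ^+ 2 <= 16 * \sum_(n < K) \sum_x g n x ^+ 2.
Proof.
have sh U V z : \sum_x U (x + z) * V (x + z) = \sum_x U x * V x.
  exact: (sum_shift (fun x => U x * V x)).
pose q U := dotG (avgQ U) U.
pose s U := dotG (avgQ U) (avgQ U).
pose c0 U := dotG U U.
have sym U V : dotG (avgQ U) V = dotG U (avgQ V).
  rewrite /dotG /avgQ.
  have -> : \sum_x (U (x + e) + 2 * U x + U (x - e)) / 4 * V x =
    4^-1 * (\sum_x U (x + e) * V x + 2 * (\sum_x U x * V x) + \sum_x U (x - e) * V x).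
    by rewrite !mulr_sumr -!big_split mulr_sumr /=; apply: eq_bigr => x _; ring.
  have -> : \sum_x U x * ((V (x + e) + 2 * V x + V (x - e)) / 4) =
    4^-1 * (\sum_x U x * V (x + e) + 2 * (\sum_x U x * V x) + \sum_x U x * V (x - e)).
    by rewrite !mulr_sumr -!big_split mulr_sumr /=; apply: eq_bigr => x _; ring.
  have -> : \sum_x U (x + e) * V x = \sum_x U x * V (x - e).
    by rewrite -(sum_shift _ (- e)); apply: eq_bigr => x _; rewrite subrK.
  have -> : \sum_x U (x - e) * V x = \sum_x U x * V (x + e).
    by rewrite -(sum_shift _ e); apply: eq_bigr => x _; rewrite addrK.
  ring.
have bN U : \sum_x U (x - e) * U x = \sum_x U (x + e) * U x.
  by rewrite -(sum_shift _ e); apply: eq_bigr => x _; rewrite addrK mulrC.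
have qE U : q U = 2^-1 * (\sum_x U (x + e) * U x + \sum_x U x * U x).
  transitivity (4^-1 * (\sum_x U (x + e) * U x + 2 * (\sum_x U x * U x) + \sum_x U (x - e) * U x)).
    by rewrite !mulr_sumr -!big_split mulr_sumr /=; apply: eq_bigr => x _; rewrite /avgQ; ring.
  by rewrite bN; field.
have qpos U : 0 <= q U.
  have -> : q U = 4^-1 * \sum_x (U x + U (x + e)) ^+ 2.
    have -> : \sum_x (U x + U (x + e)) ^+ 2 =
      \sum_x U x * U x + 2 * (\sum_x U (x + e) * U x) + \sum_x U (x + e) * U (x + e).
      by rewrite !mulr_sumr -!big_split /=; apply: eq_bigr => x _; ring.
    by rewrite sh qE; field.
  by rewrite mulr_ge0 ?invr_ge0 // sumr_ge0 // => x _; exact: sqr_ge0.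
have qs U : s U <= q U.
  rewrite -subr_ge0.
  have -> : q U - s U = 16^-1 * \sum_x (U (x + e) - U (x - e)) ^+ 2.
    have -> : \sum_x (U (x + e) - U (x - e)) ^+ 2 =
      \sum_x U (x + e) * U (x + e) - 2 * (\sum_x U (x + e) * U (x - e)) + \sum_x U (x - e) * U (x - e).
      by rewrite !mulr_sumr -sumrN -!big_split /=; apply: eq_bigr => x _; ring.
    have -> : s U = 16^-1 * (\sum_x U (x + e) * U (x + e) + \sum_x U (x - e) * U (x - e) +
      4 * (\sum_x U x * U x) + 4 * (\sum_x U (x + e) * U x) + 4 * (\sum_x U (x - e) * U x)
      + 2 * (\sum_x U (x + e) * U (x - e))).
      rewrite /s /dotG /avgQ !mulr_sumr -!big_split mulr_sumr /=.
      by apply: eq_bigr => x _; field.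
    by rewrite qE !sh bN; field.
  by rewrite mulr_ge0 ?invr_ge0 // sumr_ge0 // => x _; exact: sqr_ge0.
pose W n := heat_sol g n.
have dE U : \sum_x diff2 U x ^+ 2 = 16 * (s U - 2 * q U + c0 U).
  rewrite /s /q /c0 /dotG !mulr_sumr -sumrN -!big_split mulr_sumr /=.
  by apply: eq_bigr => x _; rewrite /diff2 /avgQ; field.
have gE n : \sum_x g n x ^+ 2 = c0 (W n.+1) - 2 * dotG (avgQ (W n)) (W n.+1) + s (W n).
  rewrite /c0 /s /dotG !mulr_sumr -sumrN -!big_split /=.
  by apply: eq_bigr => x _; rewrite /W /=; ring.
have main : \sum_(n < K) (s (W n.+1) - 2 * q (W n.+1) + c0 (W n.+1)) + (q (W K) - s (W K)) <=
  \sum_(n < K) \sum_x g n x ^+ 2.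
  elim: K => [|K IH].
    rewrite !big_ord0 add0r /q /s /dotG -sumrB big1 // => x _ /=.
    by rewrite /avgQ /W /=; ring.
  rewrite !big_ord_recr /=.
  have := qpos (fun x => W K.+1 x - W K x).
  have -> : q (fun x => W K.+1 x - W K x) = q (W K.+1) + q (W K) - 2 * dotG (avgQ (W K)) (W K.+1).
    have -> : q (fun x => W K.+1 x - W K x) =
      q (W K.+1) + q (W K) - dotG (avgQ (W K)) (W K.+1) - dotG (avgQ (W K.+1)) (W K).
      rewrite /q /dotG -!sumrN -!big_split /=; apply: eq_bigr => x _.
      by rewrite /avgQ; field.
    rewrite [dotG (avgQ (W K.+1)) _]sym.
    have -> : dotG (W K.+1) (avgQ (W K)) = dotG (avgQ (W K)) (W K.+1).
      by apply: eq_bigr => x _; rewrite mulrC.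
    ring.
  move: IH; rewrite (gE K); lra.
under eq_bigr do rewrite dE.
rewrite -mulr_sumr ler_pM2l //; apply: le_trans main.
by rewrite lerDl subr_ge0.
Qed.
End Evolution.

Section WindowL2.
Variable R : realFieldType.

Lemma heat_kernel_shift n b j b' s :
  heat_kernel R (n, b + s)%N (j, b' + s)%N = heat_kernel R (n, b) (j, b').
Proof.
rewrite /heat_kernel /=; case: ifP => // _; congr heatK.
by rewrite !PoszD opprD addrACA subrr addr0.
Qed.

Lemma sum_inj_le (I T : finType) (f : I -> T) (F : T -> R) : injective f ->
  (forall y, 0 <= F y) -> \sum_i F (f i) <= \sum_y F y.
Proof.
move=> fi F0; rewrite [leRHS](bigID (mem (f @: [set: I]))) /=.
rewrite big_imset /=; last by move=> ? ? _ _; exact: fi.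
have -> : \sum_(i in [set: I]) F (f i) = \sum_i F (f i) by apply: eq_bigl => i; rewrite inE.
by rewrite lerDl sumr_ge0.
Qed.

(** The energy estimate is carried over to the bare kernel by placing the data on a cyclic group,
    with margins wide enough that [A] steps do not wrap around. *)
Lemma window_L2 A B (g : nat -> nat -> R) :
  \sum_(n < A) \sum_(b < B)
    (\sum_(j < A) \sum_(b' < B) heat_kernel R (n : nat, b : nat) (j : nat, b' : nat) * g j b') ^+ 2
  <= 16 * \sum_(n < A) \sum_(b < B) g n b ^+ 2.
Proof.
set s := A.+1; set D := (s + (B + s.+1))%N.
pose G := 'I_D.+2.
(* Data are read at [- y] because the window of [window_eq] runs in the direction [- e]; outside the
   window they are [0]. *)
pose gG (j : nat) (y : G) : R :=
  let m := nat_of_ord (- y) in if (s <= m < s + B)%N then g j (m - s)%N else 0.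
have vG b : (b < D.+2)%N -> nat_of_ord ((1 : G) *+ b) = b.
  by move=> h; rewrite -[_ *+ _]/(b%:R) Zp_nat /= modn_small.
have gGE j b : (b < D.+2)%N -> gG j (0 - (1 : G) *+ b) = if (s <= b < s + B)%N then g j (b - s)%N else 0.
  by move=> h; rewrite /gG sub0r opprK vG.
have key (n : 'I_A) (b : 'I_B) : diff2 1 (heat_sol 1 gG n.+1) (0 - (1 : G) *+ (b + s)) =
   \sum_(j < A) \sum_(b' < B) heat_kernel R (n : nat, b : nat) (j : nat, b' : nat) * g j b'.
  rewrite (@window_eq _ _ _ _ A D n) //; first last.
  - by rewrite /D /s; have := ltn_ord n; have := ltn_ord b; lia.
  - by rewrite /s; have := ltn_ord n; lia.
  apply: eq_bigr => j _; rewrite big_split_ord /= [X in X + _]big1 ?add0r; last first.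
    move=> i _; rewrite gGE; last by rewrite /D; have := ltn_ord i; lia.
    by rewrite leqNgt ltn_ord mulr0.
  rewrite big_split_ord /= [X in _ + X]big1 ?addr0; last first.
    move=> i _; rewrite gGE; last by rewrite /D; have := ltn_ord i; lia.
    by rewrite ltn_add2l (ltnNge (B + i)) !leq_addr andbF mulr0.
  apply: eq_bigr => i _; rewrite gGE; last by rewrite /D; have := ltn_ord i; lia.
  by rewrite leq_addr ltn_add2l ltn_ord addKn (addnC s) heat_kernel_shift.
apply: (@le_trans _ _ (16 * \sum_(n < A) \sum_x gG n x ^+ 2)).
  apply: le_trans (heat_sol_L2 (1 : G) gG A); apply: ler_sum => n _.
  under eq_bigr do rewrite -key.
  apply: (@sum_inj_le _ G (fun b : 'I_B => 0 - (1 : G) *+ (b + s)) (fun x => diff2 1 (heat_sol 1 gG n.+1) x ^+ 2)).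
    move=> b b' /addrI/oppr_inj/(congr1 (@nat_of_ord _)).
    have hb := ltn_ord b; have hb' := ltn_ord b'.
    rewrite !vG; [|by rewrite /D; lia|by rewrite /D; lia].
    by move/addIn/val_inj.
  by move=> x; exact: sqr_ge0.
rewrite ler_pM2l //; apply: ler_sum => n _.
rewrite (reindex_inj oppr_inj) /=.
under eq_bigr do rewrite /gG opprK.
pose f m : R := (if (s <= m < s + B)%N then g n (m - s)%N else 0) ^+ 2.
apply: le_trans (@sum_supp_le R f s B D.+2 _ _) _.
- by move=> a; exact: sqr_ge0.
- by move=> a /negbTE h; rewrite /f h expr0n.
by apply: ler_sum => i _; rewrite /f leq_addr ltn_add2l ltn_ord addKn.
Qed.

End WindowL2.

(** * Dyadic parabolic boxes and the weak type estimate *)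

Section ParabolicBoxes.
Variable R : realFieldType.

Lemma card_interval_le A p q : (#|[pred a : 'I_A | (p <= a < p + q)%N]| <= q)%N.
Proof.
rewrite -(ler_nat R) -sum1_card natr_sum big_mkcond /=.
pose f a : R := if (p <= a < p + q)%N then 1 else 0.
have := @sum_supp_le R f p q A; move=> H.
apply: le_trans (_ : \sum_(a < A) f a <= _).
  by apply: ler_sum => a _; rewrite /f inE.
apply: le_trans (H _ _) _.
- by move=> a; rewrite /f; case: ifP.
- by move=> a /negbTE h; rewrite /f h.
rewrite -[q in leRHS]card_ord -sum1_card natr_sum; apply: ler_sum => i _.
by rewrite /f; case: ifP.
Qed.

Lemma card_block M P c : (c < M)%N -> (0 < P)%N ->
  #|[pred a : 'I_(M * P) | (a %/ P == c)%N]| = P.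
Proof.
move=> cM P0.
have hf (i : 'I_P) : (c * P + i < M * P)%N.
  apply: (@leq_trans (c.+1 * P)); last by rewrite leq_mul2r cM orbT.
  by rewrite mulSn addnC ltn_add2r.
pose f (i : 'I_P) : 'I_(M * P) := Ordinal (hf i).
have fi : injective f by move=> i j /(congr1 val) /= /addnI/val_inj.
rewrite -[RHS]card_ord -(card_codom fi); apply: eq_card => a; rewrite !inE.
apply/eqP/codomP => [e|[i ->] /=]; last by rewrite divnMDl // divn_small // addn0.
exists (Ordinal (ltn_pmod a P0)); apply: val_inj => /=.
by rewrite -e -divn_eq.
Qed.

Variable J : nat.
Let X : finType := ('I_(4 ^ J) * 'I_(2 ^ J))%type.
Definition box_pt (z : X) : nat * nat := (nat_of_ord z.1, nat_of_ord z.2).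
Definition box_kernel (z y : X) : R := heat_kernel R (box_pt z) (box_pt y).

Lemma plabel_nested j y z : plabel j z = plabel j y -> plabel j.+1 z = plabel j.+1 y.
Proof. by case=> e1 e2; rewrite /plabel !expnSr !divnMA e1 e2. Qed.

Lemma plabel_top (z y : X) : plabel J (box_pt z) = plabel J (box_pt y).
Proof. by rewrite /plabel !divn_small ?ltn_ord. Qed.

Lemma plabel_card j (z : X) : (j <= J)%N ->
  #|[pred y : X | plabel j (box_pt y) == plabel j (box_pt z)]| = (8 ^ j)%N.
Proof.
move=> jJ.
have H b (a : 'I_(b ^ J)) : (0 < b)%N ->
   #|[pred y : 'I_(b ^ J) | (y %/ b ^ j == a %/ b ^ j)%N]| = (b ^ j)%N.
  move=> b0; have e : (b ^ J = b ^ (J - j) * b ^ j)%N by rewrite -expnD subnK.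
  move: a; rewrite e => a; apply: card_block; last by rewrite expn_gt0 b0.
  by rewrite ltn_divLR ?expn_gt0 ?b0.
have -> : (8 ^ j = 4 ^ j * 2 ^ j)%N by rewrite -expnMn.
rewrite -(H 4 z.1 isT) -(H 2 z.2 isT) -cardX; apply: eq_card => y.
by rewrite !inE /plabel xpair_eqE.
Qed.

Lemma near_box_card j (z : X) :
  (#|[pred y : X | near_box j (plabel j (box_pt z)) (box_pt y)]| <= 6 * 8 ^ j)%N.
Proof.
set l := plabel j _; clearbody l.
pose A1 := [pred a : 'I_(4 ^ J) | (l.1 * 4 ^ j <= a < l.1 * 4 ^ j + 2 * 4 ^ j)%N].
pose A2 := [pred a : 'I_(2 ^ J) | (l.2.-1 * 2 ^ j <= a < l.2.-1 * 2 ^ j + 3 * 2 ^ j)%N].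
have -> : (6 * 8 ^ j = (2 * 4 ^ j) * (3 * 2 ^ j))%N.
  by rewrite mulnACA -expnMn.
apply: leq_trans (leq_mul (card_interval_le (4 ^ J) (l.1 * 4 ^ j) (2 * 4 ^ j))
  (card_interval_le (2 ^ J) (l.2.-1 * 2 ^ j) (3 * 2 ^ j))).
rewrite -(cardX A1 A2); apply/subset_leq_card/fintype.subsetP => y; rewrite !inE => /and4P[].
rewrite /plabel /=.
have p4 : (0 < 4 ^ j)%N by rewrite expn_gt0.
have p2 : (0 < 2 ^ j)%N by rewrite expn_gt0.
move: (4 ^ j)%N (2 ^ j)%N p4 p2 => p q p4 p2 h1 h2 h3 h4.
rewrite -!mulnDl -!leq_divRL // h1 -!ltn_divLR // addn2 ltnS h2 /=.
by move: (_ %/ q)%N (l.2) h3 h4 => w v h3 h4; apply/andP; split; lia.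
Qed.

Lemma box_kernel_L2 (g : X -> R) :
  \sum_z (\sum_y box_kernel z y * g y) ^+ 2 <= 16 * \sum_y g y ^+ 2.
Proof.
pose g' n b := if insub n is Some n' then if insub b is Some b' then g (n', b') else 0 else 0.
have g'E n b : g' (nat_of_ord n) (nat_of_ord b) = g (n, b) by rewrite /g' !valK.
have := window_L2 (4 ^ J) (2 ^ J) g'.
under eq_bigr do under eq_bigr do under eq_bigr do under eq_bigr do rewrite g'E.
under [X in _ <= _ * X -> _]eq_bigr do under eq_bigr do rewrite g'E.
rewrite !pair_big /= => h.
move: h; under [X in X <= _ -> _]eq_bigr do rewrite pair_big /=.
by congr (_ <= _); [apply: eq_bigr => -[z1 z2] _; congr (_ ^+ _); apply: eq_bigr => -[y1 y2] _
  | congr (_ * _); apply: eq_bigr => -[y1 y2] _].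
Qed.

Lemma box_kernel_hormander j (y y' : X) : plabel j (box_pt y) = plabel j (box_pt y') ->
  \sum_(z | ~~ near_box j (plabel j (box_pt y)) (box_pt z)) `|box_kernel z y - box_kernel z y'|
    <= 800.
Proof.
move=> e; apply: le_trans (@heat_kernel_hormander R j _ _ (4 ^ J) (2 ^ J) e).
by rewrite pair_big_dep /= le_eqVlt; apply/orP; left; apply/eqP; apply: eq_big => -[z1 z2].
Qed.

Lemma box_weak_type (g : X -> R) (lam : R) : 0 < lam ->
  lam * #|[pred z | lam < `|\sum_y box_kernel z y * g y|]|%:R
    <= (32 * 16 + 7 + 4 * 800) * \sum_y `|g y|.
Proof.
apply: (@cz_weak_type R X (nat * nat)%type (fun j z => plabel j (box_pt z)) J
  _ _ _ box_kernel 800 16 (fun j l z => near_box j l (box_pt z))).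
- by move=> j z y; exact: plabel_nested.
- exact: plabel_top.
- exact: plabel_card.
- exact: ler0n.
- exact: ler0n.
- exact: box_kernel_L2.
- by move=> j z _; exact: near_box_card.
- exact: box_kernel_hormander.
Qed.

(** Reversing both time and space transposes the kernel. The transpose therefore inherits the bounds
    for exponents below [2], and duality reaches those above. *)
Lemma box_kernel_rev (z y : X) :
  box_kernel y z = box_kernel (rev_ord z.1, rev_ord z.2) (rev_ord y.1, rev_ord y.2).
Proof.
rewrite /box_kernel /heat_kernel /=.
have h1 := ltn_ord z.1; have h2 := ltn_ord z.2.
have h3 := ltn_ord y.1; have h4 := ltn_ord y.2.
move: (4 ^ J)%N (2 ^ J)%N (nat_of_ord z.1) (nat_of_ord z.2) (nat_of_ord y.1) (nat_of_ord y.2) h1 h2 h3 h4.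
move=> M N a b c d h1 h2 h3 h4.
have -> : (M - c.+1 <= M - a.+1)%N = (a <= c)%N by lia.
case: ifP => // ac; congr (heatK R _ _); lia.
Qed.
End ParabolicBoxes.

(** * Estimates in l^p, from boxes to finite groups *)

Section DiscreteEstimate.
Variable R : realType.

Lemma box_kernel_rev_bounded J (q N : R) :
  Lp_bounded (@box_kernel R J) q N -> Lp_bounded (fun z y => @box_kernel R J y z) q N.
Proof.
move=> H g; pose X := ('I_(4 ^ J) * 'I_(2 ^ J))%type.
pose rho (z : X) : X := (rev_ord z.1, rev_ord z.2).
have rhoK : involutive rho by move=> [a b]; rewrite /rho /= !rev_ordK.
have := H (g \o rho).
rewrite [X in X <= _ -> _](reindex_inj (inv_inj rhoK)).
rewrite [X in _ <= _ * X -> _](reindex_inj (inv_inj rhoK)) /=.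
under [X in _ <= _ * X -> _]eq_bigr do rewrite rhoK.
move=> h; apply: le_trans h; apply: ler_sum => z _.
rewrite [in leRHS](reindex_inj (inv_inj rhoK)) /=.
by under [in leRHS]eq_bigr do rewrite rhoK -box_kernel_rev.
Qed.

Lemma box_kernel_Lp_low (p : R) : 1 < p < 2 ->
  exists2 N, 0 <= N & forall J, Lp_bounded (@box_kernel R J) p N.
Proof.
move=> p12; have [p1 p2] := andP p12.
have gp (s : R) : 0 < s -> 0 <= (1 - 2 `^ (- s))^-1.
  move=> s0; rewrite invr_ge0 subr_ge0 powRN invf_le1 ?powR_gt0 //.
  exact/ltW/powR_two_gt1.
have i1 : 0 <= (1 - 2 `^ (1 - p))^-1 by rewrite -[1 - p]opprB; apply: gp; lra.
have i2 : 0 <= (1 - 2 `^ (p - 2))^-1 by rewrite -[p - 2]opprB; apply: gp; lra.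
have k0 : 0 <= 32 * 16 + 7 + 4 * 800 :> R by lra.
exists (4 `^ p * ((32 * 16 + 7 + 4 * 800) / (1 - 2 `^ (1 - p)) + 16 / (1 - 2 `^ (p - 2)))).
  exact: mulr_ge0 (powR_ge0 _ _) (addr_ge0 (mulr_ge0 k0 i1) (mulr_ge0 (ler0n _ 16) i2)).
move=> J; apply: (interpolation p12 (ler0n _ 16) k0).
- exact: box_kernel_L2.
- exact: box_weak_type.
Qed.

Lemma box_kernel_Lp (p : R) : 1 < p ->
  exists2 N, 0 <= N & forall J, Lp_bounded (@box_kernel R J) p N.
Proof.
move=> p1; case: (ltgtP p 2) => p2; first by apply: box_kernel_Lp_low; rewrite p1.
  pose q := p / (p - 1).
  have p10 : 0 < p - 1 by lra.
  have q12 : 1 < q < 2 by rewrite ltr_pdivlMr // ltr_pdivrMr //; lra.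
  have [N N0 H] := box_kernel_Lp_low q12.
  exists ((N + 1) `^ (p / q)); first exact: powR_ge0.
  move=> J; apply: (@duality _ _ _ p q) => //.
  - by case/andP: q12.
  - by rewrite /q; field; rewrite !gt_eqF //; lra.
  - exact: box_kernel_rev_bounded.
exists 16 => // J g; have := @box_kernel_L2 R J g; rewrite p2.
have e (x : R) : `|x| `^ 2 = x ^+ 2 by rewrite (@powR_mulrn _ _ 2) // real_normK ?num_real.
by under eq_bigr do rewrite -e; under [X in _ <= _ * X -> _]eq_bigr do rewrite -e.
Qed.

(** Data on a window are extended by zero to a dyadic box, on whose size the constant does not
    depend. *)
Lemma window_Lp (p : R) : 1 < p ->
  exists2 N, 0 <= N & forall A B (g : nat -> nat -> R),
  \sum_(n < A) \sum_(b < B)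
    `|\sum_(j < A) \sum_(b' < B) heat_kernel R (n : nat, b : nat) (j : nat, b' : nat) * g j b'| `^ p
  <= N * \sum_(n < A) \sum_(b < B) `|g n b| `^ p.
Proof.
move=> p1; have [N N0 H] := box_kernel_Lp p1; exists N => // A B g.
set J := (A + B)%N.
have AJ : (A <= 4 ^ J)%N.
  apply: leq_trans (ltnW (ltn_expl A (isT : 1 < 4)%N)) _; by rewrite leq_exp2l ?leq_addr.
have BJ : (B <= 2 ^ J)%N.
  apply: leq_trans (ltnW (ltn_expl B (isT : 1 < 2)%N)) _; by rewrite leq_exp2l ?leq_addl.
pose g' (y : 'I_(4 ^ J) * 'I_(2 ^ J)) := if (y.1 < A)%N && (y.2 < B)%N then g y.1 y.2 else 0.
have cut (F : nat -> nat -> R) : \sum_(y : 'I_(4 ^ J) * 'I_(2 ^ J))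
   (if (y.1 < A)%N && (y.2 < B)%N then F y.1 y.2 else 0) = \sum_(n < A) \sum_(b < B) F n b.
  rewrite (big_ord_widen _ (fun n => \sum_(b < B) F n b) AJ) -(pair_bigA _ (fun n b =>
    if (nat_of_ord n < A)%N && (nat_of_ord b < B)%N then F n b else 0)) /= [RHS]big_mkcond.
  apply: eq_bigr => n _; case: ifP => /= _; last by rewrite big1.
  by rewrite (big_ord_widen _ (fun b => F n b) BJ) [RHS]big_mkcond.
have := H J g'.
have -> : \sum_y `|g' y| `^ p = \sum_(n < A) \sum_(b < B) `|g n b| `^ p.
  rewrite -(cut (fun n b => `|g n b| `^ p)); apply: eq_bigr => y _; rewrite /g'.
  by case: ifP => // _; rewrite normr0 powR0 // gt_eqF // (lt_trans ltr01).
move=> h; apply: le_trans h.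
rewrite -(cut (fun n b => `|\sum_(j < A) \sum_(b' < B) heat_kernel R (n, b) (j : nat, b' : nat) * g j b'| `^ p)).
apply: ler_sum => z _; case: ifP => _; last exact: powR_ge0.
suff -> : \sum_(j < A) \sum_(b' < B) heat_kernel R (nat_of_ord z.1, nat_of_ord z.2) (j : nat, b' : nat) * g j b'
  = \sum_y box_kernel R z y * g' y by exact: lexx.
rewrite -(cut (fun j b' => heat_kernel R (nat_of_ord z.1, nat_of_ord z.2) (j, b') * g j b')).
by apply: eq_bigr => y _; rewrite /g'; case: ifP => // _; rewrite mulr0.
Qed.

(** Transference: the window estimate is summed over all base points of [G], and translation
    invariance makes each side a multiple of a sum over [G]. *)
Lemma heat_sol_Lp (p : R) : 1 < p ->
  exists2 N, 0 <= N & forall (G : finZmodType) (e : G) (g : nat -> G -> R) K,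
  \sum_(n < K) \sum_x `|diff2 e (heat_sol e g n.+1) x| `^ p
  <= N * \sum_(n < K) \sum_x `|g n x| `^ p.
Proof.
move=> p1; have [N N0 H] := window_Lp p1; exists (2 * N); first by rewrite mulr_ge0.
move=> G e g K.
(* [window_eq] sacrifices [K.+1] points at either end. With [M = 2 K + 2] the whole window is twice
   as long as its useful part, hence the factor [2], uniform in [K]. *)
set M := (2 * K).+2; set B := (M + M)%N.
set S := \sum_(n < K) \sum_x _; set T := \sum_(n < K) \sum_x _.
have M0 : 0 < M%:R :> R by rewrite ltr0n.
rewrite -(ler_pM2l M0).
have step : \sum_x \sum_(n < K) \sum_(b < M) `|diff2 e (heat_sol e g n.+1) (x - e *+ (K.+1 + b))| `^ p
  <= \sum_x N * \sum_(n < K) \sum_(b < B) `|g n (x - e *+ b)| `^ p.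
  apply: ler_sum => x _; apply: le_trans (H K B (fun j b => g j (x - e *+ b))).
  apply: ler_sum => n _.
  have -> : B = (K.+1 + (M + K.+1))%N by rewrite /B /M; lia.
  rewrite big_split_ord /=; apply: ler_wpDl; first by apply: sumr_ge0 => i _; exact: powR_ge0.
  rewrite big_split_ord /=; apply: ler_wpDr; first by apply: sumr_ge0 => i _; exact: powR_ge0.
  apply: ler_sum => b _.
  rewrite (@window_eq _ _ _ _ K (K.+1 + (M + K.+1)) n) //.
  - by have := ltn_ord n; lia.
  - by have := ltn_ord n; have := ltn_ord b; lia.
have -> : M%:R * S = \sum_x \sum_(n < K) \sum_(b < M) `|diff2 e (heat_sol e g n.+1) (x - e *+ (K.+1 + b))| `^ p.
  rewrite exchange_big mulr_sumr /=; apply: eq_bigr => n _.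
  rewrite exchange_big /= -[M in M%:R]card_ord mulr_natl -sumr_const; apply: eq_bigr => b _.
  by rewrite -[LHS](sum_shift _ (- (e *+ (K.+1 + b)))).
apply: le_trans step _.
rewrite -mulr_sumr.
have -> : \sum_x \sum_(n < K) \sum_(b < B) `|g n (x - e *+ b)| `^ p = B%:R * T.
  rewrite exchange_big mulr_sumr /=; apply: eq_bigr => n _.
  rewrite exchange_big /= -[B in B%:R]card_ord mulr_natl -sumr_const; apply: eq_bigr => b _.
  exact: (sum_shift (fun x => `|g n x| `^ p)).
by rewrite /B natrD le_eqVlt; apply/orP; left; apply/eqP; ring.
Qed.

(** Young's inequality for [|a i|] and [m^(p-1)], with [m] the mean of the [|a i|], plays the part
    of the tangent line at [m]. *)
Lemma jensen_powR (I : finType) (w a : I -> R) (p : R) : 1 < p ->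
  (forall i, 0 <= w i) -> \sum_i w i = 1 ->
  `|\sum_i w i * a i| `^ p <= \sum_i w i * `|a i| `^ p.
Proof.
move=> p1 w0 w1; set m := \sum_i w i * `|a i|.
have p0 : 0 < p by lra.
have m0 : 0 <= m by apply: sumr_ge0 => i _; rewrite mulr_ge0.
apply: (@le_trans _ _ (m `^ p)).
  apply: (ge0_ler_powR (ltW p0)); rewrite ?nnegrE //.
  apply: le_trans (ler_norm_sum _ _ _) _; apply: ler_sum => i _.
  by rewrite normrM ger0_norm.
pose q := p / (p - 1).
have p10 : 0 < p - 1 by lra.
have q0 : 0 < q by rewrite divr_gt0.
have pq : p^-1 + q^-1 = 1 by rewrite /q; field; rewrite !gt_eqF //; lra.
have e : (p - 1) * q = p by rewrite /q; field; rewrite gt_eqF.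
have : m `^ p <= \sum_i w i * (`|a i| `^ p / p + m `^ p / q).
  rewrite -[leLHS](mulr_powRB1 m0 p0) {1}/m mulr_suml; apply: ler_sum => i _.
  rewrite -mulrA ler_wpM2l //.
  have := conjugate_powR (normr_ge0 (a i)) (powR_ge0 m (p - 1)) p0 q0 pq.
  by rewrite -powRrM e.
under eq_bigr do rewrite mulrDr.
rewrite big_split /= -mulr_suml w1 mul1r.
have -> : \sum_i w i * (`|a i| `^ p / p) = (\sum_i w i * `|a i| `^ p) / p.
  by rewrite mulr_suml; apply: eq_bigr => i _; rewrite mulrA.
have -> : q^-1 = 1 - p^-1 by rewrite -pq addrC addKr.
move=> h.
have : 0 <= (\sum_i w i * `|a i| `^ p - m `^ p) / p by move: h; lra.
by rewrite pmulr_lge0 ?invr_gt0 // subr_ge0.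
Qed.

Section RandomShifts.
Variables (G : finZmodType) (e : G).
Implicit Types (r : nat -> G -> R) (g : nat -> G -> R) (U : G -> R).

Definition wavg (w : G -> R) U x := \sum_z w z * U (x + z).
Definition is_prob (w : G -> R) := (forall z, 0 <= w z) /\ \sum_z w z = 1.
Definition dirac_at (z0 : G) : G -> R := fun z => (z == z0)%:R.

Fixpoint rheat_sol r g n : G -> R :=
  if n is m.+1 then fun x => avgQ e (wavg (r m) (rheat_sol r g m)) x + g m x else fun=> 0.

Lemma wavg_dirac z U x : wavg (dirac_at z) U x = U (x + z).
Proof.
rewrite /wavg (bigD1 z) //= /dirac_at eqxx mul1r big1 ?addr0 // => y /negbTE h.
by rewrite h mul0r.
Qed.

Lemma dirac_prob z : is_prob (dirac_at z).
Proof.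
split=> [y|]; first by rewrite ler0n.
by rewrite (bigD1 z) //= /dirac_at eqxx big1 ?addr0 // => y /negbTE ->.
Qed.

(** Deterministic shifts commute with the average in the direction [e]: in the frame that moves
    along their partial sums, the scheme is the plain heat scheme with translated data. *)
Lemma rheat_sol_dirac r g (zeta : nat -> G) : (forall n, r n = dirac_at (zeta n)) ->
  forall n x, rheat_sol r g n x =
    heat_sol e (fun j y => g j (y - \sum_(i < j.+1) zeta i)) n (x + \sum_(i < n) zeta i).
Proof.
move=> hr; elim=> [//|n IH] x /=.
congr (_ + _); last by rewrite addrK.
have h y : wavg (r n) (rheat_sol r g n) y =
  heat_sol e (fun j y0 => g j (y0 - \sum_(i < j.+1) zeta i)) n (y + \sum_(i < n.+1) zeta i).
  by rewrite hr wavg_dirac IH big_ord_recr /= (addrC (\sum_(i < n) _)) addrA.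
by rewrite /avgQ !h (addrAC x e) (addrAC x (- e)).
Qed.

Definition upd r m (w : G -> R) n := if n == m then w else r n.

Lemma rheat_sol_upd r g m w n : (n <= m)%N -> rheat_sol (upd r m w) g n = rheat_sol r g n.
Proof.
elim: n => [//|n IH] nm /=; rewrite IH ?(ltnW nm) //.
by rewrite /upd ltn_eqF.
Qed.

(** The solution is affine in each single [r m], though not in all of them jointly, so the measures
    are replaced by Dirac masses one time at a time. *)
Lemma rheat_sol_mix r g m n x : is_prob (r m) ->
  rheat_sol r g n x = \sum_z r m z * rheat_sol (upd r m (dirac_at z)) g n x.
Proof.
move=> [w0 w1]; elim: n x => [|n IH] x; first by rewrite big1 // => z _; rewrite mulr0.
have H y : wavg (r n) (rheat_sol r g n) y =
   \sum_z r m z * wavg (upd r m (dirac_at z) n) (rheat_sol (upd r m (dirac_at z)) g n) y.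
  case: (eqVneq n m) => [nm|nm].
    rewrite nm /wavg; apply: eq_bigr => z _.
    by rewrite rheat_sol_upd // /upd eqxx -/(wavg _ _ _) wavg_dirac.
  rewrite /wavg; under eq_bigr do rewrite IH mulr_sumr.
  rewrite exchange_big /=; apply: eq_bigr => z _; rewrite mulr_sumr.
  by apply: eq_bigr => y' _; rewrite /upd (negbTE nm) mulrCA.
rewrite /= (eq_bigr (fun z => r m z * avgQ e (wavg (upd r m (dirac_at z) n) (rheat_sol (upd r m (dirac_at z)) g n)) x
   + r m z * g n x)); last by move=> z _; rewrite mulrDr.
rewrite big_split /= -mulr_suml w1 mul1r; congr (_ + _).
rewrite (avgQ_ext _ _ H) avgQ_sum; apply: eq_bigr => z _.
by rewrite /avgQ; ring.
Qed.
End RandomShifts.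

Theorem rheat_sol_Lp (p : R) : 1 < p ->
  exists2 N, 0 <= N & forall (G : finZmodType) (e : G) (r g : nat -> G -> R) K,
  (forall n, is_prob (r n)) ->
  \sum_(n < K) \sum_x `|diff2 e (rheat_sol e r g n.+1) x| `^ p
  <= N * \sum_(n < K) \sum_x `|g n x| `^ p.
Proof.
move=> p1; have [N N0 H] := heat_sol_Lp p1; exists N => // G e r g K rP.
(* Induction on the number [m] of initial times at which the measure is still arbitrary. *)
have main m : forall r', (forall n, is_prob (r' n)) ->
    (forall n, (m <= n < K)%N -> exists z, r' n = dirac_at z) ->
    \sum_(n < K) \sum_x `|diff2 e (rheat_sol e r' g n.+1) x| `^ p
      <= N * \sum_(n < K) \sum_x `|g n x| `^ p.
  elim: m => [|m IH] {r rP} r rP rD; last first.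
    have mix n x : diff2 e (rheat_sol e r g n.+1) x =
      \sum_z r m z * diff2 e (rheat_sol e (upd r m (dirac_at z)) g n.+1) x.
      rewrite (diff2_ext _ _ (fun y => rheat_sol_mix e g n.+1 y (rP m))) diff2_sum.
      by apply: eq_bigr => z _; rewrite /diff2; ring.
    have [w0 w1] := rP m.
    apply: (@le_trans _ _ (\sum_(n < K) \sum_x \sum_z r m z *
       `|diff2 e (rheat_sol e (upd r m (dirac_at z)) g n.+1) x| `^ p)).
      apply: ler_sum => n _; apply: ler_sum => x _; rewrite mix.
      exact: jensen_powR.
    under eq_bigr do rewrite exchange_big /=.
    rewrite exchange_big /=.
    rewrite -[leRHS]mul1r -w1 mulr_suml; apply: ler_sum => z _.
    under eq_bigr do rewrite -mulr_sumr.
    rewrite -mulr_sumr ler_wpM2l //; apply: IH => n; rewrite /upd.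
      by case: ifP => _ //; exact: dirac_prob.
    case: eqP => [_ _|nm /andP[mn nK]]; first by exists z.
    by apply: rD; rewrite nK andbT ltn_neqAle eq_sym mn andbT; apply/eqP.
  (* The default [0] can be taken only from time [K] on, where the sums no longer see the
     measures. *)
  pose zeta n := if pick (fun z => `[< r n = dirac_at z >]) is Some z then z else 0.
  pose r' n := dirac_at (zeta n).
  have rr n : (n < K)%N -> r n = r' n.
    move=> nK; have [z rz] := rD n nK; rewrite /r' /zeta; case: pickP => [z' /asboolP //|/(_ z)].
    by rewrite rz asboolT.
  have same n : (n <= K)%N -> rheat_sol e r g n = rheat_sol e r' g n.
    by elim: n => [//|n IH] nK /=; rewrite IH ?(ltnW nK) // rr.
  have -> : \sum_(n < K) \sum_x `|diff2 e (rheat_sol e r g n.+1) x| `^ p =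
     \sum_(n < K) \sum_x `|diff2 e (heat_sol e (fun j y => g j (y - \sum_(i < j.+1) zeta i)) n.+1) x| `^ p.
    apply: eq_bigr => n _; rewrite same ?ltn_ord //.
    rewrite -[RHS](sum_shift _ (\sum_(i < n.+1) zeta i)); apply: eq_bigr => x _; congr (`|_| `^ p).
    by rewrite /diff2 !(@rheat_sol_dirac _ _ r' g zeta) // (addrAC x e) (addrAC x (- e)).
  apply: le_trans (H _ _ _ _) _; rewrite ler_wpM2l //; apply: ler_sum => n _.
  by rewrite (sum_shift (fun y => `|g n y| `^ p)).
by apply: (main K) => // n; rewrite ltnNge andbN.
Qed.
End DiscreteEstimate.

(** * Sums of rank one matrices *)

Section PsdDecomposition.
Variables (R : rcfType) (d : nat).
Implicit Types (a : 'I_d -> 'I_d -> R) (xi : 'I_d -> R).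

Definition qform a xi : R := \sum_i \sum_j a i j * xi i * xi j.

Definition psd a := (forall i j, a i j = a j i) /\ (forall xi, 0 <= qform a xi).

Lemma sum_deltaR (F : 'I_d -> R) m : \sum_i F i * (i == m)%:R = F m.
Proof.
rewrite (bigD1 m) //= eqxx mulr1 big1 ?addr0 // => i /negbTE ->.
by rewrite mulr0.
Qed.

Lemma qform_shift a xi m t : (forall i j, a i j = a j i) ->
  qform a (fun i => xi i + t * (i == m)%:R) =
  qform a xi + 2 * t * (\sum_i a i m * xi i) + t ^+ 2 * a m m.
Proof.
move=> sa; rewrite /qform.
have -> : \sum_i \sum_j a i j * (xi i + t * (i == m)%:R) * (xi j + t * (j == m)%:R) =
  \sum_i \sum_j a i j * xi i * xi j + \sum_i (t * a i m * xi i)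
   + \sum_i (t * (\sum_j a j m * xi j) * (i == m)%:R) + \sum_i (t ^+ 2 * a i m * (i == m)%:R).
  rewrite -!big_split /=; apply: eq_bigr => i _.
  have e1 : t * a i m * xi i = \sum_j t * a i j * xi i * (j == m)%:R.
    by rewrite (sum_deltaR (fun j => t * a i j * xi i)).
  have e3 : t ^+ 2 * a i m * (i == m)%:R = \sum_j t ^+ 2 * a i j * (i == m)%:R * (j == m)%:R.
    by rewrite (sum_deltaR (fun j => t ^+ 2 * a i j * (i == m)%:R)).
  have e2 : t * (\sum_j a j m * xi j) * (i == m)%:R = \sum_j t * a i j * xi j * (i == m)%:R.
    rewrite mulr_sumr mulr_suml; apply: eq_bigr => j _.
    case: eqP => [->|_]; last by rewrite !mulr0.
    by rewrite (sa j m) mulrA.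
  by rewrite e1 e2 e3 -!big_split /=; apply: eq_bigr => j _; ring.
rewrite !sum_deltaR; congr (_ + _); rewrite -addrA; congr (_ + _).
under eq_bigr do rewrite -mulrA; rewrite -mulr_sumr; ring.
Qed.

Lemma psd_zero_row a m : psd a -> a m m = 0 -> forall j, a j m = 0.
Proof.
move=> [sa pa] amm j; apply/eqP; apply: contraT => ne.
(* As [a m m = 0], the form at [e_j + t e_m] is affine in [t]; this [t] makes it [-1]. *)
pose t := - (a j j + 1) / (2 * a j m).
have := pa (fun i => (i == j)%:R + t * (i == m)%:R).
rewrite qform_shift // amm mulr0 addr0 sum_deltaR.
have -> : qform a (fun i => (i == j)%:R) = a j j.
  rewrite /qform; under eq_bigr do rewrite (sum_deltaR (fun j' => _)).
  by rewrite (sum_deltaR (fun i => a i j)).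
have -> : 2 * t * a j m = - (a j j + 1) by rewrite /t; field.
lra.
Qed.

(** Cholesky elimination from the last index downward: a positive pivot is removed by completing the
    square, and a zero pivot has a zero row. *)
Lemma psd_sum_squares a : psd a ->
  exists sig : 'I_d -> 'I_d -> R, forall i j, a i j = \sum_l sig l i * sig l j.
Proof.
have main m : forall a, psd a -> (forall i j : 'I_d, (m <= i)%N -> a i j = 0) ->
  exists sig : 'I_d -> 'I_d -> R, (forall l i : 'I_d, (m <= l)%N -> sig l i = 0) /\
    forall i j, a i j = \sum_l sig l i * sig l j.
  elim: m => [|m IH] {}a pa0 az.
    exists (fun _ _ => 0); split=> // i j; rewrite az // big1 // => l _; exact: mulr0.
  have [sa pa] := pa0.
  case: (leqP d m) => [dm|md].
    have [i j hi|sig [s0 sE]] := IH a pa0; last by exists sig; split=> // l i /ltnW; exact: s0.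
    by have := ltn_ord i; lia.
  pose m' := Ordinal md.
  case: (eqVneq (a m' m') 0) => [amm|amm].
    have [i j|sig [s0 sE]] := IH a pa0; last by exists sig; split=> // l i /ltnW; exact: s0.
    rewrite leq_eqVlt => /orP[/eqP mi|]; last exact: az.
    have -> : i = m' by apply: val_inj.
    by rewrite sa; exact: psd_zero_row.
  have amp : 0 < a m' m'.
    rewrite lt_neqAle eq_sym amm /=; have := pa (fun i => (i == m')%:R).
    rewrite /qform; under eq_bigr do rewrite (sum_deltaR (fun j' => _)).
    by rewrite (sum_deltaR (fun i => a i m')).
  pose v i := a i m' / Num.sqrt (a m' m').
  have vv i j : v i * v j = a i m' * a j m' / a m' m'.
    by rewrite /v mulf_div -expr2 sqr_sqrtr // ltW.
  pose b i j := a i j - v i * v j.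
  have bz (i j : 'I_d) : (m <= i)%N -> b i j = 0.
    rewrite leq_eqVlt => /orP[/eqP mi|mi]; last by rewrite /b vv !(az i) // !mul0r subrr.
    have -> : i = m' by apply: val_inj.
    by rewrite /b vv mulrAC mulfV // mul1r sa subrr.
  have pb : psd b.
    split=> [i j|xi]; first by rewrite /b sa mulrC.
    set w := \sum_i a i m' * xi i.
    have := pa (fun i => xi i + (- (w / a m' m')) * (i == m')%:R).
    rewrite qform_shift // -/w.
    have -> : qform b xi = qform a xi - w * w / a m' m'.
      have -> : w * w / a m' m' = \sum_i \sum_j v i * v j * xi i * xi j.
        rewrite {1}/w !mulr_suml; apply: eq_bigr => i _.
        rewrite /w mulr_sumr mulr_suml; apply: eq_bigr => j _.
        by rewrite vv; ring.
      rewrite /qform -sumrB; apply: eq_bigr => i _; rewrite -sumrB; apply: eq_bigr => j _.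
      by rewrite /b; ring.
    suff -> : qform a xi + 2 * - (w / a m' m') * w + (- (w / a m' m')) ^+ 2 * a m' m' =
      qform a xi - w * w / a m' m' by [].
    by field.
  have [sig [s0 sE]] := IH b pb bz.
  exists (fun l i => if l == m' then v i else sig l i); split=> [l i ml|i j].
    case: eqP => [e|_]; first by move: ml; rewrite e ltnn.
    by apply: s0; apply: ltnW.
  rewrite (bigD1 m') //= eqxx.
  have := sE i j; rewrite (bigD1 m') //= (s0 m' i) // mul0r add0r.
  under [X in _ = X -> _]eq_bigr => l /negbTE lm do rewrite -[sig l i]/(if false then v i else sig l i) -lm.
  rewrite /b => h.
  have -> : \sum_(l | l != m') (if l == m' then v i else sig l i) * (if l == m' then v j else sig l j)
    = a i j - v i * v j.
    by rewrite h; apply: eq_bigr => l /negbTE ->.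
  by rewrite addrC subrK.
move=> pa; have [i j|sig [_ sE]] := main d a pa; last by exists sig.
by rewrite leqNgt ltn_ord.
Qed.
End PsdDecomposition.

Local Open Scope classical_set_scope.
Local Open Scope ring_scope.

(** * Riemann sums *)

Section RealLine.
Variable R : realType.
Local Notation mu := (@lebesgue_measure R).

Lemma addl_preimage_itv (c : R) (b0 b1 : bool) (a b : R) :
  (fun x => c + x) @^-1` [set` Interval (BSide b0 a) (BSide b1 b)] =
  [set` Interval (BSide b0 (a - c)) (BSide b1 (b - c))].
Proof.
apply/seteqP; split=> x /=; rewrite !in_itv /= => /andP[h1 h2]; apply/andP; split.
- by rewrite lteifBlDl.
- by rewrite lteifBrDl.
- by rewrite -lteifBlDl.
- by rewrite -lteifBrDl.
Qed.

Lemma lebesgue_measure_shift (c : R) (A : set R) : measurable A ->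
  pushforward mu (fun x : R => c + x : measurableTypeR R) A = mu A.
Proof.
move=> mA.
have mc : measurable_fun setT (fun x : R => c + x : measurableTypeR R).
  by apply: measurable_funD.
pose mf := isMeasurableFun.Build _ _ _ _ _ mc.
pose phi : {mfun _ >-> _} := HB.pack (fun x : R => c + x : measurableTypeR R) mf.
apply/esym; apply: (@lebesgue_measure_unique R (pushforward mu phi)) => //= _ [[a b]] _ <-.
rewrite /pushforward addl_preimage_itv !lebesgue_measure_itv /=.
rewrite !lte_fin ltrD2r; case: ifP => // _.
by rewrite -!EFinD opprD opprK addrACA addNr addr0.
Qed.

Lemma ge0_integral_shift (F : R -> \bar R) (c tau : R) : measurable_fun setT F ->
  (forall x, 0 <= F x)%E ->
  (\int[mu]_(x in `[0%R, tau[) F (c + x)%R = \int[mu]_(x in `[c, (c + tau)%R[) F x)%E.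
Proof.
move=> mF F0.
pose phi : measurableTypeR R -> measurableTypeR R := fun x => c + x.
have mphi : measurable_fun setT phi by exact: measurable_funD.
have -> : `[0, tau[%classic = phi @^-1` `[c, c + tau[%classic.
  by rewrite addl_preimage_itv subrr addrAC subrr add0r.
rewrite -[LHS](@ge0_integral_pushforward _ _ (measurableTypeR R) (measurableTypeR R) R phi mphi mu _ F) //.
- by apply: eq_measure_integral => A mA _; exact: lebesgue_measure_shift.
- exact: measurable_funS mF.
Qed.

(** The substitute for Riemann sums when the integrand is only measurable: the integral is exactly
    the integral of the grid sum over the offset of the grid. *)
Lemma ge0_integral_cells (F : R -> \bar R) (a tau : R) K : 0 < tau -> measurable_fun setT F ->
  (forall x, 0 <= F x)%E ->
  (\int[mu]_(x in `[a, (a + K%:R * tau)%R[) F x =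
   \sum_(n < K) \int[mu]_(x in `[0%R, tau[) F (a + n%:R * tau + x)%R)%E.
Proof.
move=> tau0 mF F0; elim: K => [|K IH].
  by rewrite big_ord0 mul0r addr0 set_itvco0 integral_set0.
rewrite big_ord_recr /= -IH ge0_integral_shift //.
have -> : `[a, a + K.+1%:R * tau[%classic =
   `[a, a + K%:R * tau[ `|` `[a + K%:R * tau, a + K%:R * tau + tau[ :> set R.
  rewrite -itv_bndbnd_setU //=.
  - by rewrite -natr1 mulrDl mul1r addrA.
  - by rewrite bnd_simp lerDl mulr_ge0 // ltW.
  - by rewrite bnd_simp lerDl ltW.
rewrite ge0_integral_setU //=.
- exact: measurable_funS mF.
- apply/disj_setPS => x [] /=; rewrite !in_itv /= => /andP[_ h1] /andP[h2 _].
  by have := le_lt_trans h2 h1; rewrite ltxx.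
Qed.

Lemma integral_vanish (F : R -> \bar R) (D : set R) :
  (forall x, ~ D x -> F x = 0)%E -> (\int[mu]_x F x = \int[mu]_(x in D) F x)%E.
Proof.
move=> h; rewrite [RHS]integral_mkcond; apply: eq_integral => x _.
by rewrite patchE; case: ifPn => // /negP; rewrite inE => /h.
Qed.

Definition lip1 (L : R) (r : R -> R) := forall x y, `|r x - r y| <= L * `|x - y|.

Lemma lip1_continuous L r : 0 <= L -> lip1 L r -> continuous r.
Proof.
move=> L0 hr x; apply/cvgrPdist_le => e e0.
have L1 : 0 < L + 1 by rewrite ltr_wpDl.
have : \forall y \near x, ball x (e / (L + 1)) y by apply: nbhsx_ballx; rewrite divr_gt0.
apply: filterS => y; rewrite /ball /= ltr_pdivlMr // mulrC => /ltW h.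
apply: le_trans (hr _ _) _; apply: le_trans h.
by rewrite ler_wpM2r // lerDl.
Qed.

Lemma riemann_1d (r : R -> R) L A : 0 <= L -> 0 < A -> (forall x, 0 <= r x) -> lip1 L r ->
  (forall x, A <= `|x| -> r x = 0) ->
  exists2 s, 0 <= s & (\int[mu]_x (r x)%:E)%E = s%:E /\
   forall N h, N%:R * h = 2 * A -> 0 < h ->
     `|s - \sum_(i < N) h * r (- A + i%:R * h)| <= L * h * (2 * A).
Proof.
move=> L0 A0 r0 lr vr.
have mr : measurable_fun setT (EFin \o r).
  by apply/measurable_EFinP; have := continuous_measurable_fun (lip1_continuous L0 lr).
have rE0 x : (0 <= (EFin \o r) x)%E by rewrite lee_fin.
have cell c h : 0 < h -> exists2 s, 0 <= s & (\int[mu]_(x in `[0%R, h[) (r (c + x))%:E)%E = s%:E /\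
    `|s - h * r c| <= L * h * h.
  move=> h0.
  have mh : mu `[0, h[%classic = h%:E by rewrite lebesgue_measure_itv /= lte_fin h0 sube0.
  have mc : measurable_fun (`[0, h[%classic : set R) (fun x => (r (c + x))%:E).
    apply/measurable_EFinP; apply: measurable_funS (_ : measurable_fun setT _) => //.
    apply: (measurableT_comp (f := r)); first by apply/measurable_EFinP.
    exact: measurable_funD.
  have bd x : x \in `[0, h[%classic -> `|r (c + x) - r c| <= L * h.
    rewrite inE /= in_itv /= => /andP[x0 xh]; apply: le_trans (lr _ _) _.
    by rewrite addrC addKr ger0_norm // ler_wpM2l // ltW.
  have up : (\int[mu]_(x in `[0%R, h[) (r (c + x))%:E <= ((r c + L * h) * h)%:E)%E.
    rewrite EFinM -mh -integral_cst //; apply: ge0_le_integral => //.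
    - by move=> x _; rewrite lee_fin.
    - move=> x hx; rewrite lee_fin -lerBlDl; apply: le_trans (ler_norm _) _.
      by apply: bd; rewrite inE.
  have lo : ((r c * h)%:E <= \int[mu]_(x in `[0%R, h[) (r (c + x))%:E + (L * h * h)%:E)%E.
    rewrite [in X in (_ <= _ + X)%E]EFinM EFinM -mh -!integral_cst //.
    rewrite -ge0_integralD //; first last.
    - by move=> x _; rewrite lee_fin mulr_ge0 // ltW.
    - by move=> x _; rewrite lee_fin.
    apply: ge0_le_integral => //.
    - by move=> x _; rewrite lee_fin.
    - exact: emeasurable_funD.
    - move=> x hx; rewrite -EFinD lee_fin -lerBlDl; apply: le_trans (ler_norm _) _.
      by rewrite distrC; apply: bd; rewrite inE.
  have ge0 : (0 <= \int[mu]_(x in `[0%R, h[) (r (c + x))%:E)%E.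
    by apply: integral_ge0 => x _; rewrite lee_fin.
  move: up lo ge0; case: (integral _ _ _) => [s| |] //; rewrite -EFinD !lee_fin => up lo ge0.
  exists s => //; split=> //; rewrite ler_norml; apply/andP; split; lra.
have total N h : N%:R * h = 2 * A -> 0 < h ->
  exists2 s, 0 <= s & (\int[mu]_x (r x)%:E)%E = s%:E /\
     `|s - \sum_(i < N) h * r (- A + i%:R * h)| <= L * h * (2 * A).
  move=> Nh h0.
  rewrite (@integral_vanish _ `[- A, - A + N%:R * h[%classic); last first.
    move=> x /negP; rewrite in_itv /= negb_and -ltNge -leNgt Nh => hx.
    rewrite vr //; case/orP: hx => hx.
      by rewrite ltr0_norm; lra.
    by rewrite ger0_norm; lra.
  rewrite (ge0_integral_cells _ _ h0 mr rE0) /= -Nh.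
  elim: N {Nh} => [|N [s s0 [sE sB]]].
    by exists 0 => //; rewrite !big_ord0; split=> //; rewrite subrr normr0 !(mul0r, mulr0).
  have [t t0 [tE tB]] := cell (- A + N%:R * h) h h0.
  exists (s + t); first exact: addr_ge0.
  rewrite !big_ord_recr /= sE tE; split=> //.
  rewrite opprD addrACA; apply: le_trans (ler_normD _ _) _.
  by rewrite -natr1 mulrDl mulrDr mul1r lerD.
have h1 : 1%:R * (2 * A) = 2 * A by rewrite mul1r.
have A2 : 0 < 2 * A by rewrite mulr_gt0.
have [s s0 [sE _]] := total _ _ h1 A2.
exists s => //; split=> // N h Nh h0.
have [s' _ [+ sB]] := total N h Nh h0; rewrite sE => -[e].
by rewrite e.
Qed.
End RealLine.

Section RiemannSums.
Variable R : realType.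
Local Notation mu := (@lebesgue_measure R).

Lemma vcons0 n (x : R) (v : 'rV[R]_n) : vcons x v 0 ord0 = x.
Proof. by rewrite mxE unlift_none. Qed.

Lemma vconsS n (x : R) (v : 'rV[R]_n) j : vcons x v 0 (lift ord0 j) = v 0 j.
Proof. by rewrite mxE liftK. Qed.

Lemma vcons_ind n (P : 'I_n.+1 -> Prop) : P ord0 -> (forall j, P (lift ord0 j)) -> forall i, P i.
Proof. by move=> h0 hS i; case: (unliftP ord0 i) => [j ->|->]. Qed.

(** The Lipschitz condition for the maximum norm, phrased with a bound [del] so that coordinates are
    checked one by one. *)
Definition lipn n (L : R) (f : 'rV[R]_n -> R) := forall (v w : 'rV[R]_n) (del : R), 0 <= del ->
  (forall i, `|v 0 i - w 0 i| <= del) -> `|f v - f w| <= L * del.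

Definition vanishn n (A : R) (f : 'rV[R]_n -> R) := forall (v : 'rV[R]_n) i, A <= `|v 0 i| -> f v = 0.

Fixpoint rsum n (a h : R) (N : nat) : ('rV[R]_n -> R) -> R :=
  match n with
  | 0 => fun f => f 0
  | n'.+1 => fun f => \sum_(i < N) h * rsum a h N (fun v : 'rV[R]_n' => f (vcons (a + i%:R * h) v))
  end.

Lemma rsum_dist n a h N (f g : 'rV[R]_n -> R) del : 0 <= h -> (forall v, `|f v - g v| <= del) ->
  `|rsum a h N f - rsum a h N g| <= del * (N%:R * h) ^+ n.
Proof.
move=> h0; elim: n f g => [|n IH] f g fg /=; first by rewrite expr0 mulr1.
rewrite -sumrB; apply: le_trans (ler_norm_sum _ _ _) _.
apply: (@le_trans _ _ (\sum_(i < N) h * (del * (N%:R * h) ^+ n))).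
  by apply: ler_sum => i _; rewrite -mulrBr normrM ger0_norm // ler_wpM2l // IH.
by rewrite sumr_const card_ord -[leLHS]mulr_natr exprS le_eqVlt; apply/orP; left; apply/eqP; ring.
Qed.

Lemma mesh_exists (A e : R) : 0 < A -> 0 < e -> exists N h, N%:R * h = 2 * A /\ 0 < h <= e.
Proof.
move=> A0 e0; pose N := (Num.Def.truncn (2 * A / e)).+1.
have N0 : 0 < N%:R :> R by rewrite ltr0n.
exists N, (2 * A / N%:R); split; first by rewrite mulrC divfK ?gt_eqF.
rewrite divr_gt0 ?mulr_gt0 //= ler_pdivrMr // [leRHS]mulrC -ler_pdivrMr //.
by rewrite ltW // truncnS_gt.
Qed.

Lemma riemann_nd n (f : 'rV[R]_n -> R) L A : 0 <= L -> 0 < A -> (forall v, 0 <= f v) ->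
  lipn L f -> vanishn A f ->
  exists2 s, 0 <= s & iint (fun v => (f v)%:E) = s%:E /\
   forall N h, N%:R * h = 2 * A -> 0 < h ->
     `|s - rsum (- A) h N f| <= n%:R * L * h * (2 * A) ^+ n.
Proof.
move=> L0 A0; elim: n f => [|n IH] f f0 lf vf.
  by exists (f 0) => //; split=> // N h _ _ /=; rewrite subrr normr0 !mul0r.
have hx x : exists s, [/\ 0 <= s, iint (fun v : 'rV[R]_n => (f (vcons x v))%:E) = s%:E &
   forall N h, N%:R * h = 2 * A -> 0 < h ->
     `|s - rsum (- A) h N (fun v : 'rV[R]_n => f (vcons x v))| <= n%:R * L * h * (2 * A) ^+ n].
  have [||| s s0 [sE sB]] := IH (fun v => f (vcons x v)).
  - by move=> v; exact: f0.
  - move=> v w del d0 h; apply: lf => // i; elim/vcons_ind: i => [|j].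
      by rewrite !vcons0 subrr normr0.
    by rewrite !vconsS.
  - by move=> v i h; apply: (vf _ (lift ord0 i)); rewrite vconsS.
  by exists s.
have [r rP] := choice hx.
have r0 x : 0 <= r x by have [] := rP x.
have vr x : A <= `|x| -> r x = 0.
  move=> hA; have [_ e _] := rP x; apply: EFin_inj; rewrite -e.
  have -> : (fun v : 'rV[R]_n => (f (vcons x v))%:E) = (fun=> (0%:E)).
    by apply/funext => v; rewrite (vf _ ord0) // vcons0.
  elim: (n) => [//|m IHm] /=.
  by rewrite (eq_integral (cst 0%E)) ?integral0 // => y _; rewrite IHm.
have W0 : 0 <= (2 * A) ^+ n by rewrite exprn_ge0 // mulr_ge0 // ltW.
(* The partial integral inherits its Lipschitz bound from its Riemann sums, taken on a mesh so fine
   that the errors at [x] and [y] together stay below [e]. *)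
have lr : lip1 (L * (2 * A) ^+ n) r.
  move=> x y; apply/ler_addgt0Pr => e e0.
  pose C := n%:R * L * (2 * A) ^+ n.
  have C0 : 0 <= C by rewrite !mulr_ge0.
  have p : 0 < 2 * C + 1 by rewrite ltr_wpDl ?mulr_ge0.
  have [N [h [Nh /andP[h0 he]]]] := @mesh_exists A (e / (2 * C + 1)) A0 (divr_gt0 e0 p).
  have [_ _ /(_ N h Nh h0) bx] := rP x.
  have [_ _ /(_ N h Nh h0) by_] := rP y.
  have bxy' : `|rsum (- A) h N (fun v => f (vcons x v)) - rsum (- A) h N (fun v => f (vcons y v))| <= L * `|x - y| * (2 * A) ^+ n.
    rewrite -Nh; apply: (rsum_dist _ _ (ltW h0)) => v; apply: lf => // i.
    by elim/vcons_ind: i => [|k]; rewrite ?vcons0 // !vconsS subrr normr0.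
  have t : `|r x - r y| <= `|r x - rsum (- A) h N (fun v => f (vcons x v))| +
     `|rsum (- A) h N (fun v => f (vcons x v)) - rsum (- A) h N (fun v => f (vcons y v))| +
     `|r y - rsum (- A) h N (fun v => f (vcons y v))|.
    rewrite (distrC (r y)); apply: le_trans (ler_distD (rsum (- A) h N (fun v => f (vcons y v))) _ _) _.
    by rewrite lerD2r ler_distD.
  have Ch : 2 * C * h <= e.
    move: he; rewrite ler_pdivlMr // => he; apply: le_trans he.
    rewrite mulrDr mulr1 mulrC; lra.
  apply: le_trans t _; rewrite /C in Ch.
  have e1 : n%:R * L * h * (2 * A) ^+ n = n%:R * L * (2 * A) ^+ n * h by ring.
  rewrite e1 in bx by_.
  have -> : L * (2 * A) ^+ n * `|x - y| = L * `|x - y| * (2 * A) ^+ n by ring.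
  by move: bx by_ bxy' Ch; lra.
have [s s0 [sE sB]] := riemann_1d (mulr_ge0 L0 W0) A0 r0 lr vr.
exists s => //; split.
  rewrite /= -sE; apply: eq_integral => x _; by have [] := rP x.
move=> N h Nh h0 /=.
apply: le_trans (ler_distD (\sum_(i < N) h * r (- A + i%:R * h)) _ _) _.
have := sB N h Nh h0 => b1.
have b2 : `|\sum_(i < N) h * r (- A + i%:R * h) -
   \sum_(i < N) h * rsum (- A) h N (fun v => f (vcons (- A + i%:R * h) v))|
   <= n%:R * L * h * (2 * A) ^+ n * (2 * A).
  rewrite -sumrB; apply: le_trans (ler_norm_sum _ _ _) _.
  apply: (@le_trans _ _ (\sum_(i < N) h * (n%:R * L * h * (2 * A) ^+ n))).
    apply: ler_sum => i _; rewrite -mulrBr normrM gtr0_norm // ler_wpM2l ?(ltW h0) //.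
    by have [_ _ /(_ N h Nh h0)] := rP (- A + i%:R * h).
  rewrite sumr_const card_ord -[leLHS]mulr_natr.
  have -> : h * (n%:R * L * h * (2 * A) ^+ n) * N%:R = n%:R * L * h * (2 * A) ^+ n * (N%:R * h) by ring.
  by rewrite Nh.
apply: le_trans (lerD b1 b2) _.
by rewrite exprS -natr1 le_eqVlt; apply/orP; left; apply/eqP; ring.
Qed.
End RiemannSums.

(** * Taylor estimates *)

Section Smooth.
Variables (R : realType) (n : nat).
Implicit Types (f u : 'rV[R]_n -> R) (v w : 'rV[R]_n) (k : 'I_n) (s : seq 'I_n).

Local Notation e_ k := (coord_vec R k).

Lemma is_derive_line f v k (t : R) : derivable f (v + t *: e_ k) (e_ k) ->
  is_derive t 1 (fun r : R => f (v + r *: e_ k)) (derive f (v + t *: e_ k) (e_ k)).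
Proof.
have e : (fun h : R => h^-1 *: (((fun r : R => f (v + r *: e_ k)) \o shift t) (h *: 1) - f (v + t *: e_ k))) =
   (fun h : R => h^-1 *: ((f \o shift (v + t *: e_ k)) (h *: e_ k) - f (v + t *: e_ k))).
  apply/funext => h /=; congr (_ *: (f _ - _)).
  by rewrite [h *: 1]mulr1 scalerDl addrCA.
move=> df; split.
  by move: df; rewrite /derivable e.
by rewrite /derive e.
Qed.

Variable u : 'rV[R]_n -> R.
Hypothesis Hu : Cinf_c u.

Local Notation P s := (iter_partial s u).
Local Notation K := (closure [set x | u x != 0]).

Lemma Cinf_c_zero s v : ~ K v -> P s v = 0.
Proof.
have cK : open (~` K) by rewrite openC; exact: closed_closure.
elim: s v => [|k s IH] v Kv.
  apply: contrapT => uv; apply: Kv; apply: subset_closure => /=; exact/eqP.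
rewrite /= (@near_eq_derive _ _ _ _ (cst 0)) ?derive_cst //.
have : \forall x \near v, (~` K) x by apply: open_nbhs_nbhs; split.
by apply: filterS => x /IH ->.
Qed.

Lemma Cinf_c_bounded s : exists2 C, 0 <= C & forall v, `|P s v| <= C.
Proof.
have [[cont _] cK] := Hu.
have : compact ((iter_partial s u) @` K) by apply: continuous_compact => //; apply: continuous_subspaceT; exact: cont.
move/compact_bounded => [M [Mr HM]].
exists (`|M| + 1); first by rewrite addr_ge0.
move=> v; have [Kv|Kv] := pselect (K v).
  apply: HM; last by exists v.
  by apply: (le_lt_trans (ler_norm M)); rewrite ltrDl.
by rewrite Cinf_c_zero // normr0 addr_ge0.
Qed.

Lemma Cinf_c_bounded_fam (I : finType) (F : I -> seq 'I_n) :
  exists2 C, 0 <= C & forall i v, `|P (F i) v| <= C.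
Proof.
have [C CP] := choice (fun i => let: ex_intro2 C C0 H := Cinf_c_bounded (F i) in
   ex_intro (fun C => 0 <= C /\ forall v, `|P (F i) v| <= C) C (conj C0 H)).
exists (\sum_i C i); first by apply: sumr_ge0 => i _; have [] := CP i.
move=> i v; have [_ h] := CP i; apply: le_trans (h v) _.
by rewrite (bigD1 i) //= lerDl sumr_ge0 // => k _; have [] := CP k.
Qed.

Lemma Cinf_c_vanish : exists2 A, 0 < A & forall s, vanishn A (P s).
Proof.
have [_ cK] := Hu.
have H k : exists M : R, forall v, K v -> `|v 0 k| <= M.
  have : compact ((fun v : 'rV[R]_n => v 0 k) @` K).
    by apply: continuous_compact => //; apply: continuous_subspaceT; exact: coord_continuous.
  move/compact_bounded => [M [Mr HM]]; exists (`|M| + 1) => v Kv.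
  by apply: HM; [apply: (le_lt_trans (ler_norm M)); rewrite ltrDl | exists v].
have [M HM] := choice H.
exists (1 + \sum_k `|M k|); first by rewrite ltr_wpDr ?sumr_ge0.
move=> s v i h; apply: Cinf_c_zero => Kv; have := HM i v Kv.
move: h; rewrite (bigD1 i) //= => h1 h2.
have : 0 <= \sum_(j | j != i) `|M j| by apply: sumr_ge0.
have := ler_norm (M i); lra.
Qed.

Lemma partial_derivable s k v (t : R) : 
  is_derive t 1 (fun r : R => P s (v + r *: e_ k)) (P (k :: s) (v + t *: e_ k)).
Proof. by have [[_ d] _] := Hu; apply: is_derive_line; exact: d. Qed.

Lemma MVT_line (phi dphi : R -> R) (t : R) : (forall r : R, is_derive r 1 phi (dphi r)) ->
  exists2 c, `|c| <= `|t| & phi t - phi 0 = dphi c * t.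
Proof.
move=> H; have cphi : continuous phi.
  by move=> x; apply: differentiable_continuous; apply/derivable1_diffP; case: (H x).
have cw a b : {within `[a, b], continuous phi} by apply: continuous_subspaceT.
case: (lerP 0 t) => t0.
  have [c] := MVT_segment t0 (fun x _ => H x) (cw _ _).
  by rewrite in_itv /= subr0 => /andP[c0 ct] e; exists c => //; rewrite !ger0_norm.
have [c] := MVT_segment (ltW t0) (fun x _ => H x) (cw _ _).
rewrite in_itv /= sub0r => /andP[ct c0] e; exists c.
  by rewrite !ler0_norm ?lerN2 // ltW.
by rewrite -opprB e mulrN opprK.
Qed.

Lemma partial_MVT s k v (t : R) : exists2 c, `|c| <= `|t| &
  P s (v + t *: e_ k) - P s v = P (k :: s) (v + c *: e_ k) * t.
Proof.
have [c ct e] := MVT_line t (partial_derivable s k v).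
by exists c => //; rewrite -e scale0r addr0.
Qed.

(** The corners of a path from [v] to [w] along the coordinate axes, since [smooth] provides
    derivatives along the axes only. *)
Definition stair i v w : 'rV[R]_n := \row_j (if (j < i)%N then w 0 j else v 0 j).

Lemma stair0 v w : stair 0 v w = v.
Proof. by apply/rowP => j; rewrite mxE. Qed.

Lemma stairn v w : stair n v w = w.
Proof. by apply/rowP => j; rewrite mxE ltn_ord. Qed.

Lemma stairS v w (i : 'I_n) : stair i.+1 v w = stair i v w + (w 0 i - v 0 i) *: e_ i.
Proof.
apply/rowP => j; rewrite !mxE eqxx ltnS leq_eqVlt.
case: (eqVneq j i) => [->|ji] /=; first by rewrite eqxx ltnn mulr1 addrC subrK.
have -> : (nat_of_ord j == i) = false by apply/negbTE; move: ji.
by rewrite mulr0 addr0.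
Qed.

Lemma telescope_stair f v w : f w - f v = \sum_(i < n) (f (stair i.+1 v w) - f (stair i v w)).
Proof.
rewrite -{1}(stairn v w) -{1}(stair0 v w).
have H m : (m <= n)%N -> f (stair m v w) - f (stair 0 v w) = \sum_(i < m) (f (stair i.+1 v w) - f (stair i v w)).
  elim: m => [|m IH] mn; first by rewrite big_ord0 subrr.
  by rewrite big_ord_recr /= -IH ?(ltnW mn) // addrC addrA subrK.
by rewrite stair0 in H *; rewrite -H // stair0.
Qed.

Lemma partial_lip s : exists2 L, 0 <= L & lipn L (P s).
Proof.
have [C C0 CP] := Cinf_c_bounded_fam (fun k => k :: s).
exists (\sum_(k < n) C); first exact: sumr_ge0.
move=> w v del del0 h; rewrite (telescope_stair (P s)).
apply: le_trans (ler_norm_sum _ _ _) _; rewrite mulr_suml; apply: ler_sum => i _.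
rewrite stairS; have [c _ ->] := partial_MVT s i (stair i v w) (w 0 i - v 0 i).
by rewrite normrM ler_pM //; exact: (CP i).
Qed.

Lemma partial_lip_fam (I : finType) (F : I -> seq 'I_n) :
  exists2 L, 0 <= L & forall i, lipn L (P (F i)).
Proof.
have [L LP] := choice (fun i => let: ex_intro2 C C0 H := partial_lip (F i) in
   ex_intro (fun C => 0 <= C /\ lipn C (P (F i))) C (conj C0 H)).
exists (\sum_i L i); first by apply: sumr_ge0 => i _; have [] := LP i.
move=> i v w del del0 h; have [_ lf] := LP i; apply: le_trans (lf v w del del0 h) _.
by rewrite ler_wpM2r // (bigD1 i) //= lerDl sumr_ge0 // => k _; have [] := LP k.
Qed.

Lemma partial_taylor1 s : exists2 C, 0 <= C & forall v w (del : R), 0 <= del ->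
  (forall i, `|w 0 i - v 0 i| <= del) ->
  `|P s w - P s v - \sum_i (w 0 i - v 0 i) * P (i :: s) v| <= C * del ^+ 2.
Proof.
have [L L0 LP] := partial_lip_fam (fun k => k :: s).
exists (\sum_(k < n) L); first exact: sumr_ge0.
move=> v w del del0 h; rewrite (telescope_stair (P s)) -sumrB.
apply: le_trans (ler_norm_sum _ _ _) _; rewrite mulr_suml; apply: ler_sum => i _.
rewrite stairS; have [c cd ->] := partial_MVT s i (stair i v w) (w 0 i - v 0 i).
rewrite mulrC -mulrBr normrM mulrC expr2 mulrA ler_pM //.
apply: (LP i) => // j; rewrite !mxE eqxx.
case: (eqVneq j i) => [->|ji] /=.
  by rewrite ltnn mulr1 addrAC subrr add0r (le_trans cd) ?h.
by rewrite mulr0 addr0; case: ifP => // _; rewrite subrr normr0.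
Qed.

Lemma is_derive_quadratic (phi : R -> R) (t l C : R) : 0 <= C ->
  (forall h, `|phi (t + h) - phi t - h * l| <= C * h ^+ 2) -> is_derive t 1 phi l.
Proof.
move=> C0 H.
have cv : (fun h : R => h^-1 *: ((phi \o shift t) (h *: 1) - phi t)) @ (0 : R)^' --> l.
  apply/cvgrPdist_le => e e0.
  have C1 : 0 < C + 1 by rewrite ltr_wpDl.
  have : \forall h \near (0 : R)^', ball (0 : R) (e / (C + 1)) h.
    by apply: cvg_within; apply: nbhsx_ballx; rewrite divr_gt0.
  have : \forall h \near (0 : R)^', h != 0 by exact: nbhs_dnbhs_neq.
  apply: filterS2 => h h0; rewrite /ball /= sub0r normrN ltr_pdivlMr // => /ltW he.
  rewrite distrC /= [h *: 1]mulr1 (addrC h t).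
  have hp : 0 < `|h| by rewrite normr_gt0.
  rewrite -(ler_pM2l hp) -normrM mulrBr [h * (_ *: _)]mulrA mulfV // mul1r.
  apply: le_trans (H h) _.
  rewrite -[h ^+ 2]real_normK ?num_real // expr2 mulrCA ler_wpM2l //.
  by apply: le_trans he; rewrite mulrC ler_wpM2l // lerDl.
split; first by apply/cvg_ex; exists l.
exact: cvg_lim cv.
Qed.

Definition ray v z (t : R) : 'rV[R]_n := v + t *: z.

(** The derivative along an arbitrary direction comes from the first order expansion
    [partial_taylor1], whose remainder is quadratic. *)
Lemma partial_ray s v z (t : R) : is_derive t 1 (fun r : R => P s (ray v z r))
  (\sum_i z 0 i * P (i :: s) (ray v z t)).
Proof.
have [C C0 H] := partial_taylor1 s.
pose d := \sum_i `|z 0 i|.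
have d0 : 0 <= d by apply: sumr_ge0.
apply: (@is_derive_quadratic _ _ _ (C * d ^+ 2)); first by rewrite mulr_ge0 ?sqr_ge0.
move=> h.
have := H (ray v z t) (ray v z (t + h)) (`|h| * d); rewrite mulr_ge0 // => /(_ isT) H'.
have coord i : ray v z (t + h) 0 i - ray v z t 0 i = h * z 0 i.
  by rewrite !mxE; ring.
have {}H' := H' _; rewrite mulr_sumr.
under eq_bigr do rewrite mulrA -coord.
apply: le_trans (H' _) _; last by rewrite exprMn real_normK ?num_real //; lra.
move=> i; rewrite coord normrM ler_wpM2l // /d (bigD1 i) //= lerDl; exact: sumr_ge0.
Qed.

(** The mean value theorem is used twice along the ray, for [phi] minus its quadratic part and then
    for [phi1]. The remainder is cubic because the second derivatives are Lipschitz. *)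
Lemma partial_taylor2 s : exists2 C, 0 <= C & forall v (z : 'rV[R]_n) (del : R), 0 <= del ->
  (forall i, `|z 0 i| <= del) ->
  `|P s (v + z) - P s v - \sum_i z 0 i * P (i :: s) v
     - 2^-1 * \sum_i \sum_j z 0 i * z 0 j * P (j :: i :: s) v| <= C * del ^+ 3.
Proof.
have [L L0 LP] := partial_lip_fam (fun k : 'I_n * 'I_n => [:: k.2, k.1 & s]).
exists (\sum_(i < n) \sum_(j < n) L); first by do 2![apply: sumr_ge0 => ? _].
move=> v z del del0 hz.
pose phi t := P s (ray v z t).
pose phi1 t := \sum_i z 0 i * P (i :: s) (ray v z t).
pose phi2 t := \sum_i \sum_j z 0 i * z 0 j * P (j :: i :: s) (ray v z t).
have d1 (t : R) : is_derive t 1 phi (phi1 t) by exact: partial_ray.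
have d2 (t : R) : is_derive t 1 phi1 (phi2 t).
  have -> : phi1 = \sum_i (fun t => z 0 i * P (i :: s) (ray v z t)).
    by apply/funext => r; rewrite fct_sumE.
  apply: is_derive_eq.
    apply: is_derive_sum => i.
    by apply: is_deriveZ; exact: partial_ray.
  apply: eq_bigr => i _; rewrite /GRing.scale /= mulr_sumr.
  by apply: eq_bigr => j _; rewrite mulrA.
have bd t : `|t| <= 1 -> `|phi2 t - phi2 0| <= (\sum_(i < n) \sum_(j < n) L) * del ^+ 3.
  move=> t1; rewrite /phi2 -sumrB mulr_suml; apply: le_trans (ler_norm_sum _ _ _) _.
  apply: ler_sum => i _; rewrite -sumrB mulr_suml; apply: le_trans (ler_norm_sum _ _ _) _.
  apply: ler_sum => j _; rewrite -mulrBr !normrM.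
  have -> : L * del ^+ 3 = del * del * (L * del) by ring.
  rewrite ler_pM ?mulr_ge0 // ?ler_pM //.
  apply: (LP (i, j)) => // k; rewrite !mxE mul0r addr0 addrAC subrr add0r.
  rewrite normrM -[leRHS]mul1r ler_pM //.
pose q (r : R) : R := r * phi1 0 + 2^-1 * r ^+ 2 * phi2 0.
have d3 : forall r : R, is_derive r 1 q (phi1 0 + r * phi2 0).
  move=> t.
  apply: (@is_derive_quadratic _ _ _ `|phi2 0|) => // h.
  have -> : q (t + h) - q t - h * (phi1 0 + t * phi2 0) = phi2 0 * (2^-1 * h ^+ 2).
    by rewrite /q; field.
  have h2 := sqr_ge0 h.
  rewrite normrM ler_wpM2l // ger0_norm; first by lra.
  by apply: mulr_ge0.
pose psi : R -> R := phi - q.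
have dpsi : forall r : R, is_derive r 1 psi (phi1 r - (phi1 0 + r * phi2 0)).
  move=> r.
  by have := is_deriveB (d1 r) (d3 r).
have [c c1 e] := MVT_line 1 dpsi.
have [c' c1' e'] := MVT_line c d2.
have -> : P s (v + z) - P s v - \sum_i z 0 i * P (i :: s) v
     - 2^-1 * \sum_i \sum_j z 0 i * z 0 j * P (j :: i :: s) v = psi 1 - psi 0.
  have -> : psi 1 - psi 0 = phi 1 - phi 0 - phi1 0 - 2^-1 * phi2 0.
    rewrite /psi !fctE /q; move: (phi1 0) (phi2 0) (phi 1) (phi 0) => a b a' b'.
    by ring.
  by rewrite /phi /phi1 /phi2 /ray !scale0r !addr0 scale1r.
rewrite e mulr1 opprD addrA e'.
rewrite [_ * c]mulrC -mulrBr.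
rewrite normr1 in c1.
rewrite normrM -[leRHS]mul1r ler_pM // bd //.
exact: le_trans c1' c1.
Qed.

Lemma mixed_difference_le (D X Y c a b L M : R) :
  `|D - Y - X + c - a| <= L -> `|D - X - Y + c - b| <= M -> `|a - b| <= L + M.
Proof.
move=> h1 h2; have -> : a - b = (D - X - Y + c - b) - (D - Y - X + c - a) by ring.
by apply: le_trans (ler_normB _ _) _; rewrite addrC lerD.
Qed.

(** The mixed second difference with step [h] is [h^2] times either mixed derivative up to order
    [h^3]; a small [h] identifies the two. *)
Lemma schwarz s i j v : P (i :: j :: s) v = P (j :: i :: s) v.
Proof.
have [L1 L10 H1] := partial_lip (i :: j :: s).
have [L2 L20 H2] := partial_lip (j :: i :: s).
have key i' j' L (HL : lipn L (P (j' :: i' :: s))) (h : R) : 0 < h ->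
  `|P s (v + h *: e_ i' + h *: e_ j') - P s (v + h *: e_ i') - P s (v + h *: e_ j') + P s v
     - h ^+ 2 * P (j' :: i' :: s) v| <= L * (2 * h) * h ^+ 2.
  move=> h0.
  pose F r := P s (v + h *: e_ j' + r *: e_ i') - P s (v + r *: e_ i').
  have dF (r : R) : is_derive r 1 F (P (i' :: s) (v + h *: e_ j' + r *: e_ i') - P (i' :: s) (v + r *: e_ i')).
    by apply: is_deriveB; exact: partial_derivable.
  have [c ch e] := MVT_line h dF.
  have -> : P s (v + h *: e_ i' + h *: e_ j') - P s (v + h *: e_ i') - P s (v + h *: e_ j') + P s v = F h - F 0.
    by rewrite /F scale0r !addr0 (addrAC v); ring.
  rewrite e (addrAC v).
  have [c' ch' ->] := partial_MVT (i' :: s) j' (v + c *: e_ i') h.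
  have -> (a b : R) : a * h * h - h ^+ 2 * b = (a - b) * h ^+ 2 by ring.
  rewrite normrM [`|h ^+ 2|]ger0_norm ?sqr_ge0 // ler_wpM2r ?sqr_ge0 //.
  rewrite (gtr0_norm h0) in ch ch'.
  apply: HL; first by rewrite mulr_ge0 // ltW.
  move=> k; rewrite !mxE eqxx /=.
  have -> (a b : R) : v 0 k + a + b - v 0 k = a + b by ring.
  apply: le_trans (ler_normD _ _) _; rewrite mulr_natl mulr2n.
  by apply: lerD; case: eqP => _; rewrite ?mulr1 // mulr0 normr0 ltW.
apply/eqP; rewrite -subr_eq0 -normr_le0; apply/ler_addgt0Pr => e e0.
rewrite add0r.
pose C := 2 * (L1 + L2) + 1.
have C0 : 0 < C by rewrite ltr_wpDl // mulr_ge0 // addr_ge0.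
pose h := e / C; have h0 : 0 < h by rewrite divr_gt0.
have h2 : 0 < h ^+ 2 by rewrite exprn_gt0.
have k1 := key j i L1 H1 h h0; have k2 := key i j L2 H2 h h0.
rewrite -(ler_pM2r h2).
have -> : `|P (i :: j :: s) v - P (j :: i :: s) v| * h ^+ 2 = `|h ^+ 2 * P (i :: j :: s) v - h ^+ 2 * P (j :: i :: s) v|.
  by rewrite -mulrBr normrM mulrC ger0_norm // ltW.
rewrite (addrAC v) in k1.
apply: le_trans (mixed_difference_le k1 k2) _.
rewrite -mulrDl ler_wpM2r ?(ltW h2) //.
have -> : L1 * (2 * h) + L2 * (2 * h) = 2 * (L1 + L2) * h by ring.
apply: (@le_trans _ _ (C * h)); first by rewrite ler_wpM2r ?(ltW h0) // lerDl.
by rewrite /h mulrC divfK // gt_eqF.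
Qed.
End Smooth.

(** * Symmetric averages and their second order expansion *)

Section Consistency.
Variables (R : realType) (d : nat).
Implicit Types (x z : 'rV[R]_d) (w : 'rV[R]_d -> R) (l : seq 'rV[R]_d) (t : R).

Definition symavg z w x : R := 2^-1 * (w (x + z) + w (x - z)).
Definition symavgs l w := foldr symavg w l.

Lemma vconsD (a b : R) (x y : 'rV[R]_d) : vcons (a + b) (x + y) = vcons a x + vcons b y.
Proof.
by apply/rowP => i; rewrite [RHS]mxE; elim/vcons_ind: i => [|k]; rewrite ?vcons0 // !vconsS mxE.
Qed.

Lemma vconsN (a : R) (x : 'rV[R]_d) : vcons (- a) (- x) = - vcons a x.
Proof.
by apply/rowP => i; rewrite [RHS]mxE; elim/vcons_ind: i => [|k]; rewrite ?vcons0 // !vconsS mxE.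
Qed.

Lemma symavg_contr z w w' x B : (forall y, `|w y - w' y| <= B) ->
  `|symavg z w x - symavg z w' x| <= B.
Proof.
move=> h; have h1 := h (x + z); have h2 := h (x - z).
rewrite /symavg -mulrBr normrM ger0_norm ?invr_ge0 // opprD addrACA.
have := ler_normD (w (x + z) - w' (x + z)) (w (x - z) - w' (x - z)); lra.
Qed.

Lemma symavg_dist z w x B B' : `|w (x + z) - w x| <= B -> `|w (x - z) - w x| <= B' ->
  `|symavg z w x - w x| <= 2^-1 * B + 2^-1 * B'.
Proof.
rewrite /symavg; move: (w (x + z)) (w (x - z)) (w x) => a b c h1 h2.
have -> : 2^-1 * (a + b) - c = 2^-1 * ((a - c) + (b - c)) by field.
rewrite normrM ger0_norm ?invr_ge0 //.
have := ler_normD (a - c) (b - c); lra.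
Qed.

Lemma half_half_le (X : R) : 0 <= X -> 2^-1 * (2^-1 * X) + 2^-1 * (2^-1 * X) <= X.
Proof. lra. Qed.

Lemma triangle3_le (A Sw Sq a b h K1 K2 K3 : R) : `|A - (Sw + Sq)| <= K1 ->
  `|Sw - a - h| <= K2 -> `|Sq - b| <= K3 -> `|A - a - (h + b)| <= K2 + K3 + K1.
Proof.
move=> h1 h2 h3; have -> : A - a - (h + b) = (A - (Sw + Sq)) + (Sw - a - h) + (Sq - b) by ring.
have := ler_normD (A - (Sw + Sq) + (Sw - a - h)) (Sq - b).
have := ler_normD (A - (Sw + Sq)) (Sw - a - h); lra.
Qed.

Variable u : 'rV[R]_d.+1 -> R.
Hypothesis Hu : Cinf_c u.

Definition hess t x z : R := \sum_i \sum_j z 0 i * z 0 j * dxx i j u (vcons t x).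

(** The gradient terms for [z] and [- z] cancel. *)
Lemma symavg_taylor : exists2 C, 0 <= C & forall t x z (del : R), 0 <= del ->
  (forall i, `|z 0 i| <= del) ->
  `|symavg z (fun y => u (vcons t y)) x - u (vcons t x) - 2^-1 * hess t x z| <= C * del ^+ 3.
Proof.
have [C C0 H] := partial_taylor2 Hu [::]; exists C => // t x z del del0 hz.
have hz' i : `|(vcons 0 z : 'rV[R]_d.+1) 0 i| <= del.
  by elim/vcons_ind: i => [|k]; rewrite ?vcons0 ?normr0 // vconsS.
have hzN i : `|(- vcons 0 z : 'rV[R]_d.+1) 0 i| <= del by rewrite mxE normrN.
have h1 := H (vcons t x) (vcons 0 z) del del0 hz'.
have h2 := H (vcons t x) (- vcons 0 z) del del0 hzN.
have hE : hess t x z = \sum_i \sum_j (vcons 0 z : 'rV[R]_d.+1) 0 i * (vcons 0 z : 'rV[R]_d.+1) 0 j *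
   iter_partial [:: j; i] u (vcons t x).
  rewrite [RHS]big_ord_recl [X in _ = X + _]big1; last by move=> j _; rewrite vcons0 !mul0r.
  rewrite add0r.
  rewrite /hess exchange_big; apply: eq_bigr => i _.
  rewrite [RHS]big_ord_recl vcons0 mulr0 mul0r add0r; apply: eq_bigr => j _.
  by rewrite !vconsS /dxx [X in X * _ = _]mulrC.
have negE i : (- vcons 0 z : 'rV[R]_d.+1) 0 i = - (vcons 0 z : 'rV[R]_d.+1) 0 i by rewrite mxE.
have e2 : \sum_i \sum_j (- vcons 0 z : 'rV[R]_d.+1) 0 i * (- vcons 0 z : 'rV[R]_d.+1) 0 j *
   iter_partial [:: j; i] u (vcons t x) = hess t x z.
  rewrite hE; apply: eq_bigr => i _; apply: eq_bigr => j _.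
  by rewrite !negE mulrNN.
have e1 : \sum_i (- vcons 0 z : 'rV[R]_d.+1) 0 i * iter_partial [:: i] u (vcons t x)
  = - \sum_i (vcons 0 z : 'rV[R]_d.+1) 0 i * iter_partial [:: i] u (vcons t x).
  by rewrite -sumrN; apply: eq_bigr => i _; rewrite negE mulNr.
rewrite -hE in h1; rewrite e1 e2 in h2.
have v1 : vcons t (x + z) = vcons t x + vcons 0 z by rewrite -vconsD addr0.
have v2 : vcons t (x - z) = vcons t x - vcons 0 z by rewrite -vconsN -vconsD oppr0 addr0.
rewrite /symavg v1 v2.
move: h1 h2; set a := u (_ + _); set b := u (_ - _); set g := \sum_i _; set hh := hess _ _ _.
set c := u _ => h1 h2.
have -> : 2^-1 * (a + b) - c - 2^-1 * hh = 2^-1 * ((a - c - g - 2^-1 * hh) + (b - c - - g - 2^-1 * hh)).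
  by field.
rewrite normrM ger0_norm ?invr_ge0 //.
have := ler_normD (a - c - g - 2^-1 * hh) (b - c - - g - 2^-1 * hh); lra.
Qed.

Lemma hess_bounds : exists2 C, 0 <= C & forall t x z (del : R), 0 <= del ->
  (forall i, `|z 0 i| <= del) -> forall y : 'rV[R]_d, (forall i, `|y 0 i - x 0 i| <= del) ->
  `|hess t y z - hess t x z| <= C * del ^+ 3.
Proof.
have [L L0 LP] := partial_lip_fam Hu (fun k : 'I_d * 'I_d => [:: lift ord0 k.1; lift ord0 k.2]).
exists (\sum_(i < d) \sum_(j < d) L); first by do 2![apply: sumr_ge0 => ? _].
move=> t x z del del0 hz y hy.
rewrite /hess -sumrB mulr_suml; apply: le_trans (ler_norm_sum _ _ _) _.
apply: ler_sum => i _; rewrite -sumrB mulr_suml; apply: le_trans (ler_norm_sum _ _ _) _.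
apply: ler_sum => j _; rewrite -mulrBr !normrM.
have -> : L * del ^+ 3 = del * del * (L * del) by ring.
rewrite ler_pM ?mulr_ge0 // ?ler_pM //.
apply: (LP (i, j)) => // k.
by elim/vcons_ind: k => [|k]; rewrite ?vcons0 ?subrr ?normr0 // !vconsS.
Qed.

(** To second order the contributions of composed averages add up: a further average moves the
    earlier Hessian terms only by [O(del^3)], as these are already quadratic in the shifts. *)
Lemma symavgs_taylor L : exists2 C, 0 <= C & forall t x l (del : R), size l = L -> 0 <= del ->
  (forall z i, z \in l -> `|z 0 i| <= del) ->
  `|symavgs l (fun y => u (vcons t y)) x - u (vcons t x) - 2^-1 * \sum_(z <- l) hess t x z| <= C * del ^+ 3.
Proof.
have [C1 C10 H1] := symavg_taylor; have [C2 C20 H2] := hess_bounds.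
elim: L => [|L [C C0 IH]].
  exists 0 => // t x l del /size0nil -> _ _ /=.
  by rewrite big_nil mulr0 subr0 subrr normr0 mul0r.
exists (C1 + C2 * L%:R + C); first by rewrite !addr_ge0 ?mulr_ge0.
move=> t x [|z l] del //= [sl] del0 hl.
have hz i : `|z 0 i| <= del by apply: hl; rewrite mem_head.
have hl' z' i : z' \in l -> `|z' 0 i| <= del by move=> h; apply: hl; rewrite inE h orbT.
pose w y := u (vcons t y).
pose q y := 2^-1 * \sum_(z' <- l) hess t y z'.
have c1 := @symavg_contr z (symavgs l w) (fun y => w y + q y) x (C * del ^+ 3) _.
have {}c1 : `|symavg z (symavgs l w) x - symavg z (fun y => w y + q y) x| <= C * del ^+ 3.
  by apply: c1 => y; rewrite opprD addrA; exact: IH.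
have c2 := H1 t x z del del0 hz.
have c3 : `|symavg z q x - q x| <= C2 * L%:R * del ^+ 3.
  have qd (y : 'rV[R]_d) : (forall i, `|y 0 i - x 0 i| <= del) -> `|q y - q x| <= 2^-1 * (C2 * L%:R * del ^+ 3).
    move=> hy; rewrite /q -mulrBr normrM ger0_norm ?invr_ge0 // ler_wpM2l ?invr_ge0 //.
    rewrite -sumrB; apply: le_trans (ler_norm_sum _ _ _) _.
    apply: (@le_trans _ _ (\sum_(z' <- l) C2 * del ^+ 3)).
      by rewrite !big_seq; apply: ler_sum => z' z'l; apply: H2 => // i; exact: hl'.
    by rewrite big_const_seq count_predT sl iter_addr_0 -[leLHS]mulr_natr mulrAC.
  have {}q1 : `|q (x + z) - q x| <= 2^-1 * (C2 * L%:R * del ^+ 3).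
    by apply: qd => i; rewrite mxE addrAC subrr add0r.
  have {}q2 : `|q (x - z) - q x| <= 2^-1 * (C2 * L%:R * del ^+ 3).
    by apply: qd => i; rewrite !mxE addrAC subrr add0r normrN.
  apply: le_trans (symavg_dist q1 q2) _.
  have : 0 <= C2 * L%:R * del ^+ 3 by rewrite !mulr_ge0 ?exprn_ge0.
  exact: half_half_le.
rewrite big_cons mulrDr.
have e : symavg z (fun y => w y + q y) x = symavg z w x + symavg z q x.
  by rewrite /symavg -mulrDr addrACA.
rewrite e in c1; rewrite !mulrDl.
have := triangle3_le c1 c2 c3; rewrite -/w; exact.
Qed.

Lemma symavg_vanish z w B rho : 0 <= rho -> (forall i, `|z 0 i| <= rho) -> vanishn B w ->
  vanishn (B + rho) (symavg z w).
Proof.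
move=> rho0 hz vw x i hx; have hzi := hz i.
rewrite /symavg (vw _ i) ?(vw (x - z) i) ?addr0 ?mulr0 //; rewrite !mxE.
  by have := ler_normB (x 0 i) (z 0 i); have := lerB_normD (x 0 i) (- z 0 i); rewrite normrN; lra.
by have := lerB_normD (x 0 i) (z 0 i); lra.
Qed.

Lemma symavgs_vanish l w B rho : 0 <= rho -> (forall z i, z \in l -> `|z 0 i| <= rho) -> vanishn B w ->
  vanishn (B + (size l)%:R * rho) (symavgs l w).
Proof.
move=> rho0; elim: l => [|z l IH] hl vw; first by rewrite mul0r addr0.
rewrite /= -natr1 mulrDl mul1r addrA; apply: symavg_vanish => //.
  by move=> i; apply: hl; rewrite mem_head.
by apply: IH => // z' i h; apply: hl; rewrite inE h orbT.
Qed.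
End Consistency.

(** * Consistency of the lattice scheme *)

Section Lattice.
Variables (R : realType) (W eps : R) (N : nat).
Hypothesis eps_gt0 : 0 < eps.
Hypothesis W_mesh : N.+2%:R * eps = 2 * W.

(** A periodic grid: ['I_N.+2] is a cyclic group, and its elements sample [[- W, W)] in each
    coordinate. *)
Definition lat_pt d (y : 'rV['I_N.+2]_d) : 'rV[R]_d := \row_i (- W + (nat_of_ord (y 0 i))%:R * eps).
Definition lat_shift d (s : 'I_d -> int) : 'rV['I_N.+2]_d := \row_i (s i)%:~R.
Definition real_shift d (s : 'I_d -> int) : 'rV[R]_d := \row_i ((s i)%:~R * eps).

Lemma ord_addz_val (a : 'I_N.+2) (k : int) :
  exists q : int, (nat_of_ord (a + k%:~R))%:Z = a%:Z + k + q * (N.+2)%:Z.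
Proof.
have pos (b : 'I_N.+2) (m : nat) : exists q : nat, (nat_of_ord (b + m%:R)%R + q * N.+2 = b + m)%N.
  exists ((b + m) %/ N.+2)%N; rewrite addnC [RHS](divn_eq _ N.+2); congr (_ + _)%N.
  by rewrite Zp_nat /= modnDmr.
case: k => m.
  have [q e] := pos a m; exists (- q%:Z); rewrite -pmulrn mulNr; apply/eqP.
  by rewrite -subr_eq opprK; apply/eqP; rewrite -PoszM -!PoszD e.
have [q e] := pos (a + (Negz m)%:~R) m.+1.
exists q%:Z; move: e; rewrite NegzE mulrNz -pmulrn subrK => e; apply/eqP.
by rewrite addrAC eq_sym subr_eq -PoszM -!PoszD e.
Qed.

Lemma lat_shiftN d (s : 'I_d -> int) : - lat_shift s = lat_shift (fun i => - s i).
Proof. by apply/rowP => i; rewrite !mxE mulrNz. Qed.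

Lemma real_shiftN d (s : 'I_d -> int) : - real_shift s = real_shift (fun i => - s i).
Proof. by apply/rowP => i; rewrite !mxE mulrNz mulNr. Qed.

(** Wrapping around the torus happens only near its edge: both the wrapped and the unwrapped
    coordinate are then at least [B] in absolute value, where the sampled functions vanish. The
    margin [rho] between [B] and [W] ensures this. *)
Lemma wrap_real (B rho b z : R) (q : int) : B + rho <= W -> - W <= b -> b < W ->
  - W <= b + z + q%:~R * (2 * W) -> b + z + q%:~R * (2 * W) < W -> `|z| <= rho -> q != 0 ->
  B <= `|b + z + q%:~R * (2 * W)| /\ B <= `|b + z|.
Proof.
move=> hB b1 b2 c1 c2; rewrite ler_norml => /andP[z1 z2] q0.
have W0 : 0 < W by lra.
have [q1|q1] : (1 <= q) \/ (q <= -1) by move/eqP: q0; lia.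
  have : 1 <= q%:~R :> R by rewrite ler1z.
  move=> q1R; have : 2 * W <= q%:~R * (2 * W) by rewrite ler_peMl; lra.
  move: (q%:~R * (2 * W)) c1 c2 => x c1 c2 hx; split.
    by apply: le_trans (ler_norm _); lra.
  by rewrite -normrN; apply: le_trans (ler_norm _); lra.
have : q%:~R <= -1 :> R by rewrite -(intrN _ 1%N) ler_int.
move=> q1R; have : q%:~R * (2 * W) <= - (2 * W) by rewrite -[leRHS]mulN1r ler_wpM2r //; lra.
move: (q%:~R * (2 * W)) c1 c2 => x c1 c2 hx; split.
  by rewrite -normrN; apply: le_trans (ler_norm _); lra.
by apply: le_trans (ler_norm _); lra.
Qed.

Lemma lat_pt_range d (y : 'rV['I_N.+2]_d) i : - W <= lat_pt y 0 i < W.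
Proof.
rewrite mxE; have h1 : 0 <= (nat_of_ord (y 0 i))%:R * eps by rewrite mulr_ge0 // ltW.
have h2 : (nat_of_ord (y 0 i))%:R * eps < 2 * W by rewrite -W_mesh ltr_pM2r // ltr_nat.
by move: (_ * eps) h1 h2 => a h1 h2; apply/andP; split; lra.
Qed.

Lemma lat_shift_sample d (f : 'rV[R]_d -> R) B rho (s : 'I_d -> int) y :
  vanishn B f -> B + rho <= W -> (forall i, `|real_shift s 0 i| <= rho) ->
  f (lat_pt (y + lat_shift s)) = f (lat_pt y + real_shift s).
Proof.
move=> vf hB hs.
have coord i : exists q : int, lat_pt (y + lat_shift s) 0 i = lat_pt y 0 i + real_shift s 0 i + q%:~R * (2 * W).
  have [q e] := ord_addz_val (y 0 i) (s i); exists q.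
  rewrite !mxE -W_mesh; have := congr1 (fun k : int => k%:~R : R) e.
  rewrite /= !rmorphD rmorphM /= -!pmulrn => ->; ring.
case: (pselect (exists i, lat_pt (y + lat_shift s) 0 i != lat_pt y 0 i + real_shift s 0 i)) => [[i ne]|all].
  have [q e] := coord i.
  have q0 : q != 0 by apply: contra ne => /eqP q0; rewrite e q0 mul0r addr0.
  have /andP[b1 b2] := lat_pt_range y i.
  have /andP[c1 c2] := lat_pt_range (y + lat_shift s) i.
  rewrite e in c1 c2.
  have [B1 B2] := wrap_real hB b1 b2 c1 c2 (hs i) q0.
  rewrite (vf _ i) ?e //; rewrite (vf _ i) //.
  by move: B2; rewrite [(_ + real_shift s) 0 i]mxE.
congr f; apply/rowP => i; rewrite [RHS]mxE; apply/eqP; apply: contrapT => ne.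
by apply: all; exists i; apply/negP.
Qed.

Definition symavgG d (s : 'I_d -> int) (U : 'rV['I_N.+2]_d -> R) y : R :=
  2^-1 * (U (y + lat_shift s) + U (y - lat_shift s)).
Definition symavgsG d (l : seq ('I_d -> int)) (U : 'rV['I_N.+2]_d -> R) := foldr (@symavgG d) U l.

Lemma symavgsG_sample d (f : 'rV[R]_d -> R) B rho (l : seq ('I_d -> int)) y :
  0 <= rho -> vanishn B f -> B + (size l)%:R * rho <= W ->
  (forall z i, z \in map (@real_shift d) l -> `|z 0 i| <= rho) ->
  symavgsG l (fun y => f (lat_pt y)) y = symavgs (map (@real_shift d) l) f (lat_pt y).
Proof.
move=> rho0 vf; elim: l y => [//|s l IH] y hB hl.
have hl' z i : z \in map (@real_shift d) l -> `|z 0 i| <= rho.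
  by move=> h; apply: hl; rewrite inE h orbT.
have hs i : `|real_shift s 0 i| <= rho by apply: hl; rewrite mem_head.
have hB' : B + (size l)%:R * rho + rho <= W.
  by apply: le_trans hB; rewrite /= -natr1 mulrDl mul1r addrA.
have vl := @symavgs_vanish R d (map (@real_shift d) l) f B rho rho0 hl' vf.
rewrite size_map in vl.
have IH' z : symavgsG l (fun y => f (lat_pt y)) z = symavgs (map (@real_shift d) l) f (lat_pt z).
  by apply: IH => //; apply: le_trans hB'; rewrite lerDl.
rewrite /= /symavgG /symavg !IH'; congr (_ * (_ + _)).
  exact: lat_shift_sample vl hB' hs.
rewrite lat_shiftN real_shiftN; apply: lat_shift_sample vl hB' _ => i.
by rewrite -real_shiftN mxE normrN.
Qed.

(** The measure is the law of the sum of the shifts with independent random signs. *)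
Lemma symavgsG_prob d (l : seq ('I_d -> int)) :
  exists2 r : 'rV['I_N.+2]_d -> R, is_prob r & forall U y, wavg r U y = symavgsG l U y.
Proof.
elim: l => [|s l [r [r0 r1] rE]].
  exists (dirac_at R 0); first exact: dirac_prob.
  by move=> U y; rewrite wavg_dirac addr0.
exists (fun z => 2^-1 * (r (z - lat_shift s) + r (z + lat_shift s))).
  split=> [z|]; first by rewrite mulr_ge0 ?invr_ge0 ?addr_ge0.
  rewrite -mulr_sumr big_split /= (sum_shift r (- lat_shift s)) (sum_shift r) r1.
  by field.
move=> U y; rewrite /= /symavgG -!rE /wavg.
rewrite -(sum_shift (fun z => r z * U (y + lat_shift s + z)) (- lat_shift s)).
rewrite -(sum_shift (fun z => r z * U (y - lat_shift s + z)) (lat_shift s)).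
rewrite -big_split mulr_sumr /=; apply: eq_bigr => z _.
have -> : y + lat_shift s + (z - lat_shift s) = y + z by rewrite addrACA subrr addr0.
have -> : y - lat_shift s + (z + lat_shift s) = y + z by rewrite addrACA addNr addr0.
by rewrite -mulrA mulrDl.
Qed.

(** The lazy average is the square of a symmetric average with half the step, so the direction of
    the scheme is taken to be twice a lattice vector. *)
Lemma avgQ_symavgG d (s : 'I_d -> int) (U : 'rV['I_N.+2]_d -> R) y :
  avgQ (lat_shift s + lat_shift s) U y = symavgsG [:: s; s] U y.
Proof.
by rewrite /= /symavgG /avgQ !opprD !addrA addrK subrK; field.
Qed.

Lemma avgQ_diff2 (G : finZmodType) (e : G) (U : G -> R) y : diff2 e U y = 4 * (avgQ e U y - U y).
Proof. by rewrite /diff2 /avgQ; field. Qed.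

Lemma rsum_lattice d (f : 'rV[R]_d -> R) :
  rsum (- W) eps N.+2 f = eps ^+ d * \sum_(y : 'rV['I_N.+2]_d) f (lat_pt y).
Proof.
elim: d f => [|d IH] f /=.
  rewrite expr0 mul1r (big_pred1 0) => [|y]; last by apply/esym/eqP/rowP => -[].
  by congr f; apply/rowP => -[].
under eq_bigr do rewrite IH mulrA -exprS.
rewrite -mulr_sumr; congr (_ * _); rewrite pair_big /=.
pose cat (p : 'I_N.+2 * 'rV['I_N.+2]_d) : 'rV['I_N.+2]_d.+1 :=
  \row_i (if unlift ord0 i is Some j then p.2 0 j else p.1).
pose spl (y : 'rV['I_N.+2]_d.+1) := (y 0 ord0, \row_j y 0 (lift ord0 j)) : 'I_N.+2 * 'rV['I_N.+2]_d.
have catK : cancel cat spl.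
  move=> [a v]; rewrite /spl /cat !mxE unlift_none; congr (_, _).
  by apply/rowP => j; rewrite !mxE liftK.
have splK : cancel spl cat.
  move=> y; apply/rowP => i; rewrite !mxE; case: (unliftP ord0 i) => [j ->|->] //=.
  by rewrite mxE.
rewrite [RHS](reindex cat) /=; last by exists spl => ? _; [exact: catK | exact: splK].
apply: eq_bigr => -[a v] _ /=; congr f.
apply/rowP => i; rewrite [RHS]mxE; elim/vcons_ind: i => [|j].
  by rewrite vcons0 mxE unlift_none.
by rewrite vconsS !mxE liftK.
Qed.
End Lattice.

Section PowerBounds.
Variable R : realType.

(** Convexity of the power, read off Young's inequality instead of a derivative. *)
Lemma powR_tangent (a b p : R) : 1 < p -> 0 <= a -> 0 <= b ->
  b `^ p - a `^ p <= p * b `^ (p - 1) * (b - a).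
Proof.
move=> p1 a0 b0; have p0 : 0 < p by lra.
have p10 : 0 < p - 1 by lra.
pose q := p / (p - 1).
have q0 : 0 < q by rewrite divr_gt0.
have pq : p^-1 + q^-1 = 1 by rewrite /q; field; rewrite !gt_eqF //; lra.
have e : (p - 1) * q = p by rewrite /q; field; rewrite gt_eqF.
have := conjugate_powR a0 (powR_ge0 b (p - 1)) p0 q0 pq.
rewrite -powRrM e; have qE : q^-1 = 1 - p^-1 by rewrite -pq addrC addKr.
rewrite qE => h.
have bE := mulr_powRB1 b0 p0; move: h bE; move: (a `^ p) (b `^ p) (b `^ (p - 1)) => X Y Z h bE.
have {}h : p * (a * Z) <= p * (X / p + Y * (1 - p^-1)) by rewrite ler_pM2l.
have e1 : p * (X / p + Y * (1 - p^-1)) = X + (p - 1) * Y by field; rewrite gt_eqF.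
rewrite e1 in h; have e2 : p * Z * (b - a) = p * Y - p * (a * Z) by rewrite -bE; ring.
rewrite e2; lra.
Qed.

Lemma powR_lipschitz (a b M p : R) : 1 < p -> `|a| <= M -> `|b| <= M ->
  `| `|a| `^ p - `|b| `^ p | <= p * M `^ (p - 1) * `|a - b|.
Proof.
move=> p1; wlog ab : a b / `|a| <= `|b|.
  move=> H ha hb; case: (lerP `|a| `|b|) => [h|/ltW h]; first exact: H.
  by rewrite distrC (distrC a); apply: H.
move=> ha hb; have M0 : 0 <= M by apply: le_trans hb.
rewrite distrC ger0_norm; last first.
  by rewrite subr_ge0; apply: ge0_ler_powR; rewrite ?nnegrE //; lra.
apply: le_trans (powR_tangent p1 (normr_ge0 a) (normr_ge0 b)) _.
apply: ler_pM.
- by rewrite mulr_ge0 ?powR_ge0; lra.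
- by rewrite subr_ge0.
- rewrite ler_wpM2l //; first by lra.
  by apply: ge0_ler_powR; rewrite ?nnegrE //; lra.
- by rewrite distrC lerB_dist.
Qed.

Lemma prod_diff_le (z w z' w' e B : R) : `|z - w| <= e -> `|z' - w'| <= e -> `|z'| <= B -> `|w| <= B ->
  `|z * z' - w * w'| <= 2 * e * B.
Proof.
move=> h1 h2 h3 h4; have -> : z * z' - w * w' = (z - w) * z' + w * (z' - w') by ring.
apply: le_trans (ler_normD _ _) _; rewrite !normrM.
have : `|z - w| * `|z'| <= e * B by rewrite ler_pM.
have : `|w| * `|z' - w'| <= B * e by rewrite ler_pM.
lra.
Qed.

Lemma norm_shift_le (X Y Z E I : R) : `|X - Y| <= E -> `|Y| <= Z -> E <= I -> `|X| <= Z + I.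
Proof. by move=> h1 h2 h3; have := ler_normD (X - Y) Y; rewrite subrK; lra. Qed.

Lemma floor_mesh (w eps : R) : 0 < eps -> `|(Num.floor (w / eps))%:~R * eps - w| <= eps.
Proof.
move=> e0; have /andP[h1 h2] := floor_itv (w / eps).
rewrite ler_pdivlMr // in h1; rewrite intrD ltr_pdivrMr // mulrDl mul1r in h2.
rewrite ler_norml; apply/andP; split; move: h1 h2; move: (_ * eps) => X; lra.
Qed.
End PowerBounds.

Section Step.
Variables (R : realType) (d : nat) (c : 'I_d -> 'I_d -> R -> R) (T Mc : R).
Hypothesis Mc0 : 0 <= Mc.
Hypothesis c_bnd : forall i j t, - T <= t <= T -> `|c i j t| <= Mc.
Variable ez : 'I_d -> int.
Hypothesis ez_bnd : forall a, `|(ez a)%:~R : R| <= 2.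
Hypothesis c_psd : forall t, psd (fun a b => c a b t - 4^-1 * (ez a)%:~R * (ez b)%:~R).
Variable u : 'rV[R]_d.+1 -> R.
Hypothesis Hu : Cinf_c u.

(** The walk moves by order [1 / n] in time [1 / n^2]; the lattice is finer than the walk by a
    factor of order [n]. The [2] in [eps_] makes the half-step [ez / (2 n)] a lattice vector for
    every [n]. *)
Definition tau_ (n : nat) : R := (n%:R ^+ 2)^-1.
Definition eps_ (n : nat) : R := (2 * n%:R ^+ 2)^-1.
Definition half_step (n : nat) : 'I_d -> int := fun a => ez a * n%:Z.

Definition dir : 'rV[R]_d := \row_a (ez a)%:~R.

Lemma half_step_real n a : (0 < n)%N ->
  real_shift (eps_ n) (half_step n) 0 a = (2 * n%:R)^-1 * (ez a)%:~R.
Proof.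
move=> n0; rewrite mxE /half_step /eps_ rmorphM /= -pmulrn; field.
by rewrite pnatr_eq0 -lt0n.
Qed.

Lemma hess_half_step n t x : (0 < n)%N ->
  4 * hess u t x (real_shift (eps_ n) (half_step n)) = tau_ n * hess u t x dir.
Proof.
move=> n0; rewrite /hess !mulr_sumr; apply: eq_bigr => a _; rewrite !mulr_sumr.
apply: eq_bigr => b _; rewrite !half_step_real // /dir !mxE /tau_.
move: (dxx _ _ _ _) => D; field.
by rewrite pnatr_eq0 -lt0n.
Qed.

(** The averages produce half the sum of the matrices [z z^T]. The two half-steps give [tau_ n]
    times [e e^T / 4]; the shifts [eta * sig l], with [eta^2 = 2 * tau_ n], give [tau_ n] times the
    rest of [c]. The only error is the rounding of these shifts to the lattice. *)
Lemma step_consistent : exists S C, [/\ 0 <= S, 0 <= C &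
  forall n t, (0 < n)%N -> - T <= t <= T -> exists l : seq ('I_d -> int),
  [/\ size l = d,
      forall z a, z \in map (@real_shift R (eps_ n) d) [:: half_step n, half_step n & l] -> `|z 0 a| <= S / n%:R &
      forall x, `|2^-1 * \sum_(z <- map (@real_shift R (eps_ n) d) [:: half_step n, half_step n & l]) hess u t x z
          - tau_ n * Lop c u (vcons t x)| <= C / n%:R ^+ 3]].
Proof.
(* Bounds [n] times the shifts: [eta * n <= 2], the entries of [sig] are at most [1 + Mc], and
   rounding adds at most [1]. *)
pose S := 2 * (1 + Mc) + 1.
have S0 : 0 <= S by rewrite /S; move: Mc0; lra.
have [D D0 HD] := Cinf_c_bounded_fam Hu (fun k : 'I_d * 'I_d => [:: lift ord0 k.1; lift ord0 k.2]).
exists S, (\sum_(a < d) \sum_(b < d) d%:R * S * D); split => //.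
  by do 2![apply: sumr_ge0 => ? _]; rewrite !mulr_ge0.
move=> n t n0 tT.
have nR : 0 < n%:R :> R by rewrite ltr0n.
have n1 : 1 <= n%:R :> R by rewrite ler1n.
have eps0 : 0 < eps_ n by rewrite invr_gt0 mulr_gt0 ?exprn_gt0.
have epsn : eps_ n <= (n%:R)^-1.
  rewrite /eps_ lef_pV2 ?posrE ?mulr_gt0 ?exprn_gt0 // expr2.
  by move: n1; move: (n%:R : R) => m m1; nra.
have [sig sE] := psd_sum_squares (c_psd t).
have sb l a : `|sig l a| <= 1 + Mc.
  have h1 : sig l a ^+ 2 <= Mc.
    have : \sum_l' sig l' a * sig l' a <= Mc.
      rewrite -sE; have := c_bnd a a tT; move/(le_trans (ler_norm _)).
      have : 0 <= (ez a)%:~R * (ez a)%:~R :> R by rewrite -expr2 sqr_ge0.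
      move: ((ez a)%:~R) (c a a t) => X Y; lra.
    move=> h; apply: le_trans h; rewrite (bigD1 l) //= -expr2 lerDl.
    by apply: sumr_ge0 => l' _; rewrite -expr2 sqr_ge0.
  have : `|sig l a| ^+ 2 <= Mc by rewrite real_normK ?num_real.
  have := normr_ge0 (sig l a); move: `|_| Mc0 => X; nra.
pose eta := Num.sqrt 2 / n%:R : R.
have eta2 : eta ^+ 2 = 2 * tau_ n by rewrite /eta expr_div_n sqr_sqrtr.
have eta0 : 0 <= eta by rewrite divr_ge0 ?sqrtr_ge0.
have etan : eta <= 2 / n%:R.
  rewrite /eta ler_wpM2r ?invr_ge0 //.
  by rewrite -[leRHS]ger0_norm // -sqrtr_sqr ler_wsqrtr // expr2; lra.
pose fl l a : int := Num.floor (eta * sig l a / eps_ n).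
exists [seq fl l | l <- enum 'I_d]; split.
- by rewrite size_map size_enum_ord.
- move=> z a; rewrite !inE => /or3P[/eqP->|/eqP->|].
  1,2: rewrite half_step_real // normrM ger0_norm ?invr_ge0 ?mulr_ge0 // invfM mulrAC ler_wpM2r ?invr_ge0 //;
      have := ez_bnd a; move: `|_| => X hX; rewrite /S; move: Mc0; lra.
  move=> /mapP[s' /mapP[l _ ->] ->]; rewrite mxE.
  have h1 := floor_mesh (eta * sig l a) eps0.
  have h2 : `|eta * sig l a| <= 2 / n%:R * (1 + Mc).
    by rewrite normrM ger0_norm // ler_pM.
  have -> : S / n%:R = 2 / n%:R * (1 + Mc) + (n%:R)^-1 by rewrite /S; ring.
  exact: (norm_shift_le h1 h2 epsn).
move=> x.
pose M a b : R := \sum_(z <- map (@real_shift R (eps_ n) d) [:: half_step n, half_step n & [seq fl l | l <- enum 'I_d]]) z 0 a * z 0 b.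
have hE : \sum_(z <- map (@real_shift R (eps_ n) d) [:: half_step n, half_step n & [seq fl l | l <- enum 'I_d]]) hess u t x z
  = \sum_a \sum_b M a b * dxx a b u (vcons t x).
  rewrite /hess exchange_big /=; apply: eq_bigr => a _.
  rewrite exchange_big /=; apply: eq_bigr => b _.
  by rewrite /M mulr_suml.
(* Rounding moves each factor by at most [eps_ n], and the factors are at most [S / n], so each
   product moves by at most [2 * eps_ n * S / n = S / n^3]. *)
have ME a b : `|M a b - 2 * tau_ n * c a b t| <= 2 * (d%:R * S / n%:R ^+ 3).
  have -> : M a b - 2 * tau_ n * c a b t =
    \sum_l ((fl l a)%:~R * eps_ n * ((fl l b)%:~R * eps_ n) - eta * sig l a * (eta * sig l b)).
    have -> : c a b t = 4^-1 * (ez a)%:~R * (ez b)%:~R + \sum_l sig l a * sig l b.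
      by rewrite -sE addrC subrK.
    rewrite /M !big_cons !half_step_real // big_map big_map big_enum /= sumrB.
    have -> : \sum_(l < d) eta * sig l a * (eta * sig l b) = 2 * tau_ n * \sum_l sig l a * sig l b.
      rewrite -eta2 mulr_sumr; apply: eq_bigr => l _; ring.
    under eq_bigr do rewrite !mxE.
    set X := (\sum_l sig l a * sig l b); set Y := (\sum_(l < d) (fl l a)%:~R * eps_ n * _).
    by move: X Y => X Y; rewrite /tau_; field; rewrite gt_eqF.
  apply: le_trans (ler_norm_sum _ _ _) _.
  apply: (@le_trans _ _ (\sum_(l < d) 2 * (S / n%:R ^+ 3))).
    apply: ler_sum => l _.
    have h1 := floor_mesh (eta * sig l a) eps0.
    have h1' := floor_mesh (eta * sig l b) eps0.
    have h2 a' : `|eta * sig l a'| <= 2 / n%:R * (1 + Mc).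
      by rewrite normrM ger0_norm // ler_pM.
    have hS : S / n%:R = 2 / n%:R * (1 + Mc) + (n%:R)^-1 by rewrite /S; ring.
    have h3 : `|eta * sig l a| <= S / n%:R.
      by rewrite hS; apply: le_trans (h2 a) _; rewrite lerDl invr_ge0.
    have h4 : `|(fl l b)%:~R * eps_ n| <= S / n%:R.
      by rewrite hS; exact: (norm_shift_le h1' (h2 b) epsn).
    apply: le_trans (prod_diff_le h1 h1' h4 h3) _.
    rewrite /eps_ le_eqVlt; apply/orP; right.
    have -> : 2 * (2 * n%:R ^+ 2)^-1 * (S / n%:R) = S / n%:R ^+ 3 by field; rewrite gt_eqF.
    have : 0 < S / n%:R ^+ 3 by rewrite divr_gt0 ?exprn_gt0 // /S; move: Mc0; lra.
    by move: (S / _) => X; lra.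
  rewrite sumr_const card_ord -[leLHS]mulr_natl le_eqVlt; apply/orP; left; apply/eqP; ring.
rewrite hE /Lop vcons0 !mulr_sumr -sumrB mulr_suml; apply: le_trans (ler_norm_sum _ _ _) _.
apply: ler_sum => a _; rewrite !mulr_sumr -sumrB mulr_suml; apply: le_trans (ler_norm_sum _ _ _) _.
apply: ler_sum => b _; have := ME a b; have : `|dxx a b u (vcons t x)| <= D by exact: (HD (a, b)).
move: (dxx _ _ _ _) (M a b) (tau_ n) (c a b t) => X Y Z V hX hM.
have -> : 2^-1 * (Y * X) - Z * (V * X) = 2^-1 * (Y - 2 * Z * V) * X by field.
have -> : d%:R * S * D / n%:R ^+ 3 = 2^-1 * (2 * (d%:R * S / n%:R ^+ 3)) * D by field; rewrite gt_eqF.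
rewrite normrM ler_pM // normrM ger0_norm ?invr_ge0 // ler_wpM2l ?invr_ge0 //.
Qed.
End Step.

Section ScalarEstimates.
Variable R : realType.

Lemma dist3_le (X a b c d e : R) K1 K2 K3 : `|a - b + e| <= K1 -> `|X - b - c| <= K2 ->
  `|c - d| <= K3 -> `|a - X + (e + d)| <= K1 + K2 + K3.
Proof.
move=> h1 h2 h3; have -> : a - X + (e + d) = (a - b + e) - (X - b - c) - (c - d) by ring.
have := ler_normB (a - b + e - (X - b - c)) (c - d).
have := ler_normB (a - b + e) (X - b - c); lra.
Qed.

Lemma scaled_power_le (x y tau C M p L m : R) : 1 < p -> 0 < tau -> 0 <= L ->
  `|x - tau * y| <= C * (tau * m) -> `|y| <= M -> C * m <= L -> 0 <= m ->
  `| `|x / tau| `^ p - `|y| `^ p | <= p * (M + L) `^ (p - 1) * (C * m).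
Proof.
move=> p1 t0 L0 h hy hC m0.
have M0 : 0 <= M by apply: le_trans hy.
have d : `|x / tau - y| <= C * m.
  have -> : x / tau - y = (x - tau * y) / tau by field; rewrite gt_eqF.
  rewrite normrM normfV (gtr0_norm t0) ler_pdivrMr //; apply: le_trans h _.
  by rewrite le_eqVlt; apply/orP; left; apply/eqP; ring.
have xb : `|x / tau| <= M + L.
  have := ler_normD (x / tau - y) y; rewrite subrK; move: d hy hC; lra.
apply: le_trans (powR_lipschitz p1 xb (_ : `|y| <= M + L)) _.
  by apply: le_trans hy _; rewrite lerDl.
by rewrite ler_wpM2l // mulr_ge0 ?powR_ge0 //; lra.
Qed.
Lemma diff2_consistent (V U Z H H' tau m K C4 Q : R) :
  `|V - U - 2^-1 * (Z + Z)| <= K * (tau * m) -> `|H' - H| <= C4 * tau -> 4 * Z = tau * H' ->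
  0 < tau -> tau <= m -> 0 <= C4 -> 0 <= Q ->
  `|4 * (V - U) - tau * H| <= (Q + 4 * K + C4) * (tau * m).
Proof.
move=> h1 h2 hZ t0 tm C0 Q0.
have -> : 4 * (V - U) - tau * H = 4 * (V - U - 2^-1 * (Z + Z)) + tau * (H' - H).
  have e : 4 * (V - U - 2^-1 * (Z + Z)) = 4 * (V - U) - 4 * Z by field.
  by rewrite e hZ; ring.
have h3 : `|tau * (H' - H)| <= tau * (C4 * m).
  by rewrite normrM (gtr0_norm t0) ler_pM2l //; apply: le_trans h2 _; rewrite ler_wpM2l.
have h4 : 0 <= Q * (tau * m) by rewrite !mulr_ge0 //; lra.
apply: le_trans (ler_normD _ _) _; rewrite normrM ger0_norm //.
have -> : (Q + 4 * K + C4) * (tau * m) = 4 * (K * (tau * m)) + tau * (C4 * m) + Q * (tau * m) by ring.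
have h5 : 4 * `|V - U - 2^-1 * (Z + Z)| <= 4 * (K * (tau * m)) by rewrite ler_pM2l.
by apply: le_trans (lerD h5 h3) _; rewrite lerDl.
Qed.
Lemma consts_le (C3 t2 m K C1 Q C4 : R) : 0 <= C3 -> t2 <= m -> 0 <= m -> 0 <= Q -> 0 <= C4 ->
  C3 * t2 + K * m + C1 * m <= (C3 + K + C1 + 4 * Q + C4) * m.
Proof.
move=> C30 h m0 Q0 C40.
have h1 : C3 * t2 <= C3 * m by rewrite ler_wpM2l.
have h2 : 0 <= (4 * Q + C4) * m by rewrite mulr_ge0 // addr_ge0 // mulr_ge0.
have -> : (C3 + K + C1 + 4 * Q + C4) * m = C3 * m + K * m + C1 * m + (4 * Q + C4) * m by ring.
by apply: ler_wpDr h2 _; rewrite !lerD2r.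
Qed.
End ScalarEstimates.

Section Discrete.
Variables (R : realType) (d : nat) (c : 'I_d -> 'I_d -> R -> R) (T Mc : R).
Hypothesis Mc0 : 0 <= Mc.
Hypothesis c_bnd : forall i j t, - T <= t <= T -> `|c i j t| <= Mc.
Variable ez : 'I_d -> int.
Hypothesis ez_bnd : forall a, `|(ez a)%:~R : R| <= 2.
Hypothesis c_psd : forall t, psd (fun a b => c a b t - 4^-1 * (ez a)%:~R * (ez b)%:~R).
Variable u : 'rV[R]_d.+1 -> R.
Hypothesis Hu : Cinf_c u.
Variable A : R.
Hypothesis HA : forall s, vanishn A (iter_partial s u).

Local Notation D := (dir R ez).
Definition parF t x : R := dt u (vcons t x) + Lop c u (vcons t x).

Lemma parF_bounded : exists2 B, 0 <= B & forall t x, - T <= t <= T -> `|parF t x| <= B /\ `|hess u t x D| <= B.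
Proof.
have [Cd Cd0 DP] := Cinf_c_bounded_fam Hu (fun k : 'I_d * 'I_d => [:: lift ord0 k.1; lift ord0 k.2]).
have [Ct Ct0 Ht] := Cinf_c_bounded Hu [:: ord0].
exists (Ct + \sum_(a < d) \sum_(b < d) (Mc + 4) * Cd).
  rewrite addr_ge0 //; do 2![apply: sumr_ge0 => ? _].
  by rewrite mulr_ge0 ?addr_ge0.
move=> t x tT; split.
  rewrite /parF; apply: le_trans (ler_normD _ _) _; apply: lerD; first exact: Ht.
  rewrite /Lop vcons0; apply: le_trans (ler_norm_sum _ _ _) _; apply: ler_sum => a _.
  apply: le_trans (ler_norm_sum _ _ _) _; apply: ler_sum => b _.
  rewrite normrM ler_pM //; last by exact: (DP (a, b)).
  by apply: le_trans (c_bnd a b tT) _; rewrite lerDl.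
rewrite -[leLHS]add0r; apply: lerD => //.
rewrite /hess; apply: le_trans (ler_norm_sum _ _ _) _; apply: ler_sum => a _.
apply: le_trans (ler_norm_sum _ _ _) _; apply: ler_sum => b _.
rewrite normrM ler_pM //; last by exact: (DP (a, b)).
rewrite /dir !mxE normrM; apply: (@le_trans _ _ 4); last by rewrite lerDr.
have -> : 4 = 2 * 2 :> R by lra.
by rewrite ler_pM.
Qed.

Lemma hess_time : exists2 C, 0 <= C & forall t x (del : R), 0 <= del ->
  `|hess u (t - del) x D - hess u t x D| <= C * del.
Proof.
have [L L0 LP] := partial_lip_fam Hu (fun k : 'I_d * 'I_d => [:: lift ord0 k.1; lift ord0 k.2]).
exists (\sum_(i < d) \sum_(j < d) 4 * L); first by do 2![apply: sumr_ge0 => ? _]; rewrite mulr_ge0.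
move=> t x del del0.
rewrite /hess -sumrB mulr_suml; apply: le_trans (ler_norm_sum _ _ _) _.
apply: ler_sum => i _; rewrite -sumrB mulr_suml; apply: le_trans (ler_norm_sum _ _ _) _.
apply: ler_sum => j _; rewrite -mulrBr normrM -mulrA ler_pM //.
  rewrite /dir !mxE normrM; have -> : 4 = 2 * 2 :> R by lra.
  by rewrite ler_pM.
apply: (LP (i, j)) => // k.
elim/vcons_ind: k => [|k]; last by rewrite !vconsS subrr normr0.
by rewrite !vcons0 addrAC subrr add0r normrN ger0_norm.
Qed.

Lemma u_time : exists2 C, 0 <= C & forall t x (del : R), 0 <= del ->
  `|u (vcons (t - del) x) - u (vcons t x) + del * dt u (vcons t x)| <= C * del ^+ 2.
Proof.
have [C C0 H] := partial_taylor1 Hu [::]; exists C => // t x del del0.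
have hv i : `|(vcons (t - del) x : 'rV[R]_d.+1) 0 i - (vcons t x : 'rV[R]_d.+1) 0 i| <= del.
  elim/vcons_ind: i => [|k]; last by rewrite !vconsS subrr normr0.
  by rewrite !vcons0 addrAC subrr add0r normrN ger0_norm.
have := H (vcons t x) (vcons (t - del) x) del del0 hv.
rewrite big_ord_recl !vcons0 [X in _ - (_ + X)]big1; last first.
  by move=> j _; rewrite !vconsS subrr mul0r.
have e : t - del - t = - del by rewrite addrAC subrr add0r.
by rewrite addr0 e mulNr opprK.
Qed.

Section Mesh.
Variables (W : R) (n N : nat).
Hypothesis n_gt0 : (0 < n)%N.
Hypothesis mesh : N.+2%:R * eps_ R n = 2 * W.

Local Notation G := ('rV['I_N.+2]_d).
Local Notation pt := (@lat_pt R W (eps_ R n) N d).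
Definition samp (t : R) (y : G) : R := u (vcons t (pt y)).
Definition lat_e : G := lat_shift N (half_step ez n) + lat_shift N (half_step ez n).

Lemma eps_gt0 : 0 < eps_ R n.
Proof. by rewrite invr_gt0 mulr_gt0 ?exprn_gt0 ?ltr0n. Qed.

Lemma symavgsG_samp S (l : seq ('I_d -> int)) t y L : size l = L -> 0 <= S ->
  (forall z a, z \in map (@real_shift R (eps_ R n) d) l -> `|z 0 a| <= S / n%:R) ->
  A + L%:R * S <= W ->
  symavgsG l (samp t) y = symavgs (map (@real_shift R (eps_ R n) d) l) (fun x => u (vcons t x)) (pt y).
Proof.
move=> sl S0 hl hW.
have Sn : S / n%:R <= S by rewrite ler_pdivrMr ?ltr0n // ler_peMr // ler1n.
apply: (symavgsG_sample eps_gt0 mesh (f := fun x => u (vcons t x)) (B := A) (rho := S / n%:R)) => //.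
- by rewrite divr_ge0.
- by move=> v i h; apply: (HA [::] (i := lift ord0 i)); rewrite vconsS.
- by rewrite sl; apply: le_trans hW; rewrite lerD2l ler_wpM2l.
Qed.
End Mesh.

(** The step from [t] to [t - tau_ n] involves [c] only at the time [t], through the measure [r], so
    no regularity of [c] in time enters. The margin counts the [d + 2] symmetric averages of a step,
    each of reach at most [S / n <= S]. *)
Lemma lattice_consistent : exists S C, [/\ 0 <= S, 0 <= C & forall W n N, (0 < n)%N ->
  N.+2%:R * eps_ R n = 2 * W -> A + d.+2%:R * S <= W ->
  forall t, - T <= t <= T ->
   exists2 r : 'rV['I_N.+2]_d -> R, is_prob r & forall y, let x := lat_pt W (eps_ R n) y in
   `|samp W n (t - tau_ R n) y - avgQ (lat_e n N) (wavg r (samp W n t)) y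
      + (tau_ R n * dt u (vcons t x) + tau_ R n * Lop c u (vcons t x))| <= C * (tau_ R n * (n%:R)^-1) /\
   `|diff2 (lat_e n N) (samp W n (t - tau_ R n)) y - tau_ R n * hess u t x D| <= C * (tau_ R n * (n%:R)^-1)].
Proof.
have [S [C1 [S0 C10 step]]] := step_consistent Mc0 c_bnd ez_bnd c_psd Hu.
have [C2 C20 T1] := symavgs_taylor Hu d.+2.
have [C2' C20' T2] := symavgs_taylor Hu 2.
have [C3 C30 T3] := u_time.
have [C4 C40 T4] := hess_time.
exists S, (C3 + C2 * S ^+ 3 + C1 + 4 * (C2' * S ^+ 3) + C4); split=> //.
  by rewrite !addr_ge0 ?mulr_ge0 ?exprn_ge0.
move=> W n N n0 mesh hW t tT.
have nR : 0 < n%:R :> R by rewrite ltr0n.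
have n1 : 1 <= n%:R :> R by rewrite ler1n.
have [l [sl lb lh]] := step n t n0 tT.
have [r rP rE] := symavgsG_prob R N l.
have tau0 : 0 < tau_ R n by rewrite invr_gt0 exprn_gt0.
have i3 : (n%:R ^+ 3)^-1 = tau_ R n * (n%:R)^-1 by rewrite /tau_ -invfM -exprSr.
have t2 : tau_ R n ^+ 2 <= tau_ R n * (n%:R)^-1.
  rewrite expr2 ler_wpM2l ?(ltW tau0) // /tau_ lef_pV2 ?posrE ?exprn_gt0 //.
  by rewrite expr2 ler_peMl // ltW.
have S3 C : C * (S / n%:R) ^+ 3 = C * S ^+ 3 * (tau_ R n * (n%:R)^-1).
  by rewrite expr_div_n -i3 mulrA.
have m0 : 0 <= tau_ R n * (n%:R)^-1 by rewrite mulr_ge0 ?invr_ge0 // ltW.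
have Sn0 : 0 <= S / n%:R by rewrite divr_ge0.
exists r => // y x.
have UE : avgQ (lat_e n N) (wavg r (samp W n t)) y =
   symavgs (map (@real_shift R (eps_ R n) d) [:: half_step ez n, half_step ez n & l]) (fun x => u (vcons t x)) x.
  have e : wavg r (samp W n t) = symavgsG l (samp W n t) by apply/funext => z; exact: rE.
  rewrite /lat_e avgQ_symavgG e; apply: (@symavgsG_samp W n N n0 mesh S [:: half_step ez n, half_step ez n & l] t y d.+2) => //.
  by rewrite /= sl.
have lb2 z a : z \in map (@real_shift R (eps_ R n) d) [:: half_step ez n; half_step ez n] -> `|z 0 a| <= S / n%:R.
  by move=> h; apply: lb; move: h; rewrite !inE => /orP[->|->]; rewrite ?orbT.
split.
  have h1 := T3 t x (tau_ R n) (ltW tau0).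
  have h2 := T1 t x (map (@real_shift R (eps_ R n) d) [:: half_step ez n, half_step ez n & l]) (S / n%:R) _ Sn0 lb.
  rewrite -UE in h2; have {}h2 := h2 _; rewrite size_map /= sl in h2; have {}h2 := h2 erefl.
  have h3 := lh x.
  apply: le_trans (dist3_le h1 h2 h3) _; rewrite S3 i3.
  apply: consts_le C30 t2 m0 _ C40; exact: mulr_ge0 C20' (exprn_ge0 3 S0).
have UE2 : avgQ (lat_e n N) (samp W n (t - tau_ R n)) y =
   symavgs (map (@real_shift R (eps_ R n) d) [:: half_step ez n; half_step ez n]) (fun z => u (vcons (t - tau_ R n) z)) x.
  rewrite /lat_e avgQ_symavgG; apply: (@symavgsG_samp W n N n0 mesh S _ _ y 2) => //.
  by apply: le_trans hW; rewrite lerD2l ler_wpM2r // ler_nat.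
have h1 := T2 (t - tau_ R n) x (map (@real_shift R (eps_ R n) d) [:: half_step ez n; half_step ez n]) (S / n%:R) erefl Sn0 lb2.
rewrite -UE2 S3 in h1.
have {}h2 := T4 t x (tau_ R n) (ltW tau0).
rewrite avgQ_diff2.
move: h1; rewrite /= big_cons big_seq1.
have hh := hess_half_step ez u (t - tau_ R n) x n0.
move=> h1.
have tn : tau_ R n <= (n%:R)^-1.
  by rewrite /tau_ lef_pV2 ?posrE ?exprn_gt0 // expr2 ler_peMl // ltW.
apply: (diff2_consistent h1 h2 hh tau0 tn C40).
by rewrite !addr_ge0 // mulr_ge0 // exprn_ge0.
Qed.

Theorem lattice_estimate (p Nc : R) : 1 < p -> 0 <= Nc ->
  (forall (G : finZmodType) (e : G) (r g : nat -> G -> R) K, (forall n, is_prob (r n)) ->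
    \sum_(n < K) \sum_x `|diff2 e (rheat_sol e r g n.+1) x| `^ p
      <= Nc * \sum_(n < K) \sum_x `|g n x| `^ p) ->
  exists S C, [/\ 0 <= S, 0 <= C & forall W n N K b, (0 < n)%N ->
  N.+2%:R * eps_ R n = 2 * W -> A + d.+2%:R * S <= W -> A <= b ->
  (forall k, (k < K)%N -> - T <= b - k%:R * tau_ R n <= T) ->
  \sum_(k < K) \sum_(y : 'rV['I_N.+2]_d)
     `|hess u (b - k%:R * tau_ R n) (lat_pt W (eps_ R n) y) D| `^ p
  <= Nc * \sum_(k < K) \sum_(y : 'rV['I_N.+2]_d)
     `|parF (b - k%:R * tau_ R n) (lat_pt W (eps_ R n) y)| `^ p
   + \sum_(k < K) \sum_(y : 'rV['I_N.+2]_d) C / n%:R].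
Proof.
move=> p1 Nc0 heat.
have [S [C [S0 C0 cons]]] := lattice_consistent.
have [B B0 bnd] := parF_bounded.
pose C' := p * (B + C) `^ (p - 1) * C.
have p0 : 0 <= p by apply: ltW; exact: lt_trans ltr01 p1.
have C'0 : 0 <= C' by rewrite /C' !mulr_ge0 ?powR_ge0.
have C20 : 0 <= C' + Nc * C' by apply: addr_ge0 => //; exact: mulr_ge0.
exists S, (C' + Nc * C'); split=> //.
move=> W n N K b n0 mesh hW Ab hT.
set tau := tau_ R n; pose t k := b - k%:R * tau.
have tau0 : 0 < tau by rewrite invr_gt0 exprn_gt0 ?ltr0n.
have tS k : t k - tau = t k.+1 by rewrite /t -natr1 mulrDl mul1r opprD addrA.
pose x := @lat_pt R W (eps_ R n) N d.
pose e := lat_e n N.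
pose good (k : nat) (r : 'rV['I_N.+2]_d -> R) := is_prob r /\ ((k < K)%N -> forall y,
   `|samp W n (t k.+1) y - avgQ e (wavg r (samp W n (t k))) y
      + (tau * dt u (vcons (t k) (x y)) + tau * Lop c u (vcons (t k) (x y)))| <= C * (tau * (n%:R)^-1) /\
   `|diff2 e (samp W n (t k.+1)) y - tau * hess u (t k) (x y) D| <= C * (tau * (n%:R)^-1)).
have good_ex k : exists r, good k r.
  case: (ltnP k K) => kK; last first.
    by exists (dirac_at R 0); apply: conj; [exact: dirac_prob | rewrite ltnNge kK].
  have [r rP h] := cons W n N n0 mesh hW (t k) (hT k kK).
  by exists r; split=> // _ y; rewrite -tS; exact: h.
have [r rP] := choice good_ex.
(* With the exact residual as data, the sampled function solves the scheme without error;
   consistency only compares [g] with [- tau * parF]. *)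
pose g k y := samp W n (t k.+1) y - avgQ e (wavg (r k) (samp W n (t k))) y.
(* The zero initial value is correct because [t 0 = b >= A] lies beyond the support of [u]. *)
have UE k : rheat_sol e r g k = samp W n (t k).
  elim: k => [|k IH] /=; apply/funext => y.
    rewrite /samp /t mul0r subr0; symmetry; apply: (HA [::] (i := ord0)).
    by rewrite vcons0; apply: le_trans (ler_norm _).
  by rewrite IH /g addrC subrK.
have := heat _ e r g K (fun k => (rP k).1).
(* Both the data and the second differences are of order [tau], so the estimate is divided by
   [tau^p]. *)
pose q := tau^-1 `^ p; have q0 : 0 < q by rewrite powR_gt0 // invr_gt0.
rewrite -(ler_pM2r q0) -mulrA !mulr_suml => h.
have scale a : `|a / tau| `^ p = `|a| `^ p * q.
  by rewrite normrM powRM // (@gtr0_norm _ tau^-1) // invr_gt0.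
have n1 : C * (n%:R)^-1 <= C by rewrite ler_piMr // invf_le1 ?ler1n ?ltr0n.
have m0 : 0 <= (n%:R)^-1 :> R by rewrite invr_ge0.
have E1 (k : 'I_K) y : `|hess u (t k) (x y) D| `^ p <= `|diff2 e (rheat_sol e r g k.+1) y| `^ p * q + C' / n%:R.
  have [_ /(_ (ltn_ord k) y) [_ h2]] := rP k.
  have [_ hb] := bnd (t k) (x y) (hT k (ltn_ord k)).
  have := scaled_power_le p1 tau0 C0 h2 hb n1 m0.
  rewrite UE -scale -/C' mulrA -/C'; rewrite ler_norml => /andP[h3 _]; move: h3.
  by rewrite -subr_ge0 opprK addrAC subr_ge0.
have E2 (k : 'I_K) y : `|g k y| `^ p * q <= `|parF (t k) (x y)| `^ p + C' / n%:R.
  have [_ /(_ (ltn_ord k) y) [h2 _]] := rP k.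
  have [hb _] := bnd (t k) (x y) (hT k (ltn_ord k)).
  have {}h2 : `|g k y - tau * - parF (t k) (x y)| <= C * (tau * (n%:R)^-1).
    by rewrite mulrN opprK /parF mulrDr.
  rewrite -normrN in hb.
  have := scaled_power_le p1 tau0 C0 h2 hb n1 m0.
  rewrite -scale mulrA -/C' normrN; rewrite ler_norml => /andP[_ h3]; move: h3.
  by rewrite lerBlDl.
apply: (@le_trans _ _ (\sum_(k < K) (\sum_y `|diff2 e (rheat_sol e r g k.+1) y| `^ p) * q
    + \sum_(k < K) \sum_(y : 'rV['I_N.+2]_d) C' / n%:R)).
  rewrite -big_split; apply: ler_sum => k _ /=; rewrite mulr_suml -big_split; apply: ler_sum => y _.
  exact: E1.
have -> : \sum_(k < K) \sum_(y : 'rV['I_N.+2]_d) (C' + Nc * C') / n%:R =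
   \sum_(k < K) \sum_(y : 'rV['I_N.+2]_d) C' / n%:R + Nc * \sum_(k < K) \sum_(y : 'rV['I_N.+2]_d) C' / n%:R.
  rewrite mulr_sumr -big_split; apply: eq_bigr => k _; rewrite mulr_sumr -big_split; apply: eq_bigr => y _.
  by rewrite mulrDl mulrA.
rewrite [leRHS]addrCA [leLHS]addrC lerD2l -mulrDr; apply: le_trans h _.
rewrite ler_wpM2l // -big_split; apply: ler_sum => k _ /=; rewrite mulr_suml -big_split; apply: ler_sum => y _.
exact: E2.
Qed.
End Discrete.

(** * Passage to the limit *)

Section Slices.
Variable R : realType.

Lemma rsum_measurable d (f : R -> 'rV[R]_d -> R) a h N :
  (forall v, measurable_fun [set: R] (f^~ v)) -> measurable_fun [set: R] (fun t => rsum a h N (f t)).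
Proof.
elim: d f => [|d IH] f mf /=; first exact: mf.
apply: measurable_sum => i; apply: measurable_funM; first exact: measurable_cst.
by apply: (IH (fun t v => f t (vcons (a + i%:R * h) v))) => v; exact: mf.
Qed.

(** Measurability in [t] passes from the Riemann sums to their limit, and their error is uniform in
    [t]. *)
Lemma slice_integral d (f : R -> 'rV[R]_d -> R) L A : 0 <= L -> 0 < A ->
  (forall t v, 0 <= f t v) -> (forall t, lipn L (f t)) -> (forall t, vanishn A (f t)) ->
  (forall v, measurable_fun [set: R] (f^~ v)) ->
  exists s : R -> R, [/\ forall t, 0 <= s t, forall t, iint (fun v => (f t v)%:E) = (s t)%:E,
   measurable_fun [set: R] s &
   forall t N h, N%:R * h = 2 * A -> 0 < h ->
     `|s t - rsum (- A) h N (f t)| <= d%:R * L * h * (2 * A) ^+ d].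
Proof.
move=> L0 A0 f0 lf vf mf.
pose good (t s : R) := [/\ 0 <= s, iint (fun v => (f t v)%:E) = s%:E &
  forall N h, N%:R * h = 2 * A -> 0 < h -> `|s - rsum (- A) h N (f t)| <= d%:R * L * h * (2 * A) ^+ d].
have good_ex t : exists s, good t s.
  by have [s s0 [h1 h2]] := riemann_nd L0 A0 (f0 t) (lf t) (vf t); exists s.
have [s sP] := choice good_ex.
exists s; split; [by move=> t; case: (sP t)| by move=> t; case: (sP t) | |by move=> t; case: (sP t)].
pose h (m : nat) : R := 2 * A / m.+1%:R.
have h0 m : 0 < h m by rewrite divr_gt0 // mulr_gt0.
apply: (@measurable_fun_cvg _ _ _ _ (fun m t => rsum (- A) (h m) m.+1 (f t))).
  by move=> m; exact: rsum_measurable.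
move=> t _; have [_ _ sR] := sP t.
pose Q := d%:R * L * (2 * A) * (2 * A) ^+ d.
have Q0 : 0 <= Q by rewrite !mulr_ge0 ?exprn_ge0 // ltW // mulr_gt0.
apply/cvgrPdist_le => e e0.
have [m0 m0P] : exists m0 : nat, Q / e < m0%:R.
  by exists (Num.Def.truncn (Q / e)).+1; exact: truncnS_gt.
near=> m; apply: le_trans (sR m.+1 (h m) _ (h0 m)) _.
  by rewrite /h mulrC divfK // pnatr_eq0.
have -> : d%:R * L * h m * (2 * A) ^+ d = Q / m.+1%:R by rewrite /Q /h; ring.
rewrite ler_pdivrMr ?ltr0n // mulrC -ler_pdivrMr //.
apply/ltW/(lt_le_trans m0P); rewrite ler_nat; apply: leqW; near: m; exact: nbhs_infty_ge.
Unshelve. all: by end_near.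
Qed.

Lemma lipn_powR d (f : 'rV[R]_d -> R) L B p : 1 < p -> lipn L f -> (forall v, `|f v| <= B) ->
  lipn (p * B `^ (p - 1) * L) (fun v => `|f v| `^ p).
Proof.
move=> p1 lf bf v w del del0 h; apply: le_trans (powR_lipschitz p1 (bf v) (bf w)) _.
rewrite -[leRHS]mulrA ler_wpM2l //; last exact: lf.
by rewrite mulr_ge0 ?powR_ge0 // ltW // (lt_trans ltr01 p1).
Qed.

Lemma vanishn_powR d (f : 'rV[R]_d -> R) A p : p != 0 -> vanishn A f -> vanishn A (fun v => `|f v| `^ p).
Proof. by move=> p0 vf v i h; rewrite (vf v i h) normr0 powR0. Qed.

Lemma vanishn_le d (f : 'rV[R]_d -> R) A B : A <= B -> vanishn A f -> vanishn B f.
Proof. by move=> AB vf v i h; apply: (vf v i); apply: le_trans h. Qed.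

Lemma measurable_powR_norm (g : R -> R) p : measurable_fun [set: R] g ->
  measurable_fun [set: R] (fun t => `|g t| `^ p).
Proof.
move=> mg; apply: (measurableT_comp (measurable_powR p)).
exact: (measurableT_comp (@normr_measurable R setT) mg).
Qed.

Variables (d : nat) (u : 'rV[R]_d.+1 -> R).
Hypothesis Hu : Cinf_c u.

Lemma lipn_slice L (g : 'rV[R]_d.+1 -> R) t : lipn L g -> lipn L (fun x => g (vcons t x)).
Proof.
move=> lg v w del del0 h; apply: lg => // i.
by elim/vcons_ind: i => [|k]; rewrite ?vcons0 ?subrr ?normr0 // !vconsS.
Qed.

Lemma vanishn_slice A (g : 'rV[R]_d.+1 -> R) t : vanishn A g -> vanishn A (fun x => g (vcons t x)).
Proof. by move=> vg v i h; apply: (vg _ (lift ord0 i)); rewrite vconsS. Qed.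

Lemma measurable_slice s x : measurable_fun [set: R] (fun t => iter_partial s u (vcons t x)).
Proof.
have [L L0 HL] := partial_lip Hu s.
apply: continuous_measurable_fun; apply: (lip1_continuous L0) => a b.
apply: HL => // i; elim/vcons_ind: i => [|k]; first by rewrite !vcons0.
by rewrite !vconsS subrr normr0.
Qed.

Variables (c : 'I_d -> 'I_d -> R -> R) (T Mc : R).
Hypothesis c_bnd : forall i j t, - T <= t <= T -> `|c i j t| <= Mc.
Hypothesis Mc0 : 0 <= Mc.
Hypothesis c_meas : forall i j, measurable_fun [set: R] (c i j).

Lemma parF_measurable x : measurable_fun [set: R] (fun t => parF c u t x).
Proof.
apply: measurable_funD; first exact: measurable_slice.
rewrite /Lop; under eq_fun do under eq_bigr do under eq_bigr do rewrite vcons0.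
apply: measurable_sum => i; apply: measurable_sum => j.
apply: measurable_funM; [exact: c_meas | exact: measurable_slice].
Qed.

Lemma parF_lip : exists2 L, 0 <= L & forall t, - T <= t <= T -> lipn L (parF c u t).
Proof.
have [L L0 LP] := partial_lip_fam Hu (fun k : 'I_d * 'I_d => [:: lift ord0 k.1; lift ord0 k.2]).
have [Lt Lt0 HLt] := partial_lip Hu [:: ord0].
exists (Lt + \sum_(i < d) \sum_(j < d) Mc * L).
  rewrite addr_ge0 //; do 2![apply: sumr_ge0 => ? _].
  by rewrite mulr_ge0.
move=> t tT v w del del0 h.
rewrite /parF opprD addrACA mulrDl; apply: le_trans (ler_normD _ _) _; apply: lerD.
  exact: (lipn_slice t HLt).
rewrite /Lop -sumrB mulr_suml; apply: le_trans (ler_norm_sum _ _ _) _.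
apply: ler_sum => i _; rewrite -sumrB mulr_suml; apply: le_trans (ler_norm_sum _ _ _) _.
apply: ler_sum => j _; rewrite !vcons0 -mulrBr normrM -mulrA ler_pM //; first exact: c_bnd.
exact: (lipn_slice t (LP (i, j))).
Qed.

Variable A : R.
Hypothesis HA : forall s, vanishn A (iter_partial s u).

Let parF_zero t x : (forall s, iter_partial s u (vcons t x) = 0) -> parF c u t x = 0.
Proof.
move=> z; rewrite /parF [dt u _](z [:: ord0]) add0r /Lop big1 // => a _; rewrite big1 // => b _.
by rewrite [dxx _ _ _ _](z [:: lift ord0 a; lift ord0 b]) mulr0.
Qed.

Lemma parF_vanish t : vanishn A (parF c u t).
Proof. by move=> v i h; apply: parF_zero => s; exact: (vanishn_slice t (HA s) h). Qed.

Lemma parF_time_vanish t x : A <= `|t| -> parF c u t x = 0.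
Proof. by move=> h; apply: parF_zero => s; apply: (HA s (i := ord0)); rewrite vcons0. Qed.
End Slices.

Section Offsets.
Variable R : realType.
Local Notation mu := (@lebesgue_measure R).

(** The hypothesis is the discrete estimate on the grid with offset [x]; integration over one cell
    of offsets restores the integrals exactly. *)
Lemma cells_integral_le (f g : R -> R) a tau K N B : 0 < tau -> 0 <= N -> 0 <= B ->
  measurable_fun [set: R] f -> measurable_fun [set: R] g ->
  (forall t, 0 <= f t) -> (forall t, 0 <= g t) ->
  (forall x, 0 <= x < tau ->
     \sum_(j < K) f (a + j%:R * tau + x) <= N * \sum_(j < K) g (a + j%:R * tau + x) + B) ->
  (\int[mu]_(x in `[a, (a + K%:R * tau)%R[) (f x)%:E <=
   N%:E * \int[mu]_(x in `[a, (a + K%:R * tau)%R[) (g x)%:E + (tau * B)%:E)%E.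
Proof.
move=> tau0 N0 B0 mf mg f0 g0 H.
have mEF (h : R -> R) : measurable_fun [set: R] h -> measurable_fun [set: R] (EFin \o h) by move=> ?; apply/measurable_EFinP.
have ms (h : R -> R) (y : R) D : measurable_fun [set: R] h -> measurable_fun D (fun x => (h (y + x))%:E).
  move=> mh; apply: measurable_funTS; apply/measurable_EFinP; apply: (measurableT_comp mh).
  exact: measurable_funD.
have cells (h : R -> R) : measurable_fun [set: R] h -> (forall t, 0 <= h t) ->
  (\int[mu]_(x in `[a, (a + K%:R * tau)%R[) (h x)%:E =
   \int[mu]_(x in `[0%R, tau[) (\sum_(j < K) h (a + j%:R * tau + x)%R)%:E)%E.
  move=> mh h0; rewrite (@ge0_integral_cells R (EFin \o h) a tau K tau0 (mEF h mh)) => [|x]; last by rewrite lee_fin.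
  under [RHS]eq_integral do rewrite -sumEFin.
  rewrite ge0_integral_sum //.
  - by move=> j; exact: ms.
  - by move=> j x _; rewrite lee_fin.
rewrite !cells //.
have -> : (tau * B)%:E = (\int[mu]_(x in `[0%R, tau[) B%:E)%E.
  rewrite integral_cst //= lebesgue_measure_itv /= lte_fin tau0 oppr0 adde0 -EFinM.
  by rewrite mulrC.
have msum (h : R -> R) : measurable_fun [set: R] h -> measurable_fun `[0, tau[ (fun x => (\sum_(j < K) h (a + j%:R * tau + x))%:E).
  move=> mh; apply/measurable_EFinP; apply: measurable_sum => j.
  by apply/measurable_EFinP; exact: ms.
have s0 (h : R -> R) x : (forall t, 0 <= h t) -> (0 <= (\sum_(j < K) h (a + j%:R * tau + x))%:E)%E.
  by move=> h0; rewrite lee_fin sumr_ge0.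
rewrite -ge0_integralZl_EFin //; last 2 first.
- by move=> x _; exact: s0.
- exact: msum.
rewrite -ge0_integralD //; last 2 first.
- by move=> x _; rewrite mule_ge0 ?lee_fin // sumr_ge0.
- by apply: emeasurable_funM => //; exact: msum.
apply: ge0_le_integral => //.
- by move=> x _; exact: s0.
- exact: msum.
- apply: emeasurable_funD; last exact: measurable_cst.
  by apply: emeasurable_funM => //; exact: msum.
Qed.

(** The grid has [2 a0 n^2] cells of length [n^-2], so the errors accumulate to [2 a0 C / n], which
    is below any given [e] for large [n]. *)
Lemma offset_integral_le (f g : R -> R) (a0 : nat) N C : 0 <= N -> 0 <= C ->
  measurable_fun [set: R] f -> measurable_fun [set: R] g ->
  (forall t, 0 <= f t) -> (forall t, 0 <= g t) -> (forall t, a0%:R <= `|t| -> f t = 0) ->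
  (forall n x, (0 < n)%N -> 0 <= x < tau_ R n ->
     \sum_(j < 2 * a0 * n ^ 2) f (- a0%:R + j%:R * tau_ R n + x)
       <= N * \sum_(j < 2 * a0 * n ^ 2) g (- a0%:R + j%:R * tau_ R n + x) + (2 * a0 * n ^ 2)%:R * (C / n%:R)) ->
  (\int[mu]_x (f x)%:E <= N%:E * \int[mu]_x (g x)%:E)%E.
Proof.
move=> N0 C0 mf mg f0 g0 vf H.
apply/lee_addgt0Pr => e e0.
pose n := (Num.Def.truncn (2 * a0%:R * C / e)).+1.
have n0 : 0 < n%:R :> R by rewrite ltr0n.
have hn : 2 * a0%:R * C / n%:R <= e.
  rewrite ler_pdivrMr // [leRHS]mulrC -ler_pdivrMr //; apply/ltW; exact: truncnS_gt.
have tau0 : 0 < tau_ R n by rewrite invr_gt0 exprn_gt0.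
have B0 : 0 <= (2 * a0 * n ^ 2)%:R * (C / n%:R) by rewrite mulr_ge0 ?divr_ge0.
have Kt : (2 * a0 * n ^ 2)%:R * tau_ R n = 2 * a0%:R.
  by rewrite natrM natrX natrM /tau_ mulfK // gt_eqF // exprn_gt0.
have := @cells_integral_le f g (- a0%:R) (tau_ R n) (2 * a0 * n ^ 2) N _ tau0 N0 B0 mf mg f0 g0
   (fun x hx => H n x isT hx).
rewrite Kt mulrA (mulrC (tau_ R n)) Kt mulrA => h.
have e2 : - a0%:R + 2 * a0%:R = a0%:R :> R by ring.
rewrite e2 in h.
rewrite (@integral_vanish _ _ `[(- a0%:R), a0%:R[); last first.
  move=> x hx; rewrite vf //; apply: contrapT => /negP; rewrite -ltNge ltr_norml => /andP[h1 h2].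
  by apply: hx; rewrite /= in_itv /= (ltW h1).
apply: (le_trans h); apply: leeD; last by rewrite lee_fin.
apply: lee_wpmul2l; first by rewrite lee_fin.
apply: ge0_subset_integral => //.
- exact/measurable_EFinP.
- by move=> x _; rewrite lee_fin.
Qed.
End Offsets.

(** * Polarisation of the second derivatives *)

Section Polarisation.
Variables (R : realType) (d : nat).

(** The vector [e_i + s e_j], with integer entries as lattice shifts demand. For [i = j] and [s]
    equal to [1] or [-1] it is [2 e_i] or [0]. *)
Definition pol (i j : 'I_d) (s : int) : 'I_d -> int := fun a => (a == i)%:Z + s * (a == j)%:Z.

Lemma polE i j s a : (pol i j s a)%:~R = (a == i)%:R + s%:~R * (a == j)%:R :> R.
Proof. by rewrite /pol rmorphD rmorphM /= -!pmulrn. Qed.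

Lemma pol_bnd i j s a : `|s%:~R : R| <= 1 -> `|(pol i j s a)%:~R : R| <= 2.
Proof.
move=> hs; rewrite polE; apply: le_trans (ler_normD _ _) _.
have -> : 2 = 1 + 1 :> R by lra.
have h (b : bool) : `|b%:R : R| <= 1 by case: b; rewrite ?normr1 ?normr0.
by apply: lerD => //; rewrite normrM -[leRHS]mulr1 ler_pM.
Qed.

Lemma sum_pol i j s (F : 'I_d -> R) : \sum_a (pol i j s a)%:~R * F a = F i + s%:~R * F j.
Proof.
transitivity (\sum_a F a * (a == i)%:R + \sum_a (s%:~R * F a) * (a == j)%:R).
  by rewrite -big_split; apply: eq_bigr => a _ /=; rewrite polE; ring.
by rewrite !sum_deltaR.
Qed.

Lemma sum_pol2 i j s (D : 'I_d -> 'I_d -> R) :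
  \sum_a \sum_b (pol i j s a)%:~R * (pol i j s b)%:~R * D a b =
  D i i + s%:~R * D i j + s%:~R * (D j i + s%:~R * D j j).
Proof.
transitivity (\sum_a (pol i j s a)%:~R * (D a i + s%:~R * D a j)).
  apply: eq_bigr => a _; rewrite -(sum_pol i j s (D a)) mulr_sumr; apply: eq_bigr => b _.
  by rewrite mulrA.
exact: (sum_pol i j s (fun a => D a i + s%:~R * D a j)).
Qed.

Lemma hess_pol (u : 'rV[R]_d.+1 -> R) t x i j s :
  hess u t x (dir R (pol i j s)) =
  dxx i i u (vcons t x) + s%:~R * dxx i j u (vcons t x)
   + s%:~R * (dxx j i u (vcons t x) + s%:~R * dxx j j u (vcons t x)).
Proof.
rewrite -(sum_pol2 i j s (fun a b => dxx a b u (vcons t x))) /hess.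
by apply: eq_bigr => a _; apply: eq_bigr => b _; rewrite /dir !mxE.
Qed.

Lemma dxx_pol (u : 'rV[R]_d.+1 -> R) t x i j : Cinf_c u ->
  4 * dxx i j u (vcons t x) = hess u t x (dir R (pol i j 1)) - hess u t x (dir R (pol i j (- 1))).
Proof.
move=> Hu; rewrite !hess_pol.
have -> : dxx j i u (vcons t x) = dxx i j u (vcons t x) by rewrite /dxx (schwarz Hu).
move: (dxx _ _ _ _) (dxx _ _ _ _) (dxx _ _ _ _) => X Y Z.
by rewrite rmorphN /= !rmorph1; ring.
Qed.

(** The factor [1 / 4] comes from [(xi_i + s xi_j)^2 <= 2 xi_i^2 + 2 xi_j^2], where each square is
    at most the ellipticity sum; this also covers [i = j]. *)
Lemma pol_psd (p0 : nat) (a : 'I_d -> 'I_d -> R) (i j : 'I_d) s :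
  `|s%:~R : R| <= 1 -> (i < p0)%N -> (j < p0)%N -> (forall i j, a i j = a j i) ->
  (forall xi : 'I_d -> R, \sum_(k < d | (k < p0)%N) xi k ^+ 2 <= \sum_k \sum_l a k l * xi k * xi l) ->
  psd (fun k l => a k l - 4^-1 * (pol i j s k)%:~R * (pol i j s l)%:~R).
Proof.
move=> hs ip jp sym low; split=> [k l|xi]; first by rewrite sym mulrAC.
have -> : qform (fun k l => a k l - 4^-1 * (pol i j s k)%:~R * (pol i j s l)%:~R) xi =
   \sum_k \sum_l a k l * xi k * xi l - 4^-1 * (xi i + s%:~R * xi j) ^+ 2.
  rewrite -(sum_pol i j s xi) expr2 big_distrlr /= mulr_sumr -sumrB.
  apply: eq_bigr => k _; rewrite mulr_sumr -sumrB; apply: eq_bigr => l _; ring.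
have h (k : 'I_d) : (k < p0)%N -> xi k ^+ 2 <= \sum_(k < d | (k < p0)%N) xi k ^+ 2.
  by move=> kp; rewrite (bigD1 k) //= lerDl sumr_ge0 // => l _; exact: sqr_ge0.
have := low xi; have := h i ip; have := h j jp.
have s1 : (s%:~R : R) ^+ 2 <= 1.
  by rewrite -real_normK ?num_real // expr_le1.
move: (\sum_(k < d | _) _) (\sum_k _) => X Y h1 h2 h3.
have : (xi i + s%:~R * xi j) ^+ 2 <= 2 * xi i ^+ 2 + 2 * xi j ^+ 2.
  have := sqr_ge0 (xi i - s%:~R * xi j); have := sqr_ge0 (xi j).
  move: (s%:~R : R) (xi i) (xi j) s1 => S P Q s1; nra.
lra.
Qed.

(** [4 |D|] is at most twice the larger of [|E1|] and [|E2|], so the power costs no constant. *)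
Lemma pol_powR (D E1 E2 p : R) : 0 <= p -> 4 * D = E1 - E2 ->
  `|D| `^ p <= `|E1| `^ p + `|E2| `^ p.
Proof.
move=> p0 e; have h : 4 * `|D| <= `|E1| + `|E2|.
  by rewrite -[X in X * _](@ger0_norm R 4) // -normrM e ler_normB.
case: (lerP `|E1| `|E2|) => h'.
  apply: (@le_trans _ _ (`|E2| `^ p)); last by rewrite lerDr powR_ge0.
  by apply: ge0_ler_powR; rewrite ?nnegrE //; have := normr_ge0 D; lra.
apply: (@le_trans _ _ (`|E1| `^ p)); last by rewrite lerDl powR_ge0.
by apply: ge0_ler_powR; rewrite ?nnegrE //; have := normr_ge0 D; lra.
Qed.
End Polarisation.

(** The solution [N] of [(N + 2) / (2 n^2) = 2 W], as the mesh [eps_ n] requires. *)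
Lemma lattice_size W n : (0 < W)%N -> (0 < n)%N -> exists N, N.+2 = (4 * W * n ^ 2)%N.
Proof.
move=> W0 n0; exists (4 * W * n ^ 2 - 2)%N.
have : (0 < W * n ^ 2)%N by rewrite muln_gt0 W0 expn_gt0 n0.
by rewrite -mulnA; move: (W * _)%N => q; lia.
Qed.

Lemma lattice_const (R : realType) d N K (eps a : R) :
  eps ^+ d * \sum_(k < K) \sum_(y : 'rV['I_N.+2]_d) a = K%:R * ((N.+2%:R * eps) ^+ d * a).
Proof.
have e : eps ^+ d * \sum_(y : 'rV['I_N.+2]_d) a = (N.+2%:R * eps) ^+ d * a.
  rewrite -(rsum_lattice 0 eps N (fun _ : 'rV[R]_d => a)).
  elim: d => [|d IH] /=; first by rewrite expr0 mul1r.
  rewrite IH sumr_const card_ord -[LHS]mulr_natl exprS; ring.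
by rewrite mulr_sumr (eq_bigr _ (fun k _ => e)) sumr_const card_ord -[LHS]mulr_natl.
Qed.

Lemma assemble_le (R : realType) (X Y ed F G k Qf Qg C m N : R) : 0 <= N ->
  `|X - ed * F| <= k * (Qf / m) -> `|Y - ed * G| <= k * (Qg / m) ->
  ed * F <= ed * (N * G) + k * (C / m) ->
  X <= N * Y + k * ((Qf + C + N * Qg) / m).
Proof.
move=> N0; rewrite !ler_norml => /andP[_ h1] /andP[h2 _] h3.
have h4 : N * (ed * G - Y) <= N * (k * (Qg / m)) by rewrite ler_wpM2l //; lra.
have -> : k * ((Qf + C + N * Qg) / m) = k * (Qf / m) + k * (C / m) + N * (k * (Qg / m)) by ring.
have e1 : ed * (N * G) = N * (ed * G) by ring.
rewrite e1 in h3; rewrite mulrBr in h4; lra.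
Qed.

Lemma iint0 (R : realType) n : iint (fun _ : 'rV[R]_n => 0%E) = 0%E.
Proof. by elim: n => [//|n IH] /=; rewrite IH integral0. Qed.

Section Assembly.
Variables (R : realType) (d p0 : nat) (p : R) (c : 'I_d -> 'I_d -> R -> R).
Hypothesis p1 : 1 < p.
Hypothesis c_meas : forall i j, measurable_fun [set: R] (c i j).
Hypothesis c_loc : forall i j (a b : R), exists M : R, forall t, a <= t <= b -> `|c i j t| <= M.
Hypothesis c_sym : forall i j t, c i j t = c j i t.
Hypothesis c_low : forall t (xi : 'I_d -> R),
  \sum_(j < d | (j < p0)%N) xi j ^+ 2 <= \sum_(i < d) \sum_(j < d) c i j t * xi i * xi j.

Lemma c_bounded (T : R) : exists2 Mc, 0 <= Mc & forall i j t, - T <= t <= T -> `|c i j t| <= Mc.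
Proof.
have [M MP] := choice (fun k : 'I_d * 'I_d => c_loc k.1 k.2 (- T) T).
exists (\sum_k `|M k|); first by apply: sumr_ge0.
move=> i j t tT; apply: le_trans (MP (i, j) t tT) _; apply: le_trans (ler_norm _) _.
by rewrite (bigD1 (i, j)) //= lerDl sumr_ge0.
Qed.

Variable Nc : R.
Hypothesis Nc0 : 0 <= Nc.
Hypothesis heat : forall (G : finZmodType) (e : G) (r g : nat -> G -> R) K,
  (forall n, is_prob (r n)) ->
  \sum_(n < K) \sum_x `|diff2 e (rheat_sol e r g n.+1) x| `^ p
    <= Nc * \sum_(n < K) \sum_x `|g n x| `^ p.

Variable u : 'rV[R]_d.+1 -> R.
Hypothesis Hu : Cinf_c u.
Variables i j : 'I_d.
Hypotheses (ip : (i < p0)%N) (jp : (j < p0)%N).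

(** The directions [e_i + e_j] and [e_i - e_j] contribute [Nc] each; adding their margins lets one
    torus serve both. *)
Lemma dxx_lattice_estimate A T : 0 < A -> (forall s, vanishn A (iter_partial s u)) ->
  exists S C, [/\ 0 <= S, 0 <= C & forall W n N K b, (0 < n)%N ->
  N.+2%:R * eps_ R n = 2 * W -> A + S <= W -> A <= b ->
  (forall k, (k < K)%N -> - T <= b - k%:R * tau_ R n <= T) ->
  \sum_(k < K) \sum_(y : 'rV['I_N.+2]_d)
     `|dxx i j u (vcons (b - k%:R * tau_ R n) (lat_pt W (eps_ R n) y))| `^ p
  <= 2 * Nc * \sum_(k < K) \sum_(y : 'rV['I_N.+2]_d)
     `|parF c u (b - k%:R * tau_ R n) (lat_pt W (eps_ R n) y)| `^ p
   + \sum_(k < K) \sum_(y : 'rV['I_N.+2]_d) C / n%:R].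
Proof.
move=> A0 HA; have [Mc Mc0 c_bnd] := c_bounded T.
have sg1 : `|1%:~R : R| <= 1 by rewrite normr1.
have sg2 : `|(- 1)%:~R : R| <= 1 by rewrite rmorphN normrN normr1.
have est s (hs : `|s%:~R : R| <= 1) :=
  lattice_estimate Mc0 c_bnd (fun a => pol_bnd i j a hs)
    (fun t => pol_psd hs ip jp (fun i j => c_sym i j t) (c_low t)) Hu HA p1 Nc0 heat.
have [S1 [C1 [S10 C10 H1]]] := est _ sg1.
have [S2 [C2 [S20 C20 H2]]] := est _ sg2.
have S0 : 0 <= d.+2%:R * (S1 + S2) by rewrite mulr_ge0 // addr_ge0.
exists (d.+2%:R * (S1 + S2)), (C1 + C2); split => //; first exact: addr_ge0.
move=> W n N K b n0 mesh hW Ab hT.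
have hW1 : A + d.+2%:R * S1 <= W by apply: le_trans hW; rewrite lerD2l ler_wpM2l // lerDl.
have hW2 : A + d.+2%:R * S2 <= W by apply: le_trans hW; rewrite lerD2l ler_wpM2l // lerDr.
have h := lerD (H1 W n N K b n0 mesh hW1 Ab hT) (H2 W n N K b n0 mesh hW2 Ab hT).
set F := \sum_(k < K) \sum_y `|parF _ _ _ _| `^ p in h *.
have -> : \sum_(k < K) \sum_(y : 'rV['I_N.+2]_d) (C1 + C2) / n%:R =
   \sum_(k < K) \sum_(y : 'rV['I_N.+2]_d) C1 / n%:R + \sum_(k < K) \sum_(y : 'rV['I_N.+2]_d) C2 / n%:R.
  rewrite -big_split; apply: eq_bigr => k _; rewrite -big_split; apply: eq_bigr => y _.
  by rewrite mulrDl.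
have -> : 2 * Nc * F = Nc * F + Nc * F by ring.
rewrite addrACA; apply: le_trans h; rewrite -big_split; apply: ler_sum => k _ /=.
rewrite -big_split; apply: ler_sum => y _ /=.
apply: pol_powR; last exact: dxx_pol.
by apply: ltW; exact: lt_trans ltr01 p1.
Qed.

Theorem iint_dxx_le :
  (iint (fun v => ((`|dxx i j u v| `^ p)%:E)) <=
   (2 * Nc)%:E * iint (fun v => ((`|dt u v + Lop c u v| `^ p)%:E)))%E.
Proof.
have pp : 0 < p by exact: lt_trans ltr01 p1.
have [A A0 HA] := Cinf_c_vanish Hu.
have natb (x : R) : exists m : nat, x <= m%:R by exists (Num.Def.truncn x).+1; exact/ltW/truncnS_gt.
(* The starting time [b] can be as low as [a0 - tau] with [tau <= 1] and must be at least [A]. An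
   integer [a0] gives a whole number of time cells. *)
have [a0 ha0] := natb (A + 1).
have [Mc Mc0 c_bnd] := c_bounded a0%:R.
have [S [C [S0 C0 lat]]] := dxx_lattice_estimate a0%:R A0 HA.
have [W hW] := natb (A + S).
have AW : A <= W%:R by apply: le_trans hW; rewrite lerDl.
have W0 : 0 < W%:R :> R by exact: lt_le_trans A0 AW.
pose f (t : R) (x : 'rV[R]_d) := `|dxx i j u (vcons t x)| `^ p.
pose g (t : R) (x : 'rV[R]_d) := `|parF c u t x| `^ p.
have [Lf Lf0 lf] : exists2 L, 0 <= L & forall t, lipn L (f t).
  have [L L0 HL] := partial_lip Hu [:: lift ord0 i; lift ord0 j].
  have [B B0 HB] := Cinf_c_bounded Hu [:: lift ord0 i; lift ord0 j].
  exists (p * B `^ (p - 1) * L); first by rewrite !mulr_ge0 ?powR_ge0 // ltW.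
  by move=> t; apply: (lipn_powR p1 (lipn_slice t HL)) => v; exact: HB.
have vf t : vanishn W%:R (f t).
  by apply: vanishn_powR; [rewrite gt_eqF | apply: vanishn_le AW _; apply: vanishn_slice; exact: HA].
have vg t : vanishn W%:R (g t).
  by apply: vanishn_powR; [rewrite gt_eqF | apply: vanishn_le AW _; exact: parF_vanish].
have out t : ~~ (- a0%:R <= t <= a0%:R) -> A <= `|t|.
  move=> h; have : a0%:R < `|t| by rewrite ltNge ler_norml.
  by move: ha0; lra.
have [Lg Lg0 lg] : exists2 L, 0 <= L & forall t, lipn L (g t).
  have [L L0 HL] := parF_lip Hu c_bnd Mc0.
  have ez : forall a : 'I_d, `|((fun=> 0) a : int)%:~R : R| <= 2 by move=> a; rewrite normr0.
  have [B B0 HB] := parF_bounded Mc0 c_bnd ez Hu.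
  exists (p * B `^ (p - 1) * L); first by rewrite !mulr_ge0 ?powR_ge0 // ltW.
  move=> t; case: (boolP (- a0%:R <= t <= a0%:R)) => tT.
    by apply: (lipn_powR p1 (HL t tT)) => v; have [h _] := HB t v tT; exact: h.
  move=> v w del del0 _; rewrite /g !(parF_time_vanish c HA _ (out t tT)) subrr normr0.
  by rewrite !mulr_ge0 ?powR_ge0 // ltW.
have [sf [sf0 sfE sfm sfR]] := slice_integral Lf0 W0 (fun t v => powR_ge0 _ p) lf vf
   (fun x => measurable_powR_norm p (measurable_slice Hu [:: lift ord0 i; lift ord0 j] x)).
have [sg [sg0 sgE sgm sgR]] := slice_integral Lg0 W0 (fun t v => powR_ge0 _ p) lg vg
   (fun x => measurable_powR_norm p (parF_measurable Hu c_meas x)).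
rewrite /=; under eq_integral do rewrite sfE.
under [X in (_ <= _ * X)%E]eq_integral do rewrite sgE.
pose V := (2 * W%:R) ^+ d : R.
have V0 : 0 <= V by rewrite exprn_ge0 // mulr_ge0.
pose Qf := d%:R * Lf * V; pose Qg := d%:R * Lg * V.
have Qf0 : 0 <= Qf by rewrite !mulr_ge0.
have Qg0 : 0 <= Qg by rewrite !mulr_ge0.
have N20 : 0 <= 2 * Nc by rewrite mulr_ge0.
pose Ct := Qf + V * C + 2 * Nc * Qg.
have Ct0 : 0 <= Ct by rewrite !addr_ge0 // mulr_ge0.
have sfz t : a0%:R <= `|t| -> sf t = 0.
  move=> h; have := sfE t.
  have -> : (fun v => (f t v)%:E) = (fun _ : 'rV[R]_d => 0%E).
    apply/funext => v; rewrite /f.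
    have -> : dxx i j u (vcons t v) = 0.
      apply: (HA [:: lift ord0 i; lift ord0 j] _ ord0); rewrite vcons0.
      by apply: le_trans h; apply: le_trans ha0; rewrite lerDl.
    by rewrite normr0 powR0 // gt_eqF.
  by rewrite iint0 => -[<-].
apply: (offset_integral_le N20 Ct0 sfm sgm sf0 sg0 sfz) => n x n0 /andP[x0 xt].
have nR : 0 < n%:R :> R by rewrite ltr0n.
have n1 : 1 <= n%:R :> R by rewrite ler1n.
set tau := tau_ R n in x0 xt *; set K := (2 * a0 * n ^ 2)%N.
have tau0 : 0 < tau by rewrite invr_gt0 exprn_gt0.
have tau1 : tau <= 1 by rewrite invf_le1 ?exprn_gt0 // exprn_ege1.
have Kt : K%:R * tau = 2 * a0%:R.
  by rewrite /K natrM natrX natrM /tau /tau_ mulfK // gt_eqF // exprn_gt0.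
(* The offset grid is read backward from its last point, where [u] vanishes, because the scheme runs
   against time. *)
pose b := a0%:R - tau + x; pose t k := b - k%:R * tau.
have tE (k : nat) : (k < K)%N -> - a0%:R + (K - k.+1)%:R * tau + x = t k.
  move=> kK; rewrite natrB // mulrBl Kt /t /b -natr1; ring.
have re (h : R -> R) : \sum_(l < K) h (- a0%:R + l%:R * tau + x) = \sum_(k < K) h (t k).
  by rewrite (reindex_inj rev_ord_inj); apply: eq_bigr => k _ /=; rewrite tE.
rewrite !re.
have tT k : (k < K)%N -> - a0%:R <= t k <= a0%:R.
  move=> kK; have h1 : 0 <= k%:R * tau by rewrite mulr_ge0 // ltW.
  have h2 : 0 <= (K - k.+1)%:R * tau by rewrite mulr_ge0 // ltW.
  apply/andP; split; last by rewrite /t /b; move: h1 xt; lra.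
  by rewrite -tE //; move: h2 x0; lra.
have Ab : A <= b by rewrite /b; move: ha0 tau1 x0; lra.
have W1 : (0 < W)%N by rewrite -(ltr0n R).
have [N NE] := lattice_size W1 n0.
have mesh : N.+2%:R * eps_ R n = 2 * W%:R.
  by rewrite NE natrM natrX natrM /eps_; field; rewrite gt_eqF.
have e0 : 0 < eps_ R n by rewrite invr_gt0 mulr_gt0 // exprn_gt0.
have en : eps_ R n <= (n%:R)^-1.
  rewrite /eps_ lef_pV2 ?posrE ?mulr_gt0 ?exprn_gt0 //.
  by move: n1; move: (n%:R : R) => m m1; nra.
have latn := ler_wpM2l (exprn_ge0 d (ltW e0)) (lat W%:R n N K b n0 mesh hW Ab tT).
have sumE (h : R -> 'rV[R]_d -> R) (sh : R -> R) L : 0 <= L ->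
  (forall t N e, N%:R * e = 2 * W%:R -> 0 < e ->
     `|sh t - rsum (- W%:R) e N (h t)| <= d%:R * L * e * (2 * W%:R) ^+ d) ->
  `|\sum_(k < K) sh (t k) - eps_ R n ^+ d *
      \sum_(k < K) \sum_(y : 'rV['I_N.+2]_d) h (t k) (lat_pt W%:R (eps_ R n) y)|
     <= K%:R * (d%:R * L * V / n%:R).
  move=> L0 H; rewrite mulr_sumr -sumrB; apply: le_trans (ler_norm_sum _ _ _) _.
  apply: (@le_trans _ _ (\sum_(k < K) d%:R * L * V / n%:R)).
    apply: ler_sum => k _; rewrite -rsum_lattice; apply: le_trans (H _ _ _ mesh e0) _.
    by rewrite mulrAC ler_wpM2l // !mulr_ge0.
  by rewrite sumr_const card_ord -[leLHS]mulr_natl.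
have constE : eps_ R n ^+ d * \sum_(k < K) \sum_(y : 'rV['I_N.+2]_d) C / n%:R = K%:R * (V * C / n%:R).
  by rewrite lattice_const mesh; congr (_ * _); exact: mulrA.
rewrite [leRHS]mulrDr constE in latn.
apply: (assemble_le N20 (sumE f sf Lf Lf0 sfR) (sumE g sg Lg Lg0 sgR) latn).
Qed.
End Assembly.

Lemma ge0_poweR_le (R : realType) (x y : \bar R) r : 0 <= r -> (0 <= x)%E -> (x <= y)%E ->
  (poweR x r <= poweR y r)%E.
Proof.
move=> r0 x0 xy; apply: gt0_ler_poweR => //; rewrite in_itv /= leey andbT //.
exact: le_trans x0 xy.
Qed.

Lemma iint_ge0 (R : realType) n (f : 'rV[R]_n -> \bar R) : (forall v, 0 <= f v)%E -> (0 <= iint f)%E.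
Proof. by elim: n f => [|n IH] f f0 /=; [exact: f0 | apply: integral_ge0 => x _; exact: IH]. Qed.

Unset Implicit Arguments.
Set Strict Implicit.
Set Printing Implicit Defensive.

Theorem theorem2p4 (R : realType) (d : nat) (p0 : nat) (p : R) :
  (1 <= d)%N -> (1 <= p0)%N -> (p0 <= d)%N -> 1 < p ->
  exists M0 : R, 0 < M0 /\
  forall c : 'I_d -> 'I_d -> R -> R,
    (forall i j, measurable_fun [set: R] (c i j)) ->
    (forall i j (a b : R), exists M : R, forall t, a <= t <= b -> `|c i j t| <= M) ->
    (forall i j t, c i j t = c j i t) ->
    (forall t (xi : 'I_d -> R), 0 <= \sum_(i < d) \sum_(j < d) c i j t * xi i * xi j) ->
    (forall t (xi : 'I_d -> R),
        \sum_(j < d | (j < p0)%N) xi j ^+ 2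
          <= \sum_(i < d) \sum_(j < d) c i j t * xi i * xi j) ->
    forall u : 'rV[R]_d.+1 -> R, Cinf_c u ->
    forall i j : 'I_d, (i < p0)%N -> (j < p0)%N ->
      (LpnormRn p (dxx i j u)
        <= M0%:E * LpnormRn p (fun z => (dt u z + Lop c u z)%R))%E.
Proof.
move=> _ _ _ p1; have [Nc Nc0 heat] := @rheat_sol_Lp R p p1.
have p0' : 0 <= p^-1 by rewrite invr_ge0 ltW // (lt_trans ltr01 p1).
(* The added [1] makes [M0] positive even if [Nc] is zero. *)
have N1 : 0 < 2 * Nc + 1 by rewrite ltr_wpDl // mulr_ge0.
exists ((2 * Nc + 1) `^ p^-1); split; first exact: powR_gt0.
move=> c c_meas c_loc c_sym _ c_low u Hu i j ip jp.
have I0 (f : 'rV[R]_d.+1 -> R) : (0 <= iint (fun v => (`|f v| `^ p)%:E))%E.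
  by apply: iint_ge0 => v; rewrite lee_fin powR_ge0.
rewrite /LpnormRn -poweR_EFin -poweRM //; last by rewrite lee_fin ltW.
have le1 := iint_dxx_le p1 c_meas c_loc c_sym c_low Nc0 heat Hu ip jp.
have le2 : ((2 * Nc)%:E * iint (fun v => (`|dt u v + Lop c u v| `^ p)%:E) <=
            (2 * Nc + 1)%:E * iint (fun v => (`|dt u v + Lop c u v| `^ p)%:E))%E.
  by apply: lee_wpmul2r; [exact: I0 | rewrite lee_fin lerDl].
exact: ge0_poweR_le p0' (I0 _) (le_trans le1 le2).
Qed.
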